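(* Let $\Omega\subset\mathbb{R}^n$ be open and bounded with Lipschitz boundary, let $1\le q<\infty$, $0<\gamma\le\Gamma<\infty$, $u_0\in W^{1,q}(\Omega;\mathbb{R}^N)$, and let $F\in C(\mathbb{R}^{N\times n})$ be convex with $\gamma|z|\le F(z)\le\Gamma(1+|z|^q)$ for all $z\in\mathbb{R}^{N\times n}$. Then there exists $u\in BV(\Omega;\mathbb{R}^N)$ such that $$\overline{\mathscr{F}}^*_{u_0}[u;\Omega]\le\overline{\mathscr{F}}^*_{u_0}[v;\Omega]\qquad\text{for all }v\in BV(\Omega;\mathbb{R}^N).$$
   Context: $u_j\overset{*}{\rightharpoonup}u$ in $BV(\Omega;\mathbb{R}^N)$ means $u_j\to u$ strongly in $L^1(\Omega;\mathbb{R}^N)$ and $Du_j\overset{*}{\rightharpoonup}Du$ weakly* as finite $\mathbb{R}^{N\times n}$-valued Radon measures on $\Omega$. For $u\in BV(\Omega;\mathbb{R}^N)$, $$\overline{\mathscr{F}}^*_{u_0}[u;\Omega]:=\inf\Big\{\liminf_{j\to\infty}\int_\Omega F(\nabla u_j)\,dx:\ (u_j)\subset u_0+W^{1,q}_0(\Omega;\mathbb{R}^N),\ u_j\overset{*}{\rightharpoonup}u\text{ in }BV(\Omega;\mathbb{R}^N)\Big\}.$$ *)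

(* Defs.v *)
From HB Require Import structures.
From mathcomp Require Import all_boot all_order all_algebra.
From mathcomp Require Import all_classical all_reals all_analysis.

Set Implicit Arguments.
Unset Strict Implicit.
Unset Printing Implicit Defensive.

Import Order.TTheory GRing.Theory Num.Theory.
Import numFieldNormedType.Exports.

Local Open Scope classical_set_scope.
Local Open Scope ring_scope.

(* The sigma-algebra on matrices generated by the entries, i.e. the product
   (= Borel) sigma-algebra of R^(m x n). *)
Fact matrix_display : measure_display.
Proof. exact: default_measure_display. Qed.

Section matrix_measurable.
Variables (R : realType) (m n : nat).

Definition entry_preimages : set (set 'M[R]_(m, n)) :=
  [set A | exists i j, exists2 B : set (measurableTypeR R),
     measurable B & A = (fun M : 'M[R]_(m, n) => M i j) @^-1` B].

Let matrix_set0 : <<s entry_preimages >> set0.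
Proof. exact: sigma_algebra0. Qed.

Let matrix_setC A : <<s entry_preimages >> A -> <<s entry_preimages >> (~` A).
Proof. exact: sigma_algebraC. Qed.

Let matrix_bigcup (F : (set 'M[R]_(m, n))^nat) :
  (forall i, <<s entry_preimages >> (F i)) ->
  <<s entry_preimages >> (\bigcup_i (F i)).
Proof. exact: sigma_algebra_bigcup. Qed.

HB.instance Definition _ := @isMeasurable.Build matrix_display
  'M[R]_(m, n) <<s entry_preimages >> matrix_set0 matrix_setC matrix_bigcup.

Lemma measurable_entry (i : 'I_m) (j : 'I_n) :
  measurable_fun [set: 'M[R]_(m, n)]
    (fun M : 'M[R]_(m, n) => M i j : measurableTypeR R).
Proof.
move=> _ B mB; rewrite setTI; apply: sub_sigma_algebra.
by exists i, j; exists B.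
Qed.

Lemma measurable_fun_entryP d (T : measurableType d) (f : T -> 'M[R]_(m, n)) :
  (forall i j, measurable_fun setT (fun x => f x i j : measurableTypeR R)) ->
  measurable_fun setT f.
Proof.
move=> mf; apply: (@measurability _ _ _ _ _ f entry_preimages) => //.
move=> _ [_ [i [j [B mB ->]]] <-].
rewrite setTI -[X in measurable X]setTI.
exact: (mf i j measurableT B mB).
Qed.

End matrix_measurable.

(* Lebesgue measure on R^n, by recursion on n: the measure on R^(1 + n) is the
   image of the product of the measures on R and R^n under the map
   (a, v) |-> (a, v_1, ..., v_n). *)
Section lebesgue_rV.
Variable R : realType.

Definition rV_cons n (p : measurableTypeR R * 'rV[R]_n) : 'rV[R]_n.+1 :=
  row_mx (const_mx p.1 : 'rV_1) p.2.

Definition rV_uncons n (v : 'rV[R]_n.+1) : measurableTypeR R * 'rV[R]_n :=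
  (v 0 0, \row_k v 0 (lift 0 k)).

Lemma rV_consK n : cancel (@rV_cons n) (@rV_uncons n).
Proof.
case=> a v; congr pair; first by rewrite /rV_cons !mxE; case: splitP => // j _; rewrite mxE.
apply/rowP => k; rewrite !mxE; case: splitP => j /=; first by case: j => -[].
by rewrite /bump/= !add1n => -[]/val_inj ->.
Qed.

Lemma rV_cons0 n (p : measurableTypeR R * 'rV[R]_n) : rV_cons p 0 0 = p.1.
Proof. by rewrite -[in RHS](rV_consK p). Qed.

Lemma rV_consS n (p : measurableTypeR R * 'rV[R]_n) k :
  rV_cons p 0 (lift ord0 k) = p.2 0 k.
Proof. by rewrite -[in RHS](rV_consK p) [RHS]mxE. Qed.

Lemma measurable_rV_cons n : measurable_fun [set: _] (@rV_cons n).
Proof.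
apply: measurable_fun_entryP => i j; have [k jk|k jk] := splitP (j : 'I_(1 + n)).
  rewrite (_ : (fun _ => _) = fst); first exact: measurable_fst.
  apply/funext => -[a v]; rewrite /rV_cons (_ : j = lshift n k); last exact: val_inj.
  by rewrite (@row_mxEl _ 1 1 n) mxE.
rewrite (_ : (fun _ => _) = (fun v : 'rV[R]_n => v i k : measurableTypeR R) \o snd).
  exact: measurableT_comp (measurable_entry _ _) measurable_snd.
apply/funext => -[a v]; rewrite /rV_cons (_ : j = rshift 1 k); last exact: val_inj.
by rewrite (@row_mxEr _ 1 1 n).
Qed.

Lemma measurable_rV_uncons n : measurable_fun [set: _] (@rV_uncons n).
Proof.
apply: measurable_fun_pair; first exact: measurable_entry.
apply: measurable_fun_entryP => i j.
rewrite (_ : (fun _ => _) =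
    (fun v : 'rV[R]_n.+1 => v 0 (lift 0 j) : measurableTypeR R)).
  exact: measurable_entry.
by apply/funext => v; rewrite mxE.
Qed.

Section step.
Variables (n : nat) (mu : {sigma_finite_measure set 'rV[R]_n -> \bar R}).

Definition rV_measureS : set 'rV[R]_n.+1 -> \bar R :=
  pushforward (@lebesgue_measure R \x mu)%E (@rV_cons n).

Let mf : measurable_fun [set: _] (@rV_cons n) := @measurable_rV_cons n.

Let rV_measureS0 : rV_measureS set0 = 0%E.
Proof. exact: measure0. Qed.

Let rV_measureS_ge0 A : (0 <= rV_measureS A)%E.
Proof. exact: measure_ge0. Qed.

Let rV_measureS_sigma_additive : semi_sigma_additive rV_measureS.
Proof. exact: measure_semi_sigma_additive. Qed.

HB.instance Definition _ := isMeasure.Build _ _ _ rV_measureS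
  rV_measureS0 rV_measureS_ge0 rV_measureS_sigma_additive.

Let rV_measureS_sigma_finite : sigma_finite setT rV_measureS.
Proof.
have /sigma_finiteP[F [TF ndF mF]] := sigma_finiteT (@lebesgue_measure R).
have /sigma_finiteP[G [TG ndG mG]] := sigma_finiteT mu.
exists (fun k => @rV_uncons n @^-1` (F k `*` G k)).
  rewrite -preimage_bigcup [X in _ @^-1` X](_ : _ = setT) ?preimage_setT//.
  apply/seteqP; split => // -[x y] _.
  have [i _ Fx] : (\bigcup_i F i) x by rewrite -TF.
  have [j _ Gy] : (\bigcup_i G i) y by rewrite -TG.
  exists (maxn i j) => //; split => /=.
    by move: x Fx; exact/subsetPset/ndF/leq_maxl.
  by move: y Gy; exact/subsetPset/ndG/leq_maxr.
move=> k; have [mFk Fk] := mF k; have [mGk Gk] := mG k; split.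
  rewrite -[X in measurable X]setTI; apply: measurable_rV_uncons => //.
  exact: measurableX.
rewrite /rV_measureS /pushforward -comp_preimage.
rewrite (_ : _ \o _ = id) ?preimage_id; last by apply/funext/rV_consK.
by rewrite product_measure1E// lte_mul_pinfty// ge0_fin_numE.
Qed.

HB.instance Definition _ := Measure_isSigmaFinite.Build _ _ _ rV_measureS
  rV_measureS_sigma_finite.

End step.

Fixpoint lebesgue_rV n : {sigma_finite_measure set 'rV[R]_n -> \bar R} :=
  if n is n'.+1 then rV_measureS (lebesgue_rV n') else @dirac _ 'rV[R]_0 0 R.

Lemma lebesgue_rV_box n (B : 'I_n -> set (measurableTypeR R)) :
  (forall k, measurable (B k)) ->
  lebesgue_rV n [set v | forall k, B k (v 0 k)] =
  (\prod_(k < n) @lebesgue_measure R (B k))%E.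
Proof.
elim: n B => [|n IHn] B mB /=.
  by rewrite big_ord0 diracE mem_set//= => -[].
rewrite big_ord_recl -IHn; last by move=> k; exact: mB.
rewrite -product_measure1E//; last first.
  rewrite [X in measurable X](_ : _ = \bigcap_(k in [set: 'I_n])
     (fun v : 'rV[R]_n => v 0 k) @^-1` B (lift ord0 k)).
    apply: fin_bigcap_measurable => // k _.
    rewrite -[X in measurable X]setTI; exact: measurable_entry.
  by apply/seteqP; split => v /= h k => [_|]; exact: h.
rewrite /rV_measureS /pushforward; congr (_ _).
apply/seteqP; split => -[a v] /=.
  move=> h; split => [|k]; first by have := h ord0; rewrite rV_cons0.
  by have := h (lift ord0 k); rewrite rV_consS.
move=> [Ba Bv] k; have [j ->|->] := unliftP ord0 k; last by rewrite rV_cons0.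
by rewrite rV_consS; exact: Bv.
Qed.

End lebesgue_rV.

Section geometry.
Variables (R : realType) (n : nat).
Implicit Types (x y e : 'rV[R]_n) (Omega : set 'rV[R]_n).

Definition dotv x y : R := \sum_(k < n) x 0 k * y 0 k.

(* Near each boundary point, Omega is the strict supergraph of a Lipschitz
   function in some unit direction e: a point y has height <y, e> over its
   projection y - <y, e> e on the hyperplane orthogonal to e, and only the
   values of g on that hyperplane matter. *)
Definition lipschitz_boundary Omega : Prop :=
  forall x, (closure Omega `&` closure (~` Omega)) x ->
  exists (e : 'rV[R]_n) (g : 'rV[R]_n -> R) (r : R),
    [/\ dotv e e = 1, [lipschitz g y | y in [set: 'rV[R]_n]], 0 < r &
      forall y, ball x r y ->
        Omega y <-> g (y - dotv y e *: e) < dotv y e].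

End geometry.

(* The Euclidean (Frobenius) norm; the library norm on matrices is the
   maximum of the absolute values of the entries. *)
Definition enorm (R : realType) m n (z : 'M[R]_(m, n)) : R :=
  Num.sqrt (\sum_(i < m) \sum_(j < n) z i j ^+ 2).

Section test_functions.
Variables (R : realType) (n : nat).
Implicit Types (Omega : set 'rV[R]_n) (phi : 'rV[R]_n -> R).

Definition basis_vec (j : 'I_n) : 'rV[R]_n := delta_mx 0 j.

Definition pderiv (j : 'I_n) phi : 'rV[R]_n -> R :=
  fun x => 'D_(basis_vec j) phi x.

Definition smooth phi : Prop :=
  forall s : seq 'I_n, let dphi := foldr pderiv phi s in
    continuous dphi /\ (forall j x, derivable dphi x (basis_vec j)).

(* C_c^oo(Omega) *)
Definition test_function Omega phi : Prop :=
  let supp := closure [set x | phi x != 0] in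
  [/\ smooth phi, compact supp & supp `<=` Omega].

(* C_0(Omega): the continuous functions on Omega that vanish at the boundary,
   i.e., the closure of C_c(Omega) for the uniform norm. *)
Definition C0_function Omega phi : Prop :=
  {within Omega, continuous phi} /\
  (forall eps, 0 < eps -> exists K, [/\ compact K, K `<=` Omega &
    forall x, Omega x -> ~ K x -> `|phi x| < eps]).

End test_functions.

(* Functions on Omega are represented by total functions on R^n of which only
   the values on Omega matter. *)
Section Lebesgue_Sobolev.
Variables (R : realType) (n : nat).
Implicit Types (Omega : set 'rV[R]_n) (f g : 'rV[R]_n -> R).
Local Notation leb := (lebesgue_rV R n).

Definition Lp_on Omega (p : R) f : Prop := (f \_ Omega) \in Lfun leb p%:E.

Definition Lp_cvg Omega (p : R) (f_ : nat -> 'rV[R]_n -> R) f : Prop :=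
  (fun k => Lnorm leb p%:E (EFin \o ((f_ k \- f) \_ Omega))) @ \oo --> 0%E.

Definition L1loc Omega f : Prop :=
  forall K, compact K -> K `<=` Omega -> leb.-integrable K (EFin \o f).

Definition weak_pderiv Omega (j : 'I_n) f g : Prop :=
  forall phi, test_function Omega phi ->
    \int[leb]_(x in Omega) (f x * pderiv j phi x) =
    - \int[leb]_(x in Omega) (g x * phi x).

Variable N : nat.
Implicit Types (u w : 'rV[R]_n -> 'cV[R]_N) (G : 'rV[R]_n -> 'M[R]_(N, n)).

Definition is_weak_grad Omega u G : Prop :=
  forall i j, L1loc Omega (fun x => G x i j) /\
    weak_pderiv Omega j (fun x => u x i 0) (fun x => G x i j).

(* A representative of the weak gradient; it is unique up to null sets. *)
Definition wgrad Omega u : 'rV[R]_n -> 'M[R]_(N, n) :=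
  xget (cst 0) [set G | is_weak_grad Omega u G].

Definition W1 Omega (q : R) u : Prop :=
  [/\ forall i, Lp_on Omega q (fun x => u x i 0),
      exists G, is_weak_grad Omega u G &
      forall i j, Lp_on Omega q (fun x => wgrad Omega u x i j)].

(* The closure of C_c^oo(Omega; R^N) in W^{1,q}(Omega; R^N). *)
Definition W1_0 Omega (q : R) w : Prop :=
  W1 Omega q w /\
  exists phi_ : nat -> 'rV[R]_n -> 'cV[R]_N,
    [/\ forall k i, test_function Omega (fun x => phi_ k x i 0),
        forall i, Lp_cvg Omega q (fun k x => phi_ k x i 0) (fun x => w x i 0) &
        forall i j, Lp_cvg Omega q
          (fun k => pderiv j (fun x => phi_ k x i 0))
          (fun x => wgrad Omega w x i j)].

End Lebesgue_Sobolev.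

(* Integral of a real function with respect to a charge (finite signed
   measure); it does not depend on the Hahn decomposition that is chosen. *)
Definition charge_integral d (T : measurableType d) (R : realType)
    (nu : {charge set T -> \bar R}) (D : set T) (f : T -> R) : R :=
  let P := cid (Hahn_decomposition nu) in
  let N := cid (projT2 P) in
  \int[jordan_pos (projT2 N)]_(x in D) f x -
  \int[jordan_neg (projT2 N)]_(x in D) f x.

Section BV.
Variables (R : realType) (n N : nat).
Implicit Types (Omega : set 'rV[R]_n) (u v : 'rV[R]_n -> 'cV[R]_N).
Local Notation leb := (lebesgue_rV R n).

(* R^(N x n)-valued finite Borel measures, by entries. *)
Definition matrix_charge := 'I_N -> 'I_n -> {charge set 'rV[R]_n -> \bar R}.

(* mu is a measure on Omega, i.e., it is carried by Omega, and it is the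
   distributional derivative of u. *)
Definition is_deriv_measure Omega u (mu : matrix_charge) : Prop :=
  forall i j,
    (forall A, measurable A -> mu i j A = mu i j (A `&` Omega)) /\
    (forall phi, test_function Omega phi ->
      \int[leb]_(x in Omega) (u x i 0 * pderiv j phi x) =
      - charge_integral (mu i j) Omega phi).

Definition BV Omega u : Prop :=
  (forall i, Lp_on Omega 1 (fun x => u x i 0)) /\
  exists mu, is_deriv_measure Omega u mu.

(* The measure Du; it is the zero measure by convention if u is not in BV. *)
Definition deriv_measure Omega u : matrix_charge :=
  if pselect (exists mu, is_deriv_measure Omega u mu) is left h
  then projT1 (cid h) else fun _ _ => czero.

Definition BV_weak_star_cvg Omega (u_ : nat -> 'rV[R]_n -> 'cV[R]_N) u : Prop :=
  [/\ forall k, BV Omega (u_ k), BV Omega u,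
      forall i, Lp_cvg Omega 1 (fun k x => u_ k x i 0) (fun x => u x i 0) &
      forall i j psi, C0_function Omega psi ->
        (fun k => charge_integral (deriv_measure Omega (u_ k) i j) Omega psi)
          @ \oo --> charge_integral (deriv_measure Omega u i j) Omega psi].

Definition relaxed_functional (F : 'M[R]_(N, n) -> R) (q : R)
    (u0 : 'rV[R]_n -> 'cV[R]_N) Omega u : \bar R :=
  ereal_inf [set l | exists u_ : nat -> 'rV[R]_n -> 'cV[R]_N,
    [/\ forall k, W1_0 Omega q (u_ k \- u0), BV_weak_star_cvg Omega u_ u &
        l = limn_einf
              (fun k => \int[leb]_(x in Omega) (F (wgrad Omega (u_ k) x))%:E)%E]].

End BV.

(* Main.v *)
From HB Require Import structures.
Require Import Defs.
From mathcomp Require Import all_boot all_order all_algebra.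
From mathcomp Require Import all_classical all_reals all_analysis.
From mathcomp Require Import measurable_realfun ring lra zify.
Set Implicit Arguments.
Unset Strict Implicit.
Unset Printing Implicit Defensive.
Import Order.TTheory GRing.Theory Num.Theory.
Import numFieldNormedType.Exports.
Local Open Scope classical_set_scope.
Local Open Scope ring_scope.

(** The proof is the direct method of the calculus of variations. Let m be the
    infimum of the energy, the integral of F (grad w), over w in u_0 + W^{1,q}_0.
    Every energy that occurs in the definition of the relaxed functional is at
    least m, so the relaxed functional is at least m everywhere
    ([relaxed_functional_ge]). It is therefore enough to find one u in BV at which
    it is at most m. If m is infinite then any u in BV will do. Otherwise take a
    minimizing sequence u_k. Since F (z) >= gamma |z|, the gradients of the u_k are bounded in
    L^1 ([energy_controls_gradient]), and by [W1_0_compactness] a subsequence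
    converges weakly-star in BV to some u. The subsequence itself is admissible in
    the definition of the relaxed functional at u, and its energies tend to m.

    The compactness theorem rests on three facts.

    - Bounded sequences of L^1 functions have subsequences that converge weakly as
      measures ([L1_weak_compactness]). The compact set is cut into nested finite
      partitions, by the codes that record to which balls of a countable base a
      point belongs. Along a subsequence the masses of all cells converge, and
      these limit masses are the lengths of nested intervals; the limit measure is
      the law of the point to which the cells shrink when a number is drawn from
      these intervals ([skorokhod_limit]). This representation replaces the
      Riesz representation theorem.

    - Functions in W^{1,q}_0 are, by definition, limits of test functions, so
      only test functions phi with bounded derivatives in L^1 have to be treated
      ([W1_0_test_approx]). Translating phi by more than the size of Omega
      bounds phi by its derivative ([poincare]). Translating it by a small vector
      shows that mollification at scale h costs at most h times the norm of the
      gradient, while the mollifications at a fixed scale converge pointwise as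
      soon as the functions converge weakly; so weak convergence improves to
      convergence in L^1 ([rellich], [L1_complete]).

    - The limits of the gradients are the derivative of the limit function, since
      integration by parts against test functions passes to the limit, and all
      bounded measurable functions have the same integral with respect to two
      charges that agree on test functions ([charge_integral_unique]). Functions
      in C_0(Omega) extend by zero to bounded continuous functions, so that the
      convergence as measures is the one that the definition of BV asks for
      ([BV_weak_star_limit]). *)

(** * Borel sets of matrices *)

Section matrix_borel.
Variables (R : realType) (m n : nat).

Lemma measurable_mx_ball (c : 'M[R]_(m, n)) (e : R) : measurable (ball c e).
Proof.
have [e0|e0] := ltP 0 e; last first.
  rewrite (_ : ball c e = set0); first exact: measurable0.
  by apply/seteqP; split => // y [/lt_geF]; rewrite e0.
rewrite (_ : ball c e = \bigcap_(i in [set: 'I_m]) \bigcap_(j in [set: 'I_n])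
   (fun M : 'M[R]_(m, n) => M i j) @^-1` (ball (c i j) e)).
  apply: fin_bigcap_measurable => // i _; apply: fin_bigcap_measurable => // j _.
  rewrite -[X in measurable X]setTI; apply: measurable_entry => //.
  exact: measurable_ball.
by apply/seteqP; split => y; [move=> [_ h] i _ j _; exact: h|move=> h; split => // i j; exact: h].
Qed.

(** A second-countability statement, with room to spare: the balls with rational
   centres and radii 1/k, each of which may be enlarged by a factor 2 inside the
   open set that it helps to cover. *)
Lemma mx_ball_cover : exists (c : nat -> 'M[R]_(m, n)) (r : nat -> R),
  (forall k, 0 < r k) /\
  forall U, open U -> forall x, U x ->
    exists2 k, ball (c k) (r k) x & ball (c k) (r k *+ 2) `<=` U.
Proof.
pose e (k : nat) : R := k.+1%:R^-1.
pose B k := unpickle k : option ('M[rat]_(m, n) * nat).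
exists (fun k => if B k is Some pl then map_mx ratr pl.1 else 0).
exists (fun k => if B k is Some pl then e pl.2 else 1).
split => [k|U oU x Ux]; first by case: (B k) => // -[p l]; rewrite /e invr_gt0.
have /nbhs_ballP[r /= r0 xrU] : nbhs x U by exact: open_nbhs_nbhs.
pose l := Num.trunc ((r / 3)^-1).
have er : e l < r / 3.
  by rewrite /e invf_plt ?posrE ?ltr0n// ?divr_gt0//; exact: truncnS_gt.
have e0 : 0 < e l by rewrite invr_gt0 ltr0n.
have H i j : exists p : rat, x i j - e l < ratr p < x i j + e l.
  have : x i j - e l < x i j + e l by rewrite ltrBlDr -addrA ltrDl addr_gt0.
  by move=> /rat_in_itvoo[p]; rewrite in_itv/= => ?; exists p.
pose p : 'M[rat]_(m, n) :=
  \matrix_(i, j) xget 0 [set p | x i j - e l < ratr p < x i j + e l].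
exists (pickle (p, l)); rewrite /B pickleK/=.
  split => // i j; rewrite /ball/= !mxE.
  by have /(xgetPex 0) /= := H i j; set y := xget _ _; rewrite ltr_distl; lra.
move=> y yp; apply: xrU; apply: (@le_ball _ _ _ (e l + e l *+ 2)).
  by rewrite mulr2n; lra.
apply: ball_triangle yp; apply: ball_sym; split => // i j; rewrite /ball/= !mxE.
by have /(xgetPex 0) /= := H i j; set z := xget _ _; rewrite ltr_distl; lra.
Qed.

Lemma open_mx_measurable (U : set 'M[R]_(m, n)) : open U -> measurable U.
Proof.
move=> oU; have [c [r [r0 H]]] := mx_ball_cover.
rewrite (_ : U = \bigcup_(k in [set k | ball (c k) (r k *+ 2) `<=` U]) ball (c k) (r k)).
  by apply: bigcup_measurable => k _; exact: measurable_mx_ball.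
apply/seteqP; split => [x /(H _ oU)[k xk kU]|x [k /= kU xk]]; first by exists k.
by apply: kU; apply: le_ball xk; rewrite mulr2n lerDl ltW.
Qed.

Lemma continuous_mx_measurable (f : 'M[R]_(m, n) -> R) :
  continuous f -> measurable_fun [set: 'M[R]_(m, n)] (f : _ -> measurableTypeR R).
Proof.
move=> /continuousP cf; apply: (measurability _ (RGenOpens.measurableE R)).
move=> _ [_ [a [b ->] <-]]; rewrite setTI; apply: open_mx_measurable.
exact/cf/interval_open.
Qed.

End matrix_borel.

(** * Smooth bump functions *)

Section bump.
Variable R : realType.

(** It is enough to treat monomials: e^s = (e^{s/k})^k >= (s/k)^k, hence
    s^k e^{-s} <= k^k. *)
Lemma polyexp_bound (P : {poly R}) :
  exists2 C : R, 0 <= C & forall s, 0 < s -> `|P.[s]| * expR (- s) <= C.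
Proof.
have mono k : exists2 C : R, 0 <= C & forall s, 0 < s -> s ^+ k * expR (- s) <= C.
  case: k => [|k].
    exists 1 => // s s0; rewrite expr0 mul1r.
    by rewrite -[leRHS]expR0 ler_expR oppr_le0 ltW.
  exists (k.+1%:R ^+ k.+1) => [|s s0]; first exact: exprn_ge0.
  rewrite expRN ler_pdivrMr ?expR_gt0//.
  have -> : s = k.+1%:R * (s / k.+1%:R) by rewrite mulrCA divff ?mulr1// pnatr_eq0.
  rewrite expRM_natl exprMn ler_wpM2l ?exprn_ge0// lerXn2r ?nnegrE ?expR_ge0//.
    by rewrite divr_ge0// ltW.
  by apply: le_trans (expR_ge1Dx _); rewrite lerDr.
pose C k := s2val (cid2 (mono k)).
have C0 k : 0 <= C k by rewrite /C; case: cid2.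
have Cb k s : 0 < s -> s ^+ k * expR (- s) <= C k by rewrite /C; case: cid2 => ? ? /=; apply.
exists (\sum_(i < size P) `|P`_i| * C i) => [|s s0].
  by apply: sumr_ge0 => i _; rewrite mulr_ge0.
rewrite horner_coef (le_trans (ler_wpM2r (expR_ge0 _) (ler_norm_sum _ _ _)))//.
rewrite mulr_suml ler_sum// => i _.
rewrite normrM -mulrA; apply: ler_wpM2l => //.
by rewrite ger0_norm ?Cb// exprn_ge0// ltW.
Qed.

(** This family, P(1/t) e^{-1/t} for t > 0 extended by 0, is closed under
    differentiation, [dflat] being the effect on P. *)
Definition flat (P : {poly R}) (t : R) : R :=
  if 0 < t then P.[t^-1] * expR (- t^-1) else 0.

Definition dflat (P : {poly R}) : {poly R} := 'X^2 * (P - P^`()).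

(** The quadratic bound makes the derivative at 0 vanish, where the two
    branches of [flat] meet. *)
Lemma flat_quadratic P : exists2 C : R, 0 <= C & forall t, `|flat P t| <= C * t ^+ 2.
Proof.
have [C C0 Cb] := polyexp_bound ('X^2 * P); exists C => // t.
rewrite /flat; case: ifPn => [t0|_]; last by rewrite normr0 mulr_ge0// sqr_ge0.
have := Cb t^-1; rewrite invr_gt0 => /(_ t0).
rewrite hornerM hornerXn normrM (ger0_norm (sqr_ge0 _)) -mulrA.
rewrite exprVn mulrC ler_pdivrMr ?exprn_gt0// normrM.
by rewrite (ger0_norm (expR_ge0 _)).
Qed.

Lemma is_derive_line (V : normedModType R) (f : V -> R) x v df :
  is_derive (0 : R) 1 (fun h : R => f (h *: v + x)) df -> is_derive x v f df.
Proof.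
move=> [d1 d2]; apply: DeriveDef; first exact: (iffRL (derivable1P f x v) d1).
rewrite -d2 /derive; set A := fun h => h^-1 *: _; set B := fun h => h^-1 *: _.
suff -> : A = B by []; apply/funext => h; rewrite /A /B.
by rewrite /= [h *: 1]mulr1 addr0 scale0r add0r.
Qed.

Lemma is_derive_flat P (t : R) : is_derive t (1 : R) (flat P) (flat (dflat P) t).
Proof.
have [t0|t0|->] := ltgtP t 0.
- rewrite {2}/flat ltNge (ltW t0)/=.
  apply: (near_eq_is_derive (f := cst 0)).
  near=> s; rewrite /flat ltNge ltW//=; near: s.
  exact: (lt_nbhsl t0).
- apply: (near_eq_is_derive (f := (fun s => P.[s] * expR (- s)) \o (fun s => s^-1))).
    near=> s; rewrite /flat ifT//; near: s; exact: (lt_nbhsr t0).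
  have dE : is_derive t^-1 1 (fun s : R => expR (- s)) (- expR (- t^-1)).
    have dN : is_derive t^-1 1 (fun s : R => - s) (- 1).
      exact: (is_deriveN (is_derive_id (V := R^o) _ _)).
    rewrite -mulrN1.
    exact: (is_derive1_comp (is_derive_expR (- t^-1)) dN).
  have dV : is_derive t 1 (fun s : R => s^-1) (- t ^- 2).
    have tn0 : (id t : R) != 0 by rewrite gt_eqF.
    have := is_deriveV tn0 (is_derive_id (V := R^o) _ 1).
    by rewrite /GRing.scale/= mulr1.
  have := is_derive1_comp (is_deriveM (is_derive_poly P t^-1) dE) dV.
  move/is_derive_eq; apply.
  rewrite /flat t0 /dflat !hornerE /GRing.scale/= exprVn.
  by ring.
- have [C C0 Cb] := flat_quadratic P.
  have flat0 Q : flat Q 0 = 0 by rewrite /flat ltxx.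
  have lim0 : h^-1 *: ((flat P \o shift 0) (h *: 1) - flat P 0) @[h --> 0^'] --> (0 : R).
    apply/cvgr0Pnorm_lt => e e0.
    near=> h.
    have h0 : h != 0 by near: h; exact: nbhs_dnbhs_neq.
    rewrite /= flat0 subr0 addr0 [h *: 1]mulr1 normrZ normfV.
    rewrite ltr_pdivrMl ?normr_gt0//.
    apply: le_lt_trans (Cb h) _; rewrite -real_normK ?num_real// expr2 mulrCA.
    rewrite ltr_pM2l ?normr_gt0//.
    have : `|h| < e / (C + 1).
      near: h; apply: dnbhs0_lt; by rewrite divr_gt0// ltr_wpDl.
    rewrite ltr_pdivlMr ?ltr_wpDl// => /(le_lt_trans _); apply.
    by rewrite mulrC ler_wpM2l// lerDl.
  by rewrite flat0; split; [apply/cvg_ex; exists 0|exact/cvg_lim].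
Unshelve. all: by end_near. Qed.
End bump.

Section bump_algebra.
Variables (R : realType) (n : nat).
Implicit Types (phi psi : 'rV[R]_n -> R) (x : 'rV[R]_n).

(** Smoothness quantifies over all iterated partial derivatives; it is proved
    for a class of functions that is visibly stable under them. *)
Inductive bump_alg : ('rV[R]_n -> R) -> Prop :=
| bump_cst c : bump_alg (cst c)
| bump_flat P i c d : bump_alg (fun x => flat P (c * x 0 i + d))
| bump_add phi psi : bump_alg phi -> bump_alg psi -> bump_alg (phi + psi)
| bump_mul phi psi : bump_alg phi -> bump_alg psi -> bump_alg (phi * psi).

Lemma is_derive_flat_coord P i (c d : R) j x :
  is_derive x (basis_vec R j) (fun x => flat P (c * x 0 i + d))
    (flat (dflat P) (c * x 0 i + d) * (c * (i == j)%:R)).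
Proof.
apply: is_derive_line.
have -> : (fun h : R => flat P (c * (h *: basis_vec R j + x) 0 i + d)) =
   flat P \o (fun h => h * (c * (i == j)%:R) + (c * x 0 i + d)).
  by apply/funext => h /=; rewrite !mxE eqxx/= eq_sym; congr flat; ring.
have dl : is_derive (0 : R) (1 : R)
   (fun h : R => h * (c * (i == j)%:R) + (c * x 0 i + d)) (c * (i == j)%:R).
  have := is_deriveD (is_deriveM (is_derive_id (V := R^o) 0 1)
    (is_derive_cst (V := R^o) (W := R^o) (c * (i == j)%:R) 0 1))
    (is_derive_cst (V := R^o) (W := R^o) (c * x 0 i + d) 0 1).
  by rewrite /GRing.scale/= mul0r add0r mulr1 addr0.
have := @is_derive1_comp _ (flat P)
  (fun h => h * (c * (i == j)%:R) + (c * x 0 i + d)) 0 _ _ (is_derive_flat P _) dl.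
by rewrite /= mul0r add0r.
Qed.

Lemma bump_alg_derive phi j : bump_alg phi ->
  exists2 psi, bump_alg psi & forall x, is_derive x (basis_vec R j) phi (psi x).
Proof.
elim=> {phi} [c|P i c d|phi psi _ [dphi bphi Hphi] _ [dpsi bpsi Hpsi]
  |phi psi sphi [dphi bphi Hphi] spsi [dpsi bpsi Hpsi]].
- by exists (cst 0) => [|x]; [exact: bump_cst|exact: is_derive_cst].
- exists ((fun x => flat (dflat P) (c * x 0 i + d)) * cst (c * (i == j)%:R)).
    by apply: bump_mul; [exact: bump_flat|exact: bump_cst].
  by move=> x; exact: is_derive_flat_coord.
- by exists (dphi + dpsi) => [|x]; [exact: bump_add|exact: is_deriveD].
- exists (phi * dpsi + psi * dphi) => [|x]; last exact: is_deriveM.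
  by apply: bump_add; exact: bump_mul.
Qed.

Lemma flat_continuous (P : {poly R}) : continuous (flat P).
Proof.
move=> t; apply: differentiable_continuous; apply/derivable1_diffP.
by have [] := is_derive_flat P t.
Qed.

Lemma continuous_affine_coord (c d : R) (i : 'I_n) :
  continuous (fun x : 'rV[R]_n => c * x 0 i + d).
Proof.
move=> x.
apply: (@continuousD R R^o 'rV[R]_n (fun x : 'rV[R]_n => c * x 0 i) (cst d)).
  apply: (@continuousM R 'rV[R]_n (cst c) (fun x : 'rV[R]_n => x 0 i)).
    exact: cst_continuous.
  exact: coord_continuous.
exact: cst_continuous.
Qed.

Lemma bump_alg_continuous phi : bump_alg phi -> continuous phi.
Proof.
elim=> {phi} [c|P i c d|phi psi _ cphi _ cpsi|phi psi _ cphi _ cpsi] x.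
- exact: cst_continuous.
- apply: (@continuous_comp _ _ _ (fun x : 'rV[R]_n => c * x 0 i + d) (flat P)).
    exact: continuous_affine_coord.
  exact: flat_continuous.
- exact: (continuousD (cphi x) (cpsi x)).
- exact: (continuousM (cphi x) (cpsi x)).
Qed.

Lemma bump_alg_smooth phi : bump_alg phi -> smooth phi.
Proof.
move=> bphi s.
have [psi bpsi ->] : exists2 psi, bump_alg psi & foldr (@pderiv R n) phi s = psi.
  elim: s => [|j s [psi bpsi /= ->]]; first by exists phi.
  have [dpsi bdpsi H] := bump_alg_derive j bpsi.
  exists dpsi => //; apply/funext => x; rewrite /pderiv.
  by have [_ ->] := H x.
split; first exact: bump_alg_continuous.
by move=> j x; have [dpsi _ /(_ x)[]] := bump_alg_derive j bpsi.
Qed.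

Lemma bump_alg_prod (I : Type) (s : seq I) (F : I -> 'rV[R]_n -> R) :
  (forall i, bump_alg (F i)) -> bump_alg (\prod_(i <- s) F i).
Proof.
move=> bF; elim: s => [|i s IH]; first by rewrite big_nil; exact: bump_cst.
by rewrite big_cons; exact: bump_mul.
Qed.

Lemma test_function_bounded_supp Omega phi (K : set 'rV[R]_n) :
  smooth phi -> compact K -> K `<=` Omega ->
  (forall x, ~ K x -> phi x = 0) -> test_function Omega phi.
Proof.
move=> sphi cK KO phi0.
have sK : closure [set x | phi x != 0] `<=` K.
  have /closure_id -> : closed K by exact: compact_closed.
  by apply: closureS => x /=; apply: contraNP => /phi0 ->.
split => //; last exact: subset_trans KO.
by apply: subclosed_compact cK sK; exact: closed_closure.
Qed.

End bump_algebra.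

Section ball_bump.
Variables (R : realType) (n : nat).
Implicit Types (c x : 'rV[R]_n).

(** A bump that vanishes exactly off the sup-norm ball of centre c and radius
    r: each factor e^{-1/t} has k+1 times the distance to a face as t, so that
    the bump tends to 1 on this ball as k grows. *)
Definition ball_bump c (r : R) (k : nat) : 'rV[R]_n -> R :=
  \prod_(i < n) ((fun x => flat 1 (k.+1%:R * x 0 i + k.+1%:R * (r - c 0 i))) *
                 (fun x => flat 1 (- k.+1%:R * x 0 i + k.+1%:R * (r + c 0 i)))).

Lemma bump_alg_ball_bump c r k : bump_alg (ball_bump c r k).
Proof. by apply: bump_alg_prod => i; apply: bump_mul; exact: bump_flat. Qed.

Lemma flat1E (t : R) : flat 1 t = if 0 < t then expR (- t^-1) else 0.
Proof. by rewrite /flat hornerC mul1r. Qed.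

Lemma flat1_ge0 (t : R) : 0 <= flat 1 t.
Proof. by rewrite flat1E; case: ifP => // _; exact: expR_ge0. Qed.

Lemma flat1_le1 (t : R) : flat 1 t <= 1.
Proof.
rewrite flat1E; case: ifP => // t0.
by rewrite -expR0 ler_expR oppr_le0 invr_ge0 ltW.
Qed.

Lemma ball_bumpE c r k x : ball_bump c r k x =
  \prod_(i < n) (flat 1 (k.+1%:R * (x 0 i - (c 0 i - r))) *
                 flat 1 (k.+1%:R * (c 0 i + r - x 0 i))).
Proof.
rewrite /ball_bump fct_prodE; apply: eq_bigr => i _; rewrite !fctE.
by congr (flat _ _ * flat _ _); ring.
Qed.

Lemma ball_bump_ge0 c r k x : 0 <= ball_bump c r k x.
Proof. by rewrite ball_bumpE prodr_ge0// => i _; rewrite mulr_ge0 ?flat1_ge0. Qed.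

Lemma ball_bump_le1 c r k x : ball_bump c r k x <= 1.
Proof.
rewrite ball_bumpE; apply: prodr_ile1 => i _.
by rewrite mulr_ge0 ?flat1_ge0//= mulr_ile1 ?flat1_ge0 ?flat1_le1.
Qed.

Lemma ball_bump_out c r k x : 0 < r -> ~ ball c r x -> ball_bump c r k x = 0.
Proof.
move=> r0 cx.
have [i hi] : exists i, r <= `|c 0 i - x 0 i|.
  apply: contrapT => /forallNP h; apply: cx; split => // j i.
  by rewrite /ball/= (ord1 j) ltNge; apply/negP/h.
rewrite ball_bumpE; apply/eqP/prodf_eq0; exists i => //.
have flat0 (t : R) : t <= 0 -> flat 1 (k.+1%:R * t) = 0.
  by move=> t0; rewrite flat1E ltNge mulr_ge0_le0.
have [h|h] := leP (c 0 i + r) (x 0 i).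
  by rewrite [X in _ * X]flat0 ?mulr0// subr_le0.
rewrite flat0 ?mul0r// subr_le0 lerBrDl -lerBrDr.
move: hi; rewrite ler_normr => /orP[|]; lra.
Qed.

Lemma cvg_prod1 (I : Type) (s : seq I) (F : I -> nat -> R) :
  (forall i, F i k @[k --> \oo] --> (1 : R)) ->
  (fun k => \prod_(i <- s) F i k) @ \oo --> (1 : R).
Proof.
move=> F1; elim: s => [|i s IH].
  rewrite (_ : (fun k => _) = cst 1); first exact: cvg_cst.
  by apply/funext => k; rewrite big_nil.
rewrite (_ : (fun k => _) = (fun k => F i k * \prod_(j <- s) F j k)); last first.
  by apply/funext => k; rewrite big_cons.
by have := cvgM (F1 i) IH; rewrite mulr1; exact.
Qed.

Lemma ball_bump_cvg1 c r x : ball c r x -> ball_bump c r k x @[k --> \oo] --> (1 : R).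
Proof.
move=> [r0 cx]; have flatc (t : R) : 0 < t -> flat 1 (k.+1%:R * t) @[k --> \oo] --> (1 : R).
  move=> t0; rewrite (_ : (fun k => _) = (fun k => expR (- (t^-1 * harmonic k)))).
    rewrite -[X in _ --> X]expR0; apply: continuous_cvg; first exact: continuous_expR.
    rewrite -[X in _ --> X]oppr0; apply: cvgN; rewrite -(mulr0 t^-1).
    by apply: cvgM; [exact: cvg_cst|exact: cvg_harmonic].
  by apply/funext => k; rewrite flat1E mulr_gt0// invfM mulrC.
rewrite (_ : (fun k => _) = (fun k => \prod_(i < n) (flat 1 (k.+1%:R * (x 0 i - (c 0 i - r))) *
                 flat 1 (k.+1%:R * (c 0 i + r - x 0 i))))); last first.
  by apply/funext => k; rewrite ball_bumpE.
apply: cvg_prod1 => i.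
have := cx 0 i; rewrite /ball/= ltr_distlC => /andP[x1 x2].
have f1 := flatc (x 0 i - (c 0 i - r)); have f2 := flatc (c 0 i + r - x 0 i).
by rewrite -[X in _ --> X]mulr1; apply: cvgM; [apply: f1|apply: f2]; lra.
Qed.

Lemma closed_box_compact c (r : R) : compact [set x : 'rV[R]_n | forall i, `|c 0 i - x 0 i| <= r].
Proof.
rewrite (_ : mkset _ = [set x : 'rV[R]_n | forall i, [set` `[c 0 i - r, c 0 i + r]] (x 0 i)]).
  apply: (@rV_compact R n (fun i => [set` `[c 0 i - r, c 0 i + r]])) => i.
  exact: segment_compact.
by apply/seteqP; split => x h i; have := h i; rewrite /= in_itv/= ler_distlC.
Qed.

(** With the bumps b_l of the balls whose doubles fit in U, the function
    1 - prod_(l < k) (1 - b_l) is smooth, supported in U, and tends to 1 wherever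
    one of the b_l does. *)
Lemma open_bump_approx (U : set 'rV[R]_n) : open U ->
  exists f : nat -> 'rV[R]_n -> R, [/\ forall k, test_function U (f k),
    forall k x, 0 <= f k x <= 1 &
    forall x, f k x @[k --> \oo] --> (\1_U x : R)].
Proof.
move=> oU; have [c [r [r0 H]]] := mx_ball_cover R 1 n.
pose good l := `[< ball (c l) (r l *+ 2) `<=` U >].
pose f k : 'rV[R]_n -> R := cst 1 + cst (-1) *
  \prod_(l < k) (cst 1 + cst (- (good l)%:R) * ball_bump (c l) (r l) k).
have fE k x : f k x = 1 - \prod_(l < k) (1 - (good l)%:R * ball_bump (c l) (r l) k x).
  rewrite /f !fctE fct_prodE mulN1r; congr (1 - _).
  by apply: eq_bigr => l _; rewrite !fctE mulNr.
have fac01 k l x : 0 <= 1 - (good l)%:R * ball_bump (c l) (r l) k x <= 1.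
  rewrite lerBlDr lerDl mulr_ge0 ?ball_bump_ge0// andbT subr_ge0.
  by rewrite mulr_ile1 ?ball_bump_ge0 ?ball_bump_le1//; case: (good l).
have p0 k x : 0 <= \prod_(l < k) (1 - (good l)%:R * ball_bump (c l) (r l) k x).
  by apply: prodr_ge0 => l _; have /andP[] := fac01 k l x.
have p1 k x : \prod_(l < k) (1 - (good l)%:R * ball_bump (c l) (r l) k x) <= 1.
  by apply: prodr_ile1 => l _; exact: fac01.
have goodU l x : good l -> ball (c l) (r l) x -> U x.
  move=> /asboolP lU lx; apply: lU; apply: le_ball lx.
  by rewrite mulr2n lerDl ltW.
pose box l := if good l then
  [set x : 'rV[R]_n | forall i, `|c l 0 i - x 0 i| <= r l] else set0.
exists f; split.
- move=> k.
  apply: (@test_function_bounded_supp _ _ _ _ (\big[setU/set0]_(l < k) box l)).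
  + apply: bump_alg_smooth; apply: bump_add; first exact: bump_cst.
    apply: bump_mul; first exact: bump_cst.
    apply: bump_alg_prod => l; apply: bump_add; first exact: bump_cst.
    by apply: bump_mul; [exact: bump_cst|exact: bump_alg_ball_bump].
  + apply: bigsetU_compact => l _; rewrite /box; case: ifP => _.
      exact: closed_box_compact.
    exact: compact0.
  + rewrite -bigcup_mkord => x [l _]; rewrite /box; case: ifP => // /asboolP lU h; apply: lU.
    split => [|i j]; first by rewrite mulrn_wgt0.
    by rewrite /ball/= (ord1 i) (le_lt_trans (h j))// mulr2n ltrDl.
  + rewrite -bigcup_mkord => x hx; rewrite fE big1 ?subrr// => l _.
    have [gl|gl] := boolP (good l); last by rewrite mul0r subr0.
    rewrite ball_bump_out ?mulr0 ?subr0// => lx; apply: hx.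
    exists l; first by rewrite /= ltn_ord.
    by rewrite /box gl => i /=; have [_ /(_ 0 i)/ltW] := lx.
- by move=> k x; rewrite fE subr_ge0 p1 lerBlDr lerDl p0.
- move=> x; rewrite indicE; case: (boolP (x \in U)) => [/set_mem Ux|/negP].
    have [l lx lU] := H _ oU x Ux.
    have gl : good l by apply/asboolP.
    apply: (@squeeze_cvgr _ _ _ _ (ball_bump (c l) (r l) ^~ x) (cst 1)).
    + near=> k; rewrite fE [X in _ <= X]/= [X in _ && X]lerBlDr lerDl p0 andbT.
      have lk : (l < k)%N by near: k; exact: nbhs_infty_gt.
      rewrite lerBrDl -lerBrDr (bigD1 (Ordinal lk))//= gl mul1r ler_piMr//.
        by rewrite subr_ge0 ball_bump_le1.
      by apply: prodr_ile1 => ? _; exact: fac01.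
    + exact: ball_bump_cvg1.
    + exact: cvg_cst.
  rewrite inE => Ux; rewrite (_ : (fun k => _) = cst 0); first exact: cvg_cst.
  apply/funext => k; rewrite fE big1 ?subrr// => l _.
  have [gl|gl] := boolP (good l); last by rewrite mul0r subr0.
  by rewrite ball_bump_out ?mulr0 ?subr0// => /(goodU _ _ gl).
Unshelve. all: by end_near. Qed.

End ball_bump.

(** * Integrals of bounded functions *)

Section real_integrals.
Context d (T : measurableType d) (R : realType) (mu : {measure set T -> \bar R}).
Variables (D : set T) (mD : measurable D).
Implicit Types f g h : T -> R.

Lemma bounded_by (f : T -> R) M :
  (forall x, D x -> `|f x| <= M) -> [bounded f x | x in D].
Proof.
move=> fM; exists M; split; first exact: num_real.
by move=> y My x Dx; exact: le_trans (fM x Dx) (ltW My).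
Qed.

Lemma bounded_integrable f M : (mu D < +oo)%E -> measurable_fun D f ->
  (forall x, D x -> `|f x| <= M) -> mu.-integrable D (EFin \o f).
Proof.
by move=> Dfin mf fM; apply: measurable_bounded_integrable => //; exact: bounded_by fM.
Qed.

Lemma bounded_mul_integrable g h M : mu.-integrable D (EFin \o g) ->
  measurable_fun D h -> (forall x, D x -> `|h x| <= M) ->
  mu.-integrable D (EFin \o (fun x => h x * g x)).
Proof. by move=> ig mh hM; have := integrableMr mD mh (bounded_by hM) ig. Qed.

Lemma Rintegral_dominated (f_ : nat -> T -> R) f g :
  (forall k, measurable_fun D (f_ k)) -> measurable_fun D f ->
  (forall x, D x -> f_ k x @[k --> \oo] --> f x) ->
  mu.-integrable D (EFin \o g) -> (forall k x, D x -> `|f_ k x| <= g x) ->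
  \int[mu]_(x in D) f_ k x @[k --> \oo] --> \int[mu]_(x in D) f x.
Proof.
move=> mf_ mf f_f ig f_g.
have [||||| intf _ cvf] := @dominated_convergence _ _ _ mu D mD (fun k => EFin \o f_ k)
    (EFin \o f) (EFin \o g).
- by move=> k; exact/measurable_EFinP.
- exact/measurable_EFinP.
- by apply: aeW => x Dx; apply/fine_cvgP; split; [exact: nearW|exact: f_f].
- exact: ig.
- by apply: aeW => x Dx k; rewrite lee_fin f_g.
apply: fine_cvg; rewrite fineK//; exact: integrable_fin_num.
Qed.

End real_integrals.

Section density.
Local Open Scope charge_scope.
Context d (T : measurableType d) (R : realType).
Variables (mu : {sigma_finite_measure set T -> \bar R}).

(** A finite measure given by a density is absolutely continuous, and the
   density is its Radon-Nikodym derivative. *)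
Lemma Rintegral_density (nu : {finite_measure set T -> \bar R}) (f psi : T -> R)
    (D : set T) M :
  mu.-integrable setT (EFin \o f) ->
  (forall A, measurable A -> nu A = \int[mu]_(x in A) (f x)%:E)%E ->
  measurable D -> measurable_fun D psi -> (forall x, D x -> `|psi x| <= M) ->
  \int[nu]_(x in D) psi x = \int[mu]_(x in D) (psi x * f x).
Proof.
move=> intf nuE mD mpsi psiM.
have numu : nu `<< mu.
  apply/null_content_dominatesP => A mA A0; rewrite nuE//.
  rewrite null_set_integral//.
  by apply: measurable_funTS; exact: measurable_int intf.
have ipsi : nu.-integrable D (EFin \o psi).
  by apply: bounded_integrable psiM => //; rewrite ltey_eq fin_num_measure.
rewrite /Rintegral -(Radon_Nikodym_change_of_variables numu mD ipsi).
congr fine; apply: ae_eq_integral => //.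
- apply: emeasurable_funM; first exact/measurable_EFinP.
  exact: measurable_funTS.
- have := bounded_mul_integrable mD (integrableS measurableT mD (@subsetT _ _) intf) mpsi psiM.
  by move=> /(measurable_int mu).
- have : ae_eq mu D ('d (charge_of_finite_measure nu) '/d mu) (EFin \o f).
    apply: integral_ae_eq => //.
    + by apply: (integrableS measurableT) => //; exact: Radon_Nikodym_integrable.
    + by apply: measurable_funTS; exact: measurable_int intf.
    + by move=> E ED mE; rewrite -Radon_Nikodym_integral// -nuE.
  by apply: filterS => x /[apply] /= ->; rewrite EFinM.
Qed.

End density.

(** * Integrals with respect to charges *)

Section charge_integrals.
Context d (T : measurableType d) (R : realType).
Implicit Types (nu : {charge set T -> \bar R}) (D : set T) (psi : T -> R).
Implicit Types m : {finite_measure set T -> \bar R}.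

Lemma finite_bounded_integrable m D psi M : measurable D -> measurable_fun D psi ->
  (forall x, D x -> `|psi x| <= M) -> m.-integrable D (EFin \o psi).
Proof.
move=> mD mpsi psiM; apply: bounded_integrable psiM => //.
by rewrite ltey_eq fin_num_measure.
Qed.

Lemma Rintegral_measure_add m1 m2 D psi M : measurable D ->
  measurable_fun D psi -> (forall x, D x -> `|psi x| <= M) ->
  \int[measure_add m1 m2]_(x in D) psi x =
  \int[m1]_(x in D) psi x + \int[m2]_(x in D) psi x.
Proof.
move=> mD mpsi psiM.
have i1 := finite_bounded_integrable m1 mD mpsi psiM.
have i2 := finite_bounded_integrable m2 mD mpsi psiM.
by rewrite /Rintegral (integral_measure_add mD i1 i2) fineD// integrable_fin_num.
Qed.

Lemma Rintegral_add_eq m1 m2 m3 m4 D psi M : measurable D ->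
  measurable_fun D psi -> (forall x, D x -> `|psi x| <= M) ->
  (forall A, measurable A -> A `<=` D -> m1 A + m2 A = m3 A + m4 A)%E ->
  \int[m1]_(x in D) psi x + \int[m2]_(x in D) psi x =
  \int[m3]_(x in D) psi x + \int[m4]_(x in D) psi x.
Proof.
move=> mD mpsi psiM mE; rewrite -!(Rintegral_measure_add _ _ mD mpsi psiM).
congr fine; apply: eq_measure_integral => A mA AD.
have := mE A mA AD; rewrite -!measure_addE; exact.
Qed.

(** The Hahn decomposition in the definition is an arbitrary one; all that
    follows uses only that it is one. *)
Lemma charge_integral_jordan nu : exists P N (h : hahn_decomposition nu P N),
  forall D psi, charge_integral nu D psi =
  \int[jordan_pos h]_(x in D) psi x - \int[jordan_neg h]_(x in D) psi x.
Proof.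
pose P := cid (Hahn_decomposition nu); pose N := cid (projT2 P).
by exists (projT1 P), (projT1 N), (projT2 N).
Qed.

Lemma jordanE nu P N (h : hahn_decomposition nu P N) A : measurable A ->
  (jordan_pos h A = nu (A `&` P) /\ jordan_neg h A = - nu (A `&` N))%E.
Proof.
move=> mA; split; first by rewrite jordan_posE cjordan_posE /crestr0 mem_set.
by rewrite jordan_negE cjordan_negE /crestr0 mem_set.
Qed.

(** If p and q are the Jordan parts of nu then p + m2 = m1 + q on the subsets of
    D, and the integral is additive in the measure. *)
Lemma charge_integral_diff nu m1 m2 D psi M :
  measurable D -> measurable_fun D psi -> (forall x, D x -> `|psi x| <= M) ->
  (forall A, measurable A -> A `<=` D -> nu A = m1 A - m2 A)%E ->
  charge_integral nu D psi = \int[m1]_(x in D) psi x - \int[m2]_(x in D) psi x.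
Proof.
move=> mD mpsi psiM nuE.
have [P [N [h ->]]] := charge_integral_jordan nu.
apply/eqP; rewrite subr_eq addrAC eq_sym subr_eq; apply/eqP.
apply: (Rintegral_add_eq mD mpsi psiM) => A mA AD.
have := jordan_decomp h mA; rewrite /cadd/= cscaleN1/= nuE//.
have f1 : m1 A \is a fin_num by rewrite fin_num_measure.
have f2 : m2 A \is a fin_num by rewrite fin_num_measure.
have f3 : jordan_pos h A \is a fin_num by rewrite fin_num_measure.
have f4 : jordan_neg h A \is a fin_num by rewrite fin_num_measure.
move: f1 f2 f3 f4.
move: (m1 A) (m2 A) (jordan_pos h A) (jordan_neg h A) => [a| |] [b| |] [e| |] [f| |]//=.
move=> _ _ _ _ /= [] /eqP; rewrite subr_eq addrAC eq_sym subr_eq => /eqP h'.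
by rewrite -!EFinD h'.
Qed.

(** The Jordan parts have the densities f on P and - f on N. *)
Lemma charge_integral_density (mu : {sigma_finite_measure set T -> \bar R})
    nu (f : T -> R) D psi M :
  mu.-integrable setT (EFin \o f) ->
  (forall A, measurable A -> nu A = \int[mu]_(x in A) (f x)%:E)%E ->
  measurable D -> measurable_fun D psi -> (forall x, D x -> `|psi x| <= M) ->
  charge_integral nu D psi = \int[mu]_(x in D) (psi x * f x).
Proof.
move=> intf nuE mD mpsi psiM.
have [P [N [h ->]]] := charge_integral_jordan nu.
have [[mP _] [mN _] PNT PN0] := h.
have ires (Q : set T) : measurable Q -> mu.-integrable setT (EFin \o (f \_ Q)).
  move=> mQ; rewrite -restrict_EFin; apply/(integrable_mkcond _ mQ).
  exact: integrableS intf.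
have iresN : mu.-integrable setT (EFin \o (fun x => - (f \_ N) x)).
  by have := integrableN (ires _ mN).
rewrite (Rintegral_density (ires _ mP) _ mD mpsi psiM); last first.
  move=> A mA; rewrite [LHS](jordanE h mA).1 nuE; last exact: measurableI.
  by rewrite integral_mkcondr restrict_EFin.
rewrite (Rintegral_density iresN _ mD mpsi psiM); last first.
  move=> A mA; rewrite [LHS](jordanE h mA).2 nuE; last exact: measurableI.
  rewrite integral_mkcondr restrict_EFin -integralN//=.
  apply: integrable_add_def => //; apply: (integrableS measurableT) => //.
  exact: ires.
have ipsi g : mu.-integrable setT (EFin \o g) ->
    mu.-integrable D (EFin \o (fun x => psi x * g x)).
  move=> ig; apply: bounded_mul_integrable psiM => //.
  by apply: (integrableS measurableT) ig.
rewrite -RintegralB//; [|exact: ipsi (ires _ mP)|exact: ipsi iresN].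
apply: eq_Rintegral => x _; rewrite -mulrBr opprK; congr (_ * _).
have PNx : (P `|` N) x by rewrite PNT.
have nPNx : ~ (P `&` N) x by rewrite PN0.
rewrite /patch; have [xP|xP] := pselect (P x); have [xN|xN] := pselect (N x).
- by case: nPNx.
- by rewrite mem_set// memNset// addr0.
- by rewrite memNset// mem_set// add0r.
- by case: PNx.
Qed.

End charge_integrals.

(** * Measures are determined by test functions *)

Section test_functions.
Variables (R : realType) (n : nat).
Implicit Types (Omega : set 'rV[R]_n) (phi : 'rV[R]_n -> R).

Lemma test_function_continuous Omega phi : test_function Omega phi -> continuous phi.
Proof. by move=> [sphi _ _]; have [] := sphi [::]. Qed.

Lemma test_function_derivable Omega phi j x :
  test_function Omega phi -> derivable phi x (basis_vec R j).
Proof. by move=> [sphi _ _]; have [_] := sphi [::]; exact. Qed.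

Lemma test_function0 Omega phi x : test_function Omega phi -> ~ Omega x -> phi x = 0.
Proof.
move=> [_ _ KO] Ox; apply/eqP; apply: contrapT => /negP phix.
by apply/Ox/KO/subset_closure.
Qed.

Lemma test_function_pderiv Omega phi j :
  test_function Omega phi -> test_function Omega (pderiv j phi).
Proof.
move=> [sphi cK KO]; apply: test_function_bounded_supp cK KO _.
  by move=> s; have := sphi (rcons s j); rewrite foldr_rcons.
move=> x Kx; rewrite /pderiv.
rewrite (@near_eq_derive _ _ _ phi (cst 0)) ?derive_cst//.
have oK : open (~` closure [set x | phi x != 0]).
  by apply: closed_openC; exact: closed_closure.
have : nbhs x (~` closure [set x | phi x != 0]) by exact: open_nbhs_nbhs.
apply: filterS => y Ky; apply/eqP; apply: contrapT => /negP phiy.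
exact/Ky/subset_closure.
Qed.

Lemma test_function_bounded Omega phi :
  test_function Omega phi -> exists M, forall x, `|phi x| <= M.
Proof.
move=> tphi; have cphi := test_function_continuous tphi; have [_ cK _] := tphi.
have /compact_bounded[M [_ HM]] : compact (phi @` (closure [set x | phi x != 0])).
  by apply: continuous_compact => //; exact: continuous_subspaceT.
exists (`|M| + 1) => x.
have [->|phix] := eqVneq (phi x) 0; first by rewrite normr0 addr_ge0.
apply: HM; first by rewrite ltr_pwDr// ler_norm.
by exists x => //; exact: subset_closure.
Qed.

Lemma test_function_measurable Omega phi :
  test_function Omega phi -> measurable_fun setT (phi : _ -> measurableTypeR R).
Proof.
by move=> tphi; apply: continuous_mx_measurable; exact: test_function_continuous tphi.
Qed.

(** The open sets are a generator that is stable under intersections, as the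
    uniqueness of measures requires. *)
Lemma measurable_entry_open :
  @measurable _ 'rV[R]_n = <<s [set U : set 'rV[R]_n | open U] >>.
Proof.
apply/seteqP; split; last first.
  apply: smallest_sub; first exact: sigma_algebra_measurable.
  exact: open_mx_measurable.
apply: smallest_sub; first exact: smallest_sigma_algebra.
move=> _ [i [j [B mB ->]]].
have : measurable_fun [set: g_sigma_algebraType [set U : set 'rV[R]_n | open U]]
    (fun M : 'rV[R]_n => M i j : measurableTypeR R).
  apply: (measurability _ (RGenOpens.measurableE R)).
  move=> _ [_ [a [b ->] <-]]; rewrite setTI; apply: sub_gen_smallest => /=.
  apply: open_comp; last exact: interval_open.
  by move=> x _; exact: coord_continuous.
by move=> /(_ measurableT B mB); rewrite setTI.
Qed.

(** Open sets are pi-stable and their indicators are limits of test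
   functions, so that test functions determine a finite measure. *)
Lemma test_function_measure_unique Omega (m1 m2 : {finite_measure set 'rV[R]_n -> \bar R}) :
  open Omega ->
  (forall phi, test_function Omega phi ->
     \int[m1]_(x in Omega) phi x = \int[m2]_(x in Omega) phi x) ->
  forall A, measurable A -> A `<=` Omega -> m1 A = m2 A.
Proof.
move=> oO m12.
have mO := open_mx_measurable oO.
have ffin (m : {finite_measure set 'rV[R]_n -> \bar R}) A : measurable A -> m A \is a fin_num.
  exact: fin_num_measure.
suff H A : measurable A -> m1 (A `&` Omega) = m2 (A `&` Omega).
  by move=> A mA /setIidPl <-; exact: H.
have openUO U : open U -> m1 (U `&` Omega) = m2 (U `&` Omega).
  move=> oU; have oUO : open (U `&` Omega) by exact: openI.
  have [f [tf f01 cvf]] := open_bump_approx oUO.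
  have tfO k : test_function Omega (f k).
    by have [? ? h] := tf k; split => //; apply: subset_trans h _; exact: subIsetr.
  have cvm (m : {finite_measure set 'rV[R]_n -> \bar R}) :
      \int[m]_(x in Omega) f k x @[k --> \oo] --> fine (m (U `&` Omega)).
    have -> : m (U `&` Omega) = (\int[m]_(x in Omega) (\1_(U `&` Omega) x)%:E)%E.
      by rewrite integral_indic// -?setIA ?setIid//; exact: open_mx_measurable.
    apply: (@Rintegral_dominated _ _ _ _ _ _ _ _ (cst 1)) => //.
    - by move=> k; apply: measurable_funTS; exact: test_function_measurable (tf k).
    - apply: measurable_funTS; apply: measurable_indic; exact: open_mx_measurable.
    - apply: (@finite_bounded_integrable _ _ _ _ _ _ 1) => // x _ /=.
      by rewrite normr1.
    - move=> k x _ /=; have /andP[f0 f1] := f01 k x.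
      by rewrite ger0_norm.
  have mUO : measurable (U `&` Omega) by exact: open_mx_measurable.
  have cv1 := cvm m1.
  have cv2 : \int[m1]_(x in Omega) f k x @[k --> \oo] --> fine (m2 (U `&` Omega)).
    by rewrite (_ : (fun k => _) = (fun k => \int[m2]_(x in Omega) f k x));
      [exact: cvm|apply/funext => k; exact: m12].
  have m12U : fine (m1 (U `&` Omega)) = fine (m2 (U `&` Omega)).
    by apply: cvg_unique cv1 cv2; exact: Rhausdorff.
  by have := congr1 EFin m12U; rewrite !fineK ?ffin.
rewrite measurable_entry_open; move: A; apply: (dynkin_induction measurable_entry_open).
- by move=> U V /= oU oV; exact: openI.
- by apply: openUO; exact: openT.
- by move=> U oU; exact: openUO.
- move=> A mA PA; have eO : m1 Omega = m2 Omega.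
    by have := openUO _ openT; rewrite setTI.
  rewrite setIC -setDE !measureD//; [|by rewrite ltey_eq ffin..].
  by rewrite (setIC Omega A); congr (_ - _)%E; [exact: eO|exact: PA].
- move=> F mF tF PF; rewrite setI_bigcupl.
  have mFO i : measurable (F i `&` Omega) by exact: measurableI.
  rewrite !measure_bigcup//; [|exact: trivIset_setIr|exact: trivIset_setIr].
  by apply: eq_eseriesr => i _; exact: PF.
Qed.
End test_functions.

Section charge_unique.
Variables (R : realType) (n : nat) (Omega : set 'rV[R]_n).
Hypothesis oOmega : open Omega.
Local Notation leb := (lebesgue_rV R n).
Implicit Types (psi f g : 'rV[R]_n -> R) (nu : {charge set 'rV[R]_n -> \bar R}).

Let mOmega : measurable Omega. Proof. exact: open_mx_measurable. Qed.

Section measure_add_finite.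
Variables m1 m2 : {finite_measure set 'rV[R]_n -> \bar R}.
(** A copy of the sum of measures, to carry the structure of a finite
    measure. *)
Definition measure_add_fin : set 'rV[R]_n -> \bar R := measure_add m1 m2.

HB.instance Definition _ := Measure.on measure_add_fin.

Let fin_add : fin_num_fun measure_add_fin.
Proof.
move=> A mA; rewrite /measure_add_fin measure_addE fin_numD.
by rewrite !fin_num_measure.
Qed.

HB.instance Definition _ := Measure_isFinite.Build _ _ _ measure_add_fin fin_add.
End measure_add_finite.

(** Moving the negative parts to the other side turns the hypothesis into the
    equality of two finite measures on test functions. *)
Lemma charge_integral_unique nu1 nu2 psi M :
  (forall phi, test_function Omega phi ->
     charge_integral nu1 Omega phi = charge_integral nu2 Omega phi) ->
  measurable_fun Omega psi -> (forall x, Omega x -> `|psi x| <= M) ->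
  charge_integral nu1 Omega psi = charge_integral nu2 Omega psi.
Proof.
move=> nu12 mpsi psiM.
have [P1 [N1 [h1 E1]]] := charge_integral_jordan nu1.
have [P2 [N2 [h2 E2]]] := charge_integral_jordan nu2.
pose p1 : {finite_measure set 'rV[R]_n -> \bar R} := jordan_pos h1.
pose n1 : {finite_measure set 'rV[R]_n -> \bar R} := jordan_neg h1.
pose p2 : {finite_measure set 'rV[R]_n -> \bar R} := jordan_pos h2.
pose n2 : {finite_measure set 'rV[R]_n -> \bar R} := jordan_neg h2.
have E A : measurable A -> A `<=` Omega ->
    (measure_add_fin p1 n2 A = measure_add_fin p2 n1 A)%E.
  apply: test_function_measure_unique => // phi tphi.
  have [B phiB] := test_function_bounded tphi.
  have mphi := measurable_funTS (D := Omega) (test_function_measurable tphi).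
  rewrite (@Rintegral_measure_add _ _ _ p1 n2 _ _ B)//.
  rewrite (@Rintegral_measure_add _ _ _ p2 n1 _ _ B)//.
  have := nu12 _ tphi; rewrite E1 E2 => /eqP.
  by rewrite subr_eq addrAC eq_sym subr_eq eq_sym => /eqP.
rewrite E1 E2; apply/eqP; rewrite subr_eq addrAC eq_sym subr_eq eq_sym; apply/eqP.
apply: (Rintegral_add_eq mOmega mpsi psiM) => A mA AO.
by have := E A mA AO; rewrite /measure_add_fin !measure_addE.
Qed.

Lemma density_charge f : leb.-integrable Omega (EFin \o f) ->
  exists nu : {charge set 'rV[R]_n -> \bar R},
    (forall A, measurable A -> nu A = nu (A `&` Omega)) /\
    (forall psi M, measurable_fun Omega psi -> (forall x, Omega x -> `|psi x| <= M) ->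
      charge_integral nu Omega psi = \int[leb]_(x in Omega) (psi x * f x)).
Proof.
move=> intf.
have intfO : leb.-integrable setT (EFin \o (f \_ Omega)).
  by rewrite -restrict_EFin; apply/(integrable_mkcond _ mOmega).
exists (induced_charge intfO); split.
  move=> A mA.
  have nuE B : induced_charge intfO B = (\int[leb]_(x in B `&` Omega) (f x)%:E)%E.
    by rewrite integral_mkcondr restrict_EFin.
  by rewrite [LHS]nuE [RHS]nuE -setIA setIid.
move=> psi M mpsi psiM.
rewrite (charge_integral_density intfO _ mOmega mpsi psiM)//.
by apply: eq_Rintegral => x xO; rewrite /patch xO.
Qed.

(** The fundamental lemma of the calculus of variations: the two charges with
    densities f and g agree on test functions, hence on the sign of f - g. *)
Lemma test_function_L1_unique f g :
  leb.-integrable Omega (EFin \o f) -> leb.-integrable Omega (EFin \o g) ->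
  (forall phi, test_function Omega phi ->
     \int[leb]_(x in Omega) (f x * phi x) = \int[leb]_(x in Omega) (g x * phi x)) ->
  \int[leb]_(x in Omega) `|f x - g x| = 0.
Proof.
move=> intf intg fg.
have [nuf [_ nufE]] := density_charge intf.
have [nug [_ nugE]] := density_charge intg.
have mf : measurable_fun Omega f by apply/measurable_EFinP; exact: measurable_int intf.
have mg : measurable_fun Omega g by apply/measurable_EFinP; exact: measurable_int intg.
pose psi x : R := if f x < g x then -1 else 1.
have mpsi : measurable_fun Omega psi.
  apply: measurable_fun_if => //; exact: measurable_fun_ltr.
have psi1 x : Omega x -> `|psi x| <= 1.
  by move=> _; rewrite /psi; case: ifP; rewrite ?normrN normr1.
have : charge_integral nuf Omega psi = charge_integral nug Omega psi.
  apply: charge_integral_unique mpsi psi1 => phi tphi.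
  have [B phiB] := test_function_bounded tphi.
  have mphi := measurable_funTS (D := Omega) (test_function_measurable tphi).
  rewrite (nufE _ B)// (nugE _ B)//.
  under eq_Rintegral do rewrite mulrC.
  by rewrite fg//; apply: eq_Rintegral => x _; rewrite mulrC.
rewrite (nufE _ 1)// (nugE _ 1)// => /eqP; rewrite -subr_eq0 -RintegralB//.
- move=> /eqP <-; apply: eq_Rintegral => x _.
  rewrite -mulrBr /psi; case: ltP => fg'.
    by rewrite mulN1r ltr0_norm// subr_lt0.
  by rewrite mul1r ger0_norm// subr_ge0.
- exact: bounded_mul_integrable psi1.
- exact: bounded_mul_integrable psi1.
Qed.

End charge_unique.

(** * Lebesgue measure on row vectors *)

Section lebesgue_rV_theory.
Variables (R : realType) (n : nat).
Local Notation leb := (lebesgue_rV R n).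
Implicit Types (A : set 'rV[R]_n) (v : 'rV[R]_n).

Definition rV_box (B : 'I_n -> set (measurableTypeR R)) : set 'rV[R]_n :=
  [set v | forall k, B k (v 0 k)].

Lemma measurable_rV_box B : (forall k, measurable (B k)) -> measurable (rV_box B).
Proof.
move=> mB; rewrite (_ : rV_box B = \bigcap_(k in [set: 'I_n])
   (fun v : 'rV[R]_n => v 0 k) @^-1` B k).
  apply: fin_bigcap_measurable => // k _.
  by rewrite -[X in measurable X]setTI; exact: measurable_entry.
by apply/seteqP; split => v /= h k => [_|]; exact: h.
Qed.

Lemma leb_itv_box (a b : 'I_n -> R) : (forall k, a k <= b k) ->
  leb (rV_box (fun k => [set` `[a k, b k]])) = (\prod_(k < n) (b k - a k))%:E.
Proof.
move=> ab; rewrite lebesgue_rV_box// -prodEFin; apply: eq_bigr => k _.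
rewrite lebesgue_measure_itv/= lte_fin; case: ltP => //= ba.
by have /eqP -> : b k == a k by [rewrite eq_le ba ab]; rewrite subrr.
Qed.

Lemma leb_cube (r : R) : 0 <= r ->
  leb (rV_box (fun=> [set` `[- r, r]])) = ((r *+ 2) ^+ n)%:E.
Proof.
move=> r0; rewrite (@leb_itv_box (fun=> - r) (fun=> r)) => [|k].
  by rewrite opprK -mulr2n prodr_const card_ord.
by rewrite (le_trans _ r0)// oppr_le0.
Qed.

Lemma normr_coord (x : 'rV[R]_n) k : `|x 0 k| <= `|x|.
Proof.
rewrite -[leRHS]/(mx_norm x) mx_normrE.
exact: (le_bigmax _ (fun i : 'I_1 * 'I_n => `|x i.1 i.2|) (0, k)).
Qed.

Lemma leb_bounded A : measurable A -> bounded_set A -> (leb A < +oo)%E.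
Proof.
move=> mA [M [_ HM]]; pose r := `|M| + 1.
have r0 : 0 <= r by rewrite addr_ge0.
have Mr : M < r by rewrite ltr_pwDr// ler_norm.
have AB : A `<=` rV_box (fun=> [set` `[- r, r]]).
  move=> x Ax k; have := HM _ Mr x Ax; rewrite /= in_itv/= -ler_norml.
  exact/le_trans/normr_coord.
apply: (@le_lt_trans _ _ ((r *+ 2) ^+ n)%:E); last exact: ltry.
rewrite -leb_cube//; apply: le_measure => //; rewrite inE//.
by apply: measurable_rV_box => k.
Qed.

Lemma measurable_shift (a : R) :
  measurable_fun setT (fun x : measurableTypeR R => x + a : measurableTypeR R).
Proof. exact: measurable_funD. Qed.

Lemma lebesgue_measure_shift (a : R) (B : set (measurableTypeR R)) : measurable B ->
  lebesgue_measure ((fun x => x + a) @^-1` B) = lebesgue_measure B.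
Proof.
have ms := measurable_shift a.
move=> mB; apply/esym.
pose m := pushforward (@lebesgue_measure R) (fun x : measurableTypeR R => x + a : measurableTypeR R).
rewrite -[RHS]/(m B).
apply: lebesgue_measure_unique => //= _ [[b c]] _ <-.
rewrite /m /pushforward.
have -> : (fun x => x + a) @^-1` `]b, c]%classic = `](b - a), (c - a)]%classic.
  by apply/seteqP; split => x /=; rewrite !in_itv/= ltrBlDr lerBrDr.
rewrite !lebesgue_measure_itv/= !lte_fin ltrD2r; case: ifP => // _.
by rewrite -!EFinD; congr _%:E; lra.
Qed.

Lemma measurable_rV_shift v :
  measurable_fun [set: 'rV[R]_n] (fun x : 'rV[R]_n => x + v).
Proof.
apply: measurable_fun_entryP => i j.
rewrite (_ : (fun _ => _) = (fun x : 'rV[R]_n => x i j + v i j)).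
  by apply: measurable_funD => //; exact: measurable_entry.
by apply/funext => x; rewrite mxE.
Qed.

Lemma measurable_boxes : @measurable _ 'rV[R]_n =
  <<s [set C | exists2 B, forall k, measurable (B k) & C = rV_box B] >>.
Proof.
apply/seteqP; split; last first.
  apply: smallest_sub; first exact: sigma_algebra_measurable.
  by move=> _ [B mB ->]; exact: measurable_rV_box.
apply: smallest_sub; first exact: smallest_sigma_algebra.
move=> _ [i [j [B mB ->]]]; apply: sub_gen_smallest.
exists (fun k => if k == j then B else setT); first by move=> k; case: ifP.
apply/seteqP; split => x /=.
  by move=> h k; case: eqP => // ->; rewrite -(ord1 i).
by move=> /(_ j); rewrite eqxx (ord1 i).
Qed.

(** The Lebesgue measure and its image under the translation agree on boxes. *)
Lemma leb_shift v A : measurable A -> leb ((fun x => x + v) @^-1` A) = leb A.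
Proof.
pose m := pushforward leb (fun x : 'rV[R]_n => x + v).
move=> mA; rewrite -[LHS]/(m A).
have ms := measurable_rV_shift v.
pose G := [set C : set 'rV[R]_n | exists2 B, forall k, measurable (B k) & C = rV_box B].
pose g (l : nat) := rV_box (fun=> [set` `[- l%:R, l%:R]]).
have mE C : G C -> m C = leb C.
  move=> [B mB ->]; rewrite /m /pushforward lebesgue_rV_box//.
  have -> : (fun x => x + v) @^-1` rV_box B =
      rV_box (fun k => (fun x => x + v 0 k) @^-1` B k).
    by apply/seteqP; split => x /= h k; have := h k; rewrite /= mxE.
  rewrite lebesgue_rV_box; last first.
    by move=> k; have := measurable_shift (v 0 k) measurableT (mB k); rewrite setTI.
  by apply: eq_bigr => k _; exact: lebesgue_measure_shift.
apply: (measure_unique G g) => //.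
- exact: measurable_boxes.
- move=> _ _ [B mB ->] [C mC ->]; exists (fun k => B k `&` C k).
    by move=> k; exact: measurableI.
  apply/seteqP; split => x /=; first by move=> [xB xC] k; split; [exact: xB|exact: xC].
  by move=> h; split => k; have [] := h k.
- by move=> l; exists (fun=> [set` `[- l%:R, l%:R]]).
- apply/seteqP; split => // x _.
  exists (Num.trunc `|x|).+1 => // k /=; rewrite in_itv/= -ler_norml.
  exact: le_trans (normr_coord _ _) (ltW (truncnS_gt _)).
- move=> l; rewrite [X in (X < _)%E]mE; first by rewrite leb_cube// ltry.
  by exists (fun=> [set` `[- l%:R, l%:R]]).
Qed.

Lemma ge0_integral_shift (f : 'rV[R]_n -> \bar R) v :
  measurable_fun setT f -> (forall x, 0 <= f x)%E ->
  (\int[leb]_x f (x + v)%R = \int[leb]_x f x)%E.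
Proof.
move=> mf f0.
have -> : (\int[leb]_x f x = \int[pushforward leb (fun x : 'rV[R]_n => x + v)%R]_x f x)%E.
  apply: eq_measure_integral => [|ms A mA _]; first exact: measurable_rV_shift.
  by rewrite -[LHS](leb_shift v mA).
by rewrite ge0_integral_pushforward//; exact: measurable_rV_shift.
Qed.

End lebesgue_rV_theory.

(** * Weak compactness of measures *)

Section extraction.
Variable R : realType.

(** Simultaneous Bolzano-Weierstrass extraction for countably many bounded
   sequences: the limits along a free ultrafilter are approached by the
   diagonal choice of one index for the first j sequences. *)
Lemma diagonal_extraction (T : countType) (a : T -> nat -> R) (C : T -> R) :
  (forall t k, `|a t k| <= C t) ->
  exists (sigma : nat -> nat) (c : T -> R),
    (forall k, (k <= sigma k)%N) /\ forall t, a t (sigma k) @[k --> \oo] --> c t.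
Proof.
move=> aC.
have [U [UU oU]] := @ultraFilterLemma nat \oo _.
have [c cP] : {c : T -> R | forall t e, 0 < e -> U [set k | `|a t k - c t| < e]}.
  suff H t : exists ct, forall e, 0 < e -> U [set k | `|a t k - ct| < e].
    by exists (fun t => sval (cid (H t))) => t; case: cid.
  have Uab : U [set k | a t k \in `[- C t, C t]].
    by apply: filterE => k /=; rewrite in_itv/= -ler_norml.
  have [ct [_ clc]] := @segment_compact R (- C t) (C t) (a t @ U) _ Uab.
  exists ct => e e0; have [//|UC] := in_ultra_setVsetC [set k | `|a t k - ct| < e] UU.
  have ball_ct : nbhs ct (ball ct e) by exact: nbhsx_ballx.
  have nball : U [set k | ~ ball ct e (a t k)].
    apply: filterS UC => k /= kP; apply: contra_not kP.
    by rewrite /ball/= distrC.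
  by have [x [/= nx bx]] := clc (~` ball ct e) (ball ct e) nball ball_ct.
have UJ j e : 0 < e -> U [set k | forall t, (pickle t < j)%N -> `|a t k - c t| < e].
  move=> e0; elim: j => [|j IH]; first by apply: filterE.
  have [[t tj]|nt] := pselect (exists t : T, pickle t = j); last first.
    apply: filterS IH => k Hk t; rewrite ltnS leq_eqVlt => /orP[/eqP tj|]; last exact: Hk.
    by case: nt; exists t.
  apply: filterS2 IH (cP t e e0) => k Hk kt t'.
  rewrite ltnS leq_eqVlt => /orP[/eqP tj'|]; last exact: Hk.
  by have -> : t' = t by apply: (pcan_inj pickleK); rewrite tj tj'.
have sel j : exists k, (j <= k)%N /\
    forall t, (pickle t < j)%N -> `|a t k - c t| < j.+1%:R^-1.
  have Uge : U [set k | (j <= k)%N] by apply: oU; exact: nbhs_infty_ge.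
  have e0 : 0 < j.+1%:R^-1 :> R by rewrite invr_gt0.
  have [k [jk Hk]] := filter_ex (filterI Uge (UJ j _ e0)).
  by exists k.
exists (fun j => sval (cid (sel j))), c; split => [j|t].
  by case: cid => k /= [].
apply/cvgrPdist_lt => e e0; near=> j.
have tj : (pickle t < j)%N by near: j; exact: nbhs_infty_gt.
have je : j.+1%:R^-1 < e by near: j; exact: near_infty_natSinv_lt (PosNum e0).
by case: cid => k [/= _ Hk]; rewrite distrC; exact: lt_trans (Hk _ tj) je.
Unshelve. all: by end_near. Qed.

End extraction.

Section nat_valued.
Context d (T : measurableType d) (R : realType) (mu : {measure set T -> \bar R}).
Variables (D : set T) (mD : measurable D) (a : T -> nat) (N : nat).
Hypotheses (muD : (mu D < +oo)%E) (ma : forall m, measurable (D `&` a @^-1` [set m])).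
Hypothesis aN : forall x, D x -> (a x < N)%N.

Lemma nat_valued_measurable (g : nat -> R) : measurable_fun D (g \o a).
Proof.
move=> _ Y mY.
rewrite (_ : D `&` _ = \bigcup_(m in [set m | Y (g m)]) (D `&` a @^-1` [set m])).
  exact: bigcup_measurable.
apply/seteqP; split => [x /= [Dx Yx]|x [m /= Ym [Dx axm]]]; first by exists (a x).
by split => //=; rewrite axm.
Qed.

Lemma nat_valued_Rintegral (g : nat -> R) : \int[mu]_(x in D) g (a x) =
  \sum_(m < N) g m * fine (mu (D `&` a @^-1` [set (m : nat)])).
Proof.
pose A (m : nat) := D `&` a @^-1` [set m].
have iA (m : nat) : mu.-integrable D (fun x => (g m * \1_(A m) x)%:E).
  apply: (@bounded_integrable _ _ _ _ _ mD _ (`|g m|)) => //.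
    by apply: measurable_funM => //; apply: measurable_indic; exact: ma.
  by move=> x _; rewrite normrM ler_piMr// indicE; case: (_ \in _); rewrite ?normr1 ?normr0.
have EA m : (\int[mu]_(x in D) (g m * \1_(A m) x)%:E = (g m)%:E * mu (A m))%E.
  under eq_integral do rewrite EFinM.
  rewrite integralZl//; last first.
    apply: (@bounded_integrable _ _ _ _ _ mD _ (1)) => //.
      by apply: measurable_indic; exact: ma.
    by move=> x _; rewrite indicE; case: (_ \in _); rewrite ?normr1 ?normr0.
  rewrite integral_indic//; last exact: ma.
  by rewrite /A setIAC setIid.
have Afin m : mu (A m) \is a fin_num.
  rewrite ge0_fin_numE//; apply: le_lt_trans muD; apply: le_measure; rewrite ?inE//.
    exact: ma.
  exact: subIsetl.
transitivity (fine (\int[mu]_(x in D) \sum_(m < N) (g m * \1_(A m) x)%:E)%E).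
  congr fine; apply: eq_integral => x xD; have Dx : D x by rewrite inE in xD.
  rewrite (bigD1 (Ordinal (aN Dx)))//= big1 ?adde0 => [|i /eqP ia].
    by rewrite indicE mem_set ?mulr1.
  rewrite indicE memNset ?mulr0// => -[_ /= ax].
  by apply: ia; apply: val_inj.
rewrite integral_sum//; under eq_bigr do rewrite EA.
rewrite (_ : \sum_(m < N) _ = (\sum_(m < N) g m * fine (mu (A m)))%:E)%E//.
by rewrite -sumEFin; apply: eq_bigr => m _; rewrite EFinM fineK.
Qed.

End nat_valued.

Section codes.
Context d (T : measurableType d) (A : nat -> set T) (mA : forall j, measurable (A j)).

(** The earliest bit is the most significant one, so that halving a code forgets
    the last bit: the partitions by codes are nested. *)
Fixpoint code (j : nat) (x : T) : nat :=
  if j is i.+1 then ((x \in A i) + (code i x).*2)%N else 0%N.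

Lemma code_half j x : (code j.+1 x)./2 = code j x.
Proof. exact: half_bit_double. Qed.

Lemma code_odd j x : odd (code j.+1 x) = (x \in A j).
Proof. by rewrite /= oddD odd_double addbF oddb. Qed.

Lemma code_lt j x : (code j x < 2 ^ j)%N.
Proof.
elim: j => //= j IH; rewrite expnS mul2n -addn1.
case: (x \in A j); lia.
Qed.

Lemma code_eq_le i j x y : (i <= j)%N -> code j x = code j y -> code i x = code i y.
Proof.
move=> /subnK <-; elim: (j - i)%N => // l IH; rewrite addSn => E.
by apply: IH; rewrite -(code_half _ x) -(code_half _ y) E.
Qed.

Lemma measurable_code j m : measurable (code j @^-1` [set m]).
Proof.
elim: j m => [|j IH] m.
  have [->|m0] := eqVneq m 0%N.
    by rewrite (_ : _ @^-1` _ = setT)//; apply/seteqP.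
  rewrite (_ : _ @^-1` _ = set0)//; apply/seteqP; split => // x /= h.
  by rewrite -h in m0.
rewrite (_ : _ @^-1` _ = code j @^-1` [set m./2] `&`
   (if odd m then A j else ~` A j)).
  by apply: measurableI => //; case: odd => //; exact: measurableC.
apply/seteqP; split => x.
  move=> <-; split; first by rewrite /= half_bit_double.
  by rewrite code_odd; case: ifPn => [/set_mem//|/negP xA /= Ax]; apply/xA/mem_set.
move=> [/= jm mAj]; rewrite jm.
have -> : (x \in A j) = odd m.
  by case: (odd m) mAj => h; [exact: mem_set|exact: memNset].
exact: odd_double_half.
Qed.

End codes.

Arguments code : simpl never.

Section ball_codes.
Variables (R : realType) (n : nat) (c : nat -> 'rV[R]_n) (r : nat -> R).
Hypothesis cover_balls : forall U, open U -> forall x, U x ->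
  exists2 k, ball (c k) (r k) x & ball (c k) (r k *+ 2) `<=` U.
Hypothesis r_gt0 : forall k, 0 < r k.

Local Notation ball_code := (code (fun k => ball (c k) (r k))).

(** On a compact set a continuous function hardly varies between points with
   the same code: finitely many of the balls cover the set and the function
   varies little on each of them, while two points with the same code belong
   to the same balls. *)
Lemma ball_code_uniform (X : set 'rV[R]_n) (psi : 'rV[R]_n -> R) (e : R) :
  compact X -> continuous psi -> 0 < e ->
  exists J, forall x y, X x -> ball_code J x = ball_code J y -> `|psi x - psi y| < e.
Proof.
move=> cX cpsi e0.
pose D := [set k | forall x y, ball (c k) (r k) x -> ball (c k) (r k) y ->
  `|psi x - psi y| < e].
have : X `<=` cover D (fun k => ball (c k) (r k)).
  move=> x Xx.
  have : open (psi @^-1` (ball (psi x) (e / 2))).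
    by apply: open_comp; [move=> ? _; exact: cpsi|exact: ball_open].
  move=> /cover_balls/(_ x)[|k kx kU]; first by apply: ballxx; rewrite divr_gt0.
  exists k => // y z ky kz.
  have kU' w : ball (c k) (r k) w -> ball (psi x) (e / 2) (psi w).
    by move=> kw; apply: kU; apply: le_ball kw; rewrite mulr2n lerDl ltW.
  have := ball_triangle (ball_sym (kU' _ ky)) (kU' _ kz).
  by rewrite -splitr.
move: cX; rewrite compact_cover => /(_ _ D (fun k => ball (c k) (r k))) H.
move=> /H[k _|F FD XF]; first exact: ball_open.
exists (\max_(k <- finmap.enum_fset F) k).+1 => x y Xx xy.
have [k /= kF kx] := XF x Xx.
have kJ : (k < (\max_(k <- finmap.enum_fset F) k).+1)%N by rewrite ltnS; apply: (@leq_bigmax_seq _ _ xpredT id).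
have kD : D k by have := FD k kF; rewrite inE.
apply: (kD _ _ kx).
have := code_eq_le kJ xy => /(congr1 odd); rewrite !code_odd (mem_set kx).
by move=> ky; apply: set_mem; rewrite -ky.
Qed.

End ball_codes.

Section image_measure.
Context d1 d2 (T1 : measurableType d1) (T2 : measurableType d2) (R : realType).
Variables (m : {finite_measure set T1 -> \bar R}) (phi : T1 -> T2).
Variable mphi : measurable_fun setT phi.

(** The proof of measurability is an argument so that the structure of a finite
    measure can be inferred from the term. *)
Definition image_measure (_ : measurable_fun setT phi) : set T2 -> \bar R :=
  pushforward m phi.

Let image0 : image_measure mphi set0 = 0%E. Proof. exact: measure0. Qed.

Let image_ge0 A : (0 <= image_measure mphi A)%E. Proof. exact: measure_ge0. Qed.

Let image_sigma_additive : semi_sigma_additive (image_measure mphi).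
Proof. exact: measure_semi_sigma_additive. Qed.

HB.instance Definition _ := isMeasure.Build _ _ _ (image_measure mphi)
  image0 image_ge0 image_sigma_additive.

Let image_fin : fin_num_fun (image_measure mphi).
Proof.
move=> A mA; rewrite /image_measure /pushforward fin_num_measure//.
by rewrite -[X in measurable X]setTI; exact: mphi.
Qed.

HB.instance Definition _ := Measure_isFinite.Build _ _ _ (image_measure mphi) image_fin.

Lemma Rintegral_image (f : T2 -> R) M : measurable_fun setT f ->
  (forall y, `|f y| <= M) ->
  \int[image_measure mphi]_y f y = \int[m]_x f (phi x).
Proof.
move=> mf fM; congr fine.
rewrite -[LHS]/(\int[pushforward m phi]_y (f y)%:E)%E integral_pushforward//.
  exact/measurable_EFinP.
rewrite preimage_setT; apply: (@finite_bounded_integrable _ _ _ m _ (f \o phi) M) => //.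
  exact: measurableT_comp.
by move=> x _; exact: fM.
Qed.

End image_measure.

Lemma Rintegral_close d (T : measurableType d) (R : realType)
    (mu : {measure set T -> \bar R}) (D : set T) (f g : T -> R) (e : R) :
  measurable D -> (mu D < +oo)%E -> mu.-integrable D (EFin \o f) ->
  mu.-integrable D (EFin \o g) -> (forall x, D x -> `|f x - g x| <= e) ->
  `|\int[mu]_(x in D) f x - \int[mu]_(x in D) g x| <= e * fine (mu D).
Proof.
move=> mD muD intf intg fg; rewrite -RintegralB//.
have intfg : mu.-integrable D (EFin \o (fun x => f x - g x)).
  by have := integrableB mD intf intg.
apply: (le_trans (le_normr_Rintegral mD intfg)); rewrite -Rintegral_cst//.
apply: le_Rintegral => //; first exact: integrable_norm intfg.
by apply: (@bounded_integrable _ _ _ _ _ mD _ `|e|).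
Qed.

Lemma cvg_sumr (R : realType) (I : Type) (s : seq I) (F : I -> nat -> R) (l : I -> R) :
  (forall i, F i k @[k --> \oo] --> l i) ->
  (fun k => \sum_(i <- s) F i k) @ \oo --> \sum_(i <- s) l i.
Proof.
move=> Fl; elim: s => [|i s IH].
  rewrite big_nil (_ : (fun k => _) = cst 0); first exact: cvg_cst.
  by apply/funext => k; rewrite big_nil.
rewrite big_cons (_ : (fun k => _) = (fun k => F i k + \sum_(j <- s) F j k)).
  exact: cvgD (Fl i) IH.
by apply/funext => k; rewrite big_cons.
Qed.

Section skorokhod.
Variables (R : realType) (n : nat) (c : nat -> 'rV[R]_n) (r : nat -> R).
Hypothesis cover_balls : forall U, open U -> forall x, U x ->
  exists2 k, ball (c k) (r k) x & ball (c k) (r k *+ 2) `<=` U.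
Hypothesis r_gt0 : forall k, 0 < r k.
Variables (X : set 'rV[R]_n) (mu : nat -> {finite_measure set 'rV[R]_n -> \bar R}).
Hypotheses (cX : compact X) (mX : measurable X).
Local Notation bcode := (code (fun k => ball (c k) (r k))).

(** The cells of level j.+1 refine those of level j; the hypothesis is that
    their masses converge at every level. *)
Definition cell j m := X `&` bcode j @^-1` [set m].

Variable w : nat -> nat -> R.
Hypothesis wP : forall j m, fine (mu k (cell j m)) @[k --> \oo] --> w j m.

Let measurable_ball_code j m : measurable (bcode j @^-1` [set m]).
Proof. by apply: measurable_code => k; exact: measurable_mx_ball. Qed.

Lemma measurable_cell j m : measurable (cell j m).
Proof. by apply: measurableI. Qed.

Lemma cell_split j m : cell j m = cell j.+1 m.*2 `|` cell j.+1 m.*2.+1.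
Proof.
apply/seteqP; split => x.
  move=> [Xx jm]; have [[] xm] : exists b : bool, bcode j.+1 x = (b + m.*2)%N.
  - by eexists; rewrite -jm.
  - by right.
  - by left.
by move=> [] [Xx jm]; split => //=; rewrite -code_half jm ?doubleK//= uphalf_double.
Qed.

Lemma w_ge0 j m : 0 <= w j m.
Proof.
by apply: (cvgr_to_ge (@wP j m)); apply: nearW => k; exact: fine_ge0.
Qed.

Lemma w_split j m : w j m = w j.+1 m.*2 + w j.+1 m.*2.+1.
Proof.
apply: (cvg_unique _ (@wP j m)) => //.
rewrite (_ : (fun k => _) = (fun k => fine (mu k (cell j.+1 m.*2)) +
    fine (mu k (cell j.+1 m.*2.+1)))); first exact: cvgD (@wP j.+1 m.*2) (@wP j.+1 _).
apply/funext => k.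
rewrite [in LHS]cell_split measureU; [|exact: measurable_cell..|].
  by rewrite fineD// fin_num_measure//; exact: measurable_cell.
apply/seteqP; split => // x [[_ /= a] [_ /=]]; rewrite a => /eqP.
by rewrite eqn_leq ltnn andbF.
Qed.

Lemma cell_nonempty j m : 0 < w j m -> cell j m !=set0.
Proof.
move=> w0; apply/set0P/eqP => cell0; move: w0.
have -> : w j m = 0; last by rewrite ltxx.
apply: (cvg_unique _ (@wP j m)) => //.
rewrite (_ : (fun k => _) = cst 0); first exact: cvg_cst.
by apply/funext => k; rewrite cell0 measure0.
Qed.

Lemma w_out j m : (2 ^ j <= m)%N -> w j m = 0.
Proof.
move=> jm; apply/eqP; rewrite eq_le w_ge0 andbT leNgt; apply/negP.
by move=> /cell_nonempty[x [_ /= xm]]; have := code_lt (fun k => ball (c k) (r k)) j x; rewrite xm ltnNge jm.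
Qed.

(** The intervals [cumw j m, cumw j m.+1[ have the limit masses of the cells as
   lengths, and are nested in the same way as the cells. *)
Definition cumw j m : R := \sum_(i < m) w j i.

Lemma cumwS j m : cumw j m.+1 = cumw j m + w j m.
Proof. by rewrite /cumw big_ord_recr. Qed.

Lemma cumw_split j m : cumw j.+1 m.*2 = cumw j m.
Proof.
elim: m => [|m IH]; first by rewrite /cumw !big_ord0.
by rewrite doubleS !cumwS IH (w_split j m) addrA.
Qed.

Lemma cumw_homo j : {homo cumw j : m m' / (m <= m')%N >-> m <= m'}.
Proof.
move=> m m' /subnK <-; elim: (m' - m)%N => // l IH.
by rewrite addSn cumwS (le_trans IH)// lerDl w_ge0.
Qed.

Lemma cumw_total j : cumw j (2 ^ j) = w 0 0.
Proof.
elim: j => [|j <-]; first by rewrite cumwS /cumw big_ord0 add0r.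
by rewrite expnS mul2n cumw_split.
Qed.

Definition D0 : set (measurableTypeR R) := [set` `[0, w 0 0[].

Definition path j (t : R) : nat := xget 0%N [set m | cumw j m <= t < cumw j m.+1].

Lemma path_unique j t m : cumw j m <= t < cumw j m.+1 -> path j t = m.
Proof.
move=> mP; have /(xgetPex 0%N) : exists m, cumw j m <= t < cumw j m.+1 by exists m.
rewrite -/(path j t) /= => pP; apply/eqP; rewrite eqn_leq.
move: pP mP => /andP[p1 p2] /andP[m1 m2].
by apply/andP; split; rewrite leqNgt; apply/negP => /(cumw_homo j); lra.
Qed.

Lemma pathP j t : D0 t -> cumw j (path j t) <= t < cumw j (path j t).+1.
Proof.
rewrite /D0/= in_itv/= => /andP[t0 t1].
suff [m mP] : exists m, cumw j m <= t < cumw j m.+1 by rewrite (path_unique mP).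
move: t1; rewrite -(cumw_total j); elim: (2 ^ j)%N => [|m IH] tm.
  by move: tm; rewrite /cumw big_ord0; lra.
have [/IH//|mt] := ltP t (cumw j m).
by exists m; rewrite mt.
Qed.

Lemma path_half j t : D0 t -> (path j.+1 t)./2 = path j t.
Proof.
move=> Dt; apply/esym/path_unique.
have /andP[p1 p2] := pathP j.+1 Dt; set m := path j.+1 t in p1 p2 *.
rewrite -(cumw_split j m./2) -(cumw_split j m./2.+1); apply/andP; split.
  by apply: le_trans p1; apply: cumw_homo; lia.
by apply: lt_le_trans p2 _; apply: cumw_homo; lia.
Qed.

Lemma path_lt j t : D0 t -> (path j t < 2 ^ j)%N.
Proof.
move=> Dt; rewrite ltnNge; apply/negP => jp.
by have := pathP j Dt; rewrite cumwS w_out// addr0; lra.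
Qed.

Lemma path_fiber j m : D0 `&` path j @^-1` [set m] =
  if (m < 2 ^ j)%N then [set` `[cumw j m, cumw j m.+1[] else set0.
Proof.
apply/seteqP; split => t.
  move=> [Dt /= pm]; have := pathP j Dt; have := path_lt j Dt.
  by rewrite pm => ->; rewrite /= in_itv.
case: ifPn => // mj; rewrite /= in_itv/= => tm; split; last exact: path_unique.
rewrite /D0/= in_itv/=; move: tm => /andP[t1 t2]; apply/andP; split.
  by apply: le_trans t1; rewrite -[leLHS](_ : cumw j 0 = 0) ?cumw_homo// /cumw big_ord0.
by apply: lt_le_trans t2 _; rewrite -(cumw_total j) cumw_homo.
Qed.

Lemma measurable_path_fiber j m : measurable (D0 `&` path j @^-1` [set m]).
Proof. by rewrite path_fiber; case: ifP => // _; exact: measurable_itv. Qed.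

Lemma path_fiber_length j m :
  fine (lebesgue_measure (D0 `&` path j @^-1` [set m])) = w j m.
Proof.
rewrite path_fiber; case: ifPn => [_|]; last first.
  by rewrite measure0 -leqNgt => /w_out ->.
rewrite lebesgue_measure_itv/= lte_fin cumwS ltrDl.
have := w_ge0 j m; rewrite le_eqVlt => /orP[/eqP <-|w0]; first by rewrite ltxx.
by rewrite w0/= addrAC subrr add0r.
Qed.

Definition cell_point j m : 'rV[R]_n := xget 0 (cell j m).

Lemma cell_pointP j t : D0 t -> cell j (path j t) (cell_point j (path j t)).
Proof.
move=> Dt; apply: (xgetPex 0); apply: cell_nonempty.
by have := pathP j Dt; rewrite cumwS; lra.
Qed.

Lemma bcode_cell_point i j t : D0 t -> (i <= j)%N ->
  bcode i (cell_point j (path j t)) = path i t.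
Proof.
move=> Dt ij; have [_ /=] := cell_pointP j Dt.
move: (cell_point _ _) => x; move: ij => /subnK <-; elim: (j - i)%N => // l IH.
by rewrite addSn => E; apply: IH; rewrite -[LHS]code_half [X in X./2]E path_half.
Qed.

(** The points chosen at the levels beyond J along a path all have the same
    code of level J, to which [ball_code_uniform] applies. *)
Lemma cell_point_uniform (psi : 'rV[R]_n -> R) e : continuous psi -> 0 < e ->
  exists J, (forall j t, (J <= j)%N -> D0 t ->
     `|psi (cell_point J (path J t)) - psi (cell_point j (path j t))| < e) /\
  forall x, X x -> `|psi x - psi (cell_point J (bcode J x))| < e.
Proof.
move=> cpsi e0; have [J JP] := ball_code_uniform cover_balls r_gt0 cX cpsi e0.
exists J; split=> [j t Jj Dt|x Xx].
  by apply: JP; [have [] := cell_pointP J Dt|rewrite !bcode_cell_point].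
apply: JP => //.
have : cell J (bcode J x) (cell_point J (bcode J x)) by apply: (xgetPex 0); exists x.
by case.
Qed.

Definition limit_point (t : R) : 'rV[R]_n :=
  \row_i lim ((fun j => cell_point j (path j t) 0 i) @ \oo).

Lemma limit_point_cvg t : D0 t ->
  cell_point j (path j t) @[j --> \oo] --> limit_point t.
Proof.
move=> Dt.
have cvi i : cell_point j (path j t) 0 i @[j --> \oo] --> limit_point t 0 i.
  rewrite mxE; apply: cauchy_cvg; apply: cauchy_exP => e e0.
  have [J [JP _]] := @cell_point_uniform (fun x => x 0 i) e (@coord_continuous _ _ _ _ _) e0.
  exists (cell_point J (path J t) 0 i); exists J => // j /= Jj.
  exact: JP j t Jj Dt.
apply/cvg_ballP => e e0.
have H : \forall j \near \oo, forall k : 'I_n,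
    ball (limit_point t 0 k) e (cell_point j (path j t) 0 k).
  by apply: filter_forall => k; have /cvg_ballP/(_ e e0) := cvi k.
by apply: filterS H => j Hj; split => // i k; rewrite (ord1 i).
Qed.

Lemma limit_point_close (psi : 'rV[R]_n -> R) e : continuous psi -> 0 < e ->
  exists J, (forall t, D0 t -> `|psi (cell_point J (path J t)) - psi (limit_point t)| <= e) /\
  forall x, X x -> `|psi x - psi (cell_point J (bcode J x))| <= e.
Proof.
move=> cpsi e0; have [J [JP JX]] := cell_point_uniform cpsi e0.
exists J; split=> [t Dt|x Xx]; last exact/ltW/JX.
have cvt : psi (cell_point j (path j t)) @[j --> \oo] --> psi (limit_point t).
  by apply: continuous_cvg; [exact: cpsi|exact: limit_point_cvg].
have cvn : `|psi (cell_point J (path J t)) - psi (cell_point j (path j t))| @[j --> \oo]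
    --> `|psi (cell_point J (path J t)) - psi (limit_point t)|.
  by apply: cvg_norm; apply: cvgB => //; exact: cvg_cst.
apply: (cvgr_to_le cvn); near=> j; apply/ltW/JP => //.
by near: j; exact: nbhs_infty_ge.
Unshelve. all: by end_near. Qed.

Let mD0 : measurable D0. Proof. exact: measurable_itv. Qed.

Let D0_fin : (lebesgue_measure D0 < +oo)%E.
Proof. by rewrite /D0 lebesgue_measure_itv/= lte_fin; case: ifP => // _; rewrite ltry. Qed.

Lemma path_step_measurable j (g : nat -> R) : measurable_fun D0 (g \o path j).
Proof. by apply: nat_valued_measurable => // m; exact: measurable_path_fiber. Qed.

Definition limit_map (t : measurableTypeR R) : 'rV[R]_n :=
  if t \in D0 then limit_point t else 0.

Lemma measurable_limit_map : measurable_fun setT limit_map.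
Proof.
apply: measurable_fun_entryP => i k; rewrite (ord1 i).
rewrite (_ : (fun _ => _) = (fun t => limit_point t 0 k) \_ D0); last first.
  by apply/funext => t; rewrite /limit_map /patch; case: ifP => // _; rewrite mxE.
apply/(measurable_restrictT _ mD0).
apply: (measurable_fun_cvg (h := fun j t => cell_point j (path j t) 0 k)).
  by move=> j; exact: (@path_step_measurable j (fun m => cell_point j m 0 k)).
move=> t Dt; exact: (cvg_comp _ _ (limit_point_cvg Dt) (@coord_continuous R 1 n 0 k _)).
Qed.

(** Skorokhod representation of a weak limit: the limit is the law, under the
   Lebesgue measure of [0, w 0 0[, of the point that the nested cells along
   the path of t shrink to. *)
Lemma skorokhod_limit C : (forall k, fine (mu k X) <= C) ->
  exists m : {finite_measure set 'rV[R]_n -> \bar R},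
  forall (psi : 'rV[R]_n -> R) M, continuous psi -> (forall x, `|psi x| <= M) ->
    \int[mu k]_(x in X) psi x @[k --> \oo] --> \int[m]_x psi x.
Proof.
move=> muC.
pose leb0 : {finite_measure set _ -> \bar R} := mfrestr mD0 D0_fin.
exists (image_measure leb0 measurable_limit_map) => psi M cpsi psiM.
have mpsi : measurable_fun setT psi by exact: continuous_mx_measurable.
rewrite (@Rintegral_image _ _ _ _ _ leb0 _ measurable_limit_map psi M)//.
have intD0 : (@lebesgue_measure R).-integrable setT (EFin \o \1_D0).
  apply/integrableP; split; first by apply/measurable_EFinP; exact: measurable_indic.
  under eq_integral do rewrite /= ger0_norm ?indicE//.
  by rewrite integral_indic// setIT.
have -> : \int[leb0]_t psi (limit_map t) =
    \int[lebesgue_measure]_(t in D0) psi (limit_point t).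
  have leb0E A : measurable A ->
      leb0 A = (\int[lebesgue_measure]_(t in A) (\1_D0 t)%:E)%E.
    by move=> mA; rewrite integral_indic// setIC.
  have mpl : measurable_fun setT (psi \o limit_map).
    exact: measurableT_comp measurable_limit_map.
  rewrite (Rintegral_density intD0 leb0E measurableT mpl (M := M)); last first.
    by move=> t _; exact: psiM.
  rewrite [RHS]Rintegral_mkcond; apply: eq_Rintegral => t _.
  rewrite /= /limit_map /patch indicE; case: (t \in D0); first by rewrite mulr1.
  by rewrite mulr0.
have C0 : 0 <= C by apply: le_trans (muC 0%N); exact: fine_ge0.
apply/cvgrPdist_le => e e0.
pose e' := e / (C + w 0 0 + 1).
have Cw0 : 0 < C + w 0 0 + 1 by rewrite ltr_wpDl// addr_ge0// w_ge0.
have e'0 : 0 < e' by rewrite divr_gt0.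
have [J [JD JX]] := limit_point_close cpsi e'0.
pose g m := psi (cell_point J m).
have codeN x : X x -> (bcode J x < 2 ^ J)%N by move=> _; exact: code_lt.
have pathN t : D0 t -> (path J t < 2 ^ J)%N by exact: path_lt.
have muX k : (mu k X < +oo)%E by rewrite ltey_eq fin_num_measure.
have stepX k := nat_valued_Rintegral mX (muX k) (measurable_cell J) codeN g.
have stepD := nat_valued_Rintegral mD0 D0_fin (measurable_path_fiber J) pathN g.
have mstepX := nat_valued_measurable (measurable_cell J) g.
have mstepD := @path_step_measurable J g.
have limD : fine (lebesgue_measure D0) = w 0 0.
  rewrite lebesgue_measure_itv/= lte_fin; have := w_ge0 0 0.
  by rewrite le_eqVlt => /orP[/eqP <-|w0]; rewrite ?ltxx// w0 /= subr0.
have gM m : `|g m| <= M by exact: psiM.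
have intX k (f : 'rV[R]_n -> R) : measurable_fun X f -> (forall x, X x -> `|f x| <= M) ->
    (mu k).-integrable X (EFin \o f).
  by move=> mf fM; apply: bounded_integrable fM => //; exact: muX.
have close1 k : `|\int[mu k]_(x in X) psi x - \int[mu k]_(x in X) g (bcode J x)| <= e' * C.
  apply: le_trans (_ : e' * fine (mu k X) <= _); last by rewrite ler_wpM2l// ltW.
  apply: Rintegral_close => //.
  - exact: muX.
  - by apply: intX => //; exact: measurable_funTS.
  - exact: intX.
have close2 : `|\int[lebesgue_measure]_(t in D0) g (path J t) -
    \int[lebesgue_measure]_(t in D0) psi (limit_point t)| <= e' * w 0 0.
  rewrite -limD; apply: Rintegral_close => //.
  - exact: (@bounded_integrable _ _ _ _ _ mD0 _ M).
  - apply: (@bounded_integrable _ _ _ _ _ mD0 _ M) => //.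
    apply: (measurable_fun_cvg (h := fun j t => psi (cell_point j (path j t)))).
      by move=> j; exact: (@path_step_measurable j (fun m => psi (cell_point j m))).
    move=> t Dt; apply: continuous_cvg; first exact: cpsi.
    exact: limit_point_cvg.
have cvstep : \int[mu k]_(x in X) g (bcode J x) @[k --> \oo] -->
    \int[lebesgue_measure]_(t in D0) g (path J t).
  rewrite stepD (_ : (fun k => _) = (fun k => \sum_(m < 2 ^ J) g m * fine (mu k (cell J m)))).
    apply: cvg_sumr => m; rewrite path_fiber_length.
    by apply: cvgM; [exact: cvg_cst|exact: wP].
  by apply/funext => k; rewrite stepX.
have /cvgrPdist_le/(_ _ e'0) cvstep' := cvstep.
near=> k.
have close3 : `|\int[lebesgue_measure]_(t in D0) g (path J t) -
  \int[mu k]_(x in X) g (bcode J x)| <= e' by near: k.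
have -> : e = e' * w 0 0 + e' * C + e'.
  by rewrite -mulrDr -[X in _ + X]mulr1 -mulrDr (addrC _ C) /e' divfK ?gt_eqF.
move: close1 close2 close3 => /(_ k).
move: (Rintegral _ _ _) (Rintegral _ _ _) (Rintegral _ _ _) (Rintegral _ _ _) => a b p q.
rewrite !ler_norml; lra.
Unshelve. all: by end_near. Qed.

End skorokhod.

Section L1_weak_compactness.
Variables (R : realType) (n : nat) (Omega X : set 'rV[R]_n).
Hypotheses (mOmega : measurable Omega) (cX : compact X) (mX : measurable X).
Hypothesis OX : Omega `<=` X.
Local Notation leb := (lebesgue_rV R n).
Local Notation finmeas := {finite_measure set 'rV[R]_n -> \bar R}.

(** The representation of weak limits is for measures, hence the splitting into
    Jordan parts; both masses are bounded by the L^1 norm. *)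
Lemma L1_jordan (f : 'rV[R]_n -> R) : leb.-integrable Omega (EFin \o f) ->
  exists pq : finmeas * finmeas,
  [/\ fine (pq.1 X) <= \int[leb]_(x in Omega) `|f x|,
      fine (pq.2 X) <= \int[leb]_(x in Omega) `|f x| &
      forall (psi : 'rV[R]_n -> R) M, measurable_fun setT psi -> (forall x, `|psi x| <= M) ->
        \int[leb]_(x in Omega) (psi x * f x) =
        \int[pq.1]_(x in X) psi x - \int[pq.2]_(x in X) psi x].
Proof.
move=> intf.
have intfO : leb.-integrable setT (EFin \o (f \_ Omega)).
  by rewrite -restrict_EFin; apply/(integrable_mkcond _ mOmega).
pose nu := induced_charge intfO.
have mass A : measurable A -> `|fine (nu A)| <= \int[leb]_(x in Omega) `|f x|.
  move=> mA; rewrite -[fine (nu A)]/(\int[leb]_(x in A) (f \_ Omega) x).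
  have intA : leb.-integrable A (EFin \o (f \_ Omega)) by exact: (integrableS measurableT mA (@subsetT _ _) intfO).
  apply: (le_trans (le_normr_Rintegral mA intA)).
  rewrite [leRHS]Rintegral_mkcond.
  have -> : (fun x => `|f x|) \_ Omega = (fun x => `|(f \_ Omega) x|).
    by apply/funext => x; rewrite /patch; case: ifP => // _; rewrite normr0.
  have intn : leb.-integrable setT (EFin \o (fun x => `|(f \_ Omega) x|)).
    exact: integrable_norm intfO.
  apply: fine_le.
  - apply: integrable_fin_num => //.
    exact: (integrableS measurableT mA (@subsetT _ _) intn).
  - exact: integrable_fin_num.
  - apply: ge0_subset_integral => //; exact: measurable_int intn.
have [P [N [h E]]] := charge_integral_jordan nu.
have [[mP _] [mN _] _ _] := h.
exists (jordan_pos h : finmeas, jordan_neg h : finmeas); split.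
- rewrite [X in fine X](jordanE h mX).1; apply: le_trans (mass _ _).
    exact: ler_norm.
  exact: measurableI.
- rewrite [X in fine X](jordanE h mX).2 fineN; apply: le_trans (mass (X `&` N) _).
    by rewrite -normrN ler_norm.
  exact: measurableI.
- move=> psi M mpsi psiM; rewrite -E.
  rewrite (charge_integral_density intfO (nu := nu) _ mX (measurable_funTS mpsi) (M := M))//.
  rewrite Rintegral_mkcond [RHS]Rintegral_mkcond; apply: eq_Rintegral => x _.
  rewrite /patch; case: (boolP (x \in Omega)) => xO.
    by rewrite mem_set//; apply: OX; exact: set_mem.
  by rewrite mulr0 if_same.
Qed.

(** The masses of the cells of all partitions, for both parts of all the
    sequences, are countably many bounded sequences of numbers, so that a single
    diagonal extraction serves them all. *)
Lemma L1_weak_compactness (T : countType) (f : T -> nat -> 'rV[R]_n -> R) (C : T -> R) :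
  (forall t k, leb.-integrable Omega (EFin \o f t k)) ->
  (forall t k, \int[leb]_(x in Omega) `|f t k x| <= C t) ->
  exists (sigma : nat -> nat) (m : T -> finmeas * finmeas),
    (forall k, (k <= sigma k)%N) /\
    forall t (psi : 'rV[R]_n -> R) M, continuous psi -> (forall x, `|psi x| <= M) ->
      \int[leb]_(x in Omega) (psi x * f t (sigma k) x) @[k --> \oo] -->
      \int[(m t).1]_x psi x - \int[(m t).2]_x psi x.
Proof.
move=> intf fC; have [c [r [r0 H]]] := mx_ball_cover R 1 n.
have /choice[pq pqP] : forall tk : T * nat, exists pq : finmeas * finmeas,
  [/\ fine (pq.1 X) <= C tk.1, fine (pq.2 X) <= C tk.1 &
      forall (psi : 'rV[R]_n -> R) M, measurable_fun setT psi -> (forall x, `|psi x| <= M) ->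
        \int[leb]_(x in Omega) (psi x * f tk.1 tk.2 x) =
        \int[pq.1]_(x in X) psi x - \int[pq.2]_(x in X) psi x].
  move=> [t k]; have [pq [h1 h2 h3]] := L1_jordan (intf t k).
  by exists pq; split => //; apply: le_trans (fC t k).
pose mu (tb : T * bool) k : finmeas := if tb.2 then (pq (tb.1, k)).1 else (pq (tb.1, k)).2.
have muC tb k : fine (mu tb k X) <= C tb.1.
  by case: tb => t [] /=; have [? ? _] := pqP (t, k).
have cellC tb k j l : `|fine (mu tb k (cell c r X j l))| <= C tb.1.
  rewrite ger0_norm ?fine_ge0//; apply: le_trans (muC tb k).
  have mc : measurable (cell c r X j l) by exact: measurable_cell.
  rewrite fine_le ?fin_num_measure//; apply: le_measure; rewrite ?inE//.
  exact: subIsetl.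
have [sigma [w [sk wP]]] := @diagonal_extraction R (T * bool * (nat * nat))%type
  (fun q k => fine (mu q.1 k (cell c r X q.2.1 q.2.2))) (fun q => C q.1.1)
  (fun q k => cellC q.1 k q.2.1 q.2.2).
have /choice[m mP] tb : exists m : finmeas,
  forall (psi : 'rV[R]_n -> R) M, continuous psi -> (forall x, `|psi x| <= M) ->
    \int[mu tb (sigma k)]_(x in X) psi x @[k --> \oo] --> \int[m]_x psi x.
  apply: (@skorokhod_limit R n c r H r0 X (fun k => mu tb (sigma k)) cX mX
    (fun j l => w (tb, (j, l))) _ (C tb.1)) => //.
  by move=> j l; exact: (wP (tb, (j, l))).
exists sigma, (fun t => (m (t, true), m (t, false))); split => // t psi M cpsi psiM /=.
rewrite (_ : (fun k => _) = (fun k => \int[mu (t, true) (sigma k)]_(x in X) psi x -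
  \int[mu (t, false) (sigma k)]_(x in X) psi x)).
  by apply: cvgB; exact: mP psiM.
apply/funext => k; have [_ _ /(_ psi M)] := pqP (t, sigma k); apply => //.
exact: continuous_mx_measurable.
Qed.

End L1_weak_compactness.

(** * Translations in L^1 *)

Section translation_estimate.
Variables (R : realType) (n : nat).
Local Notation leb := (lebesgue_rV R n).
Implicit Types (x v : 'rV[R]_n) (phi : 'rV[R]_n -> R).

Lemma is_derive_along_line phi x (e : 'rV[R]_n) (t : R) :
  derivable phi (t *: e + x) e ->
  is_derive t (1 : R) (fun s : R => phi (s *: e + x)) ('D_e phi (t *: e + x)).
Proof.
move=> dphi.
have E : (fun h : R => h^-1 *: (((fun s : R => phi (s *: e + x)) \o shift t) (h *: (1 : R)) -
      phi (t *: e + x))) =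
    (fun h : R => h^-1 *: ((phi \o shift (t *: e + x)) (h *: e) - phi (t *: e + x))).
  by apply/funext => h /=; rewrite [h *: 1]mulr1 scalerDl addrA.
by apply: DeriveDef; rewrite /derivable /derive E.
Qed.

Lemma continuous_line phi x (e : 'rV[R]_n) : continuous phi ->
  continuous (fun s : R => phi (s *: e + x)).
Proof.
move=> cphi s; apply: (@continuous_comp _ _ _ (fun s : R => s *: e + x) phi).
  apply: (@continuousD R _ _ (fun s : R => s *: e) (cst x)); last exact: cst_continuous.
  exact: scalel_continuous.
exact: cphi.
Qed.

(** The fundamental theorem of calculus on a segment. *)
Lemma increment_le_integral phi (j : 'I_n) x (h : R) :
  (forall y, derivable phi y (basis_vec R j)) -> continuous (pderiv j phi) -> 0 < h ->
  (`|phi (h *: basis_vec R j + x) - phi x|%:E <=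
   \int[lebesgue_measure]_(t in `[0%R, h]) `|pderiv j phi (t *: basis_vec R j + x)|%:E)%E.
Proof.
move=> dphi cdphi h0; set e := basis_vec R j.
pose g (s : R) := phi (s *: e + x); pose g' (s : R) := pderiv j phi (s *: e + x).
have dg (s : R) : is_derive s (1 : R) g (g' s) by exact: is_derive_along_line.
have cg : continuous g.
  move=> s; apply: differentiable_continuous; apply/derivable1_diffP.
  by have [] := dg s.
have cg' : continuous g' by exact: continuous_line.
have FTC : (\int[lebesgue_measure]_(t in `[0%R, h]) (g' t)%:E = (g h)%:E - (g 0%R)%:E)%E.
  apply: continuous_FTC2 => //.
  - exact: continuous_subspaceT.
  - split; [by move=> s _; have [] := dg s| |].
    + by apply: cvg_at_right_filter; exact: cg.
    + by apply: cvg_at_left_filter; exact: cg.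
  - by move=> s _; rewrite derive1E; have [_ ->] := dg s.
have -> : (`|phi (h *: e + x) - phi x|%:E =
    `|\int[lebesgue_measure]_(t in `[0%R, h]) (g' t)%:E|)%E.
  by rewrite FTC /g scale0r add0r.
apply: le_abse_integral => //; apply/measurable_EFinP; apply: measurable_funTS.
exact: continuous_measurable_fun.
Qed.

Definition L1norm phi : \bar R := (\int[leb]_x `|phi x|%:E)%E.

Lemma L1norm_ge0 phi : (0 <= L1norm phi)%E.
Proof. by apply: integral_ge0 => x _; rewrite lee_fin. Qed.

Definition C1 phi := continuous phi /\
  forall j, continuous (pderiv j phi) /\ forall y, derivable phi y (basis_vec R j).

Lemma measurable_abs_EFin d (T : measurableType d) (f : T -> R) :
  measurable_fun setT f -> measurable_fun setT (fun x : T => `|f x|%:E).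
Proof. by move=> mf; apply/measurable_EFinP; exact: measurableT_comp. Qed.

Lemma L1norm_shift phi v : measurable_fun setT phi ->
  L1norm (fun x => phi (x + v)) = L1norm phi.
Proof.
move=> mphi; apply: (ge0_integral_shift (f := fun x => `|phi x|%:E)) => //.
exact: measurable_abs_EFin.
Qed.

Lemma measurable_line (e : 'rV[R]_n) :
  measurable_fun setT (fun xt : 'rV[R]_n * measurableTypeR R => xt.2 *: e + xt.1).
Proof.
apply: measurable_fun_entryP => i j.
rewrite (_ : (fun _ => _) = (fun xt : 'rV[R]_n * measurableTypeR R =>
   xt.2 * e i j + xt.1 i j)); last by apply/funext => xt; rewrite !mxE.
apply: measurable_funD; first by apply: measurable_funM.
exact: measurableT_comp (measurable_entry i j) measurable_fst.
Qed.

(** Tonelli's theorem and translation invariance turn the pointwise bound of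
   the increment into an estimate in L^1. *)
Lemma L1_translation_basis phi (j : 'I_n) (h : R) : C1 phi -> 0 <= h ->
  (L1norm (fun x => phi (x + h *: basis_vec R j) - phi x)%R <=
   h%:E * L1norm (pderiv j phi))%E.
Proof.
move=> [cphi Cphi]; have [cdphi dphi] := Cphi j.
rewrite le_eqVlt => /orP[/eqP <-|h0].
  rewrite mul0e /L1norm integral0_eq// => x _.
  by rewrite scale0r addr0 subrr normr0.
have mphi : measurable_fun setT phi by exact: continuous_mx_measurable.
have mdphi : measurable_fun setT (pderiv j phi) by exact: continuous_mx_measurable.
pose e := basis_vec R j.
pose f (xt : 'rV[R]_n * measurableTypeR R) : \bar R :=
  (`|pderiv j phi (xt.2 *: e + xt.1)| * \1_(`[0, h]%classic) xt.2)%:E.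
have mf : measurable_fun setT f.
  apply/measurable_EFinP; apply: measurable_funM.
    apply: measurableT_comp => //; apply: measurableT_comp => //.
    exact: measurable_line.
  by apply: measurableT_comp => //; exact: measurable_indic.
have f0 xt : (0 <= f xt)%E by rewrite lee_fin mulr_ge0.
have fE x : (\int[lebesgue_measure]_t f (x, t) =
    \int[lebesgue_measure]_(t in `[0%R, h]) `|pderiv j phi (t *: e + x)|%:E)%E.
  rewrite [RHS]integral_mkcond; apply: eq_integral => t _.
  rewrite /f/= /patch indicE; case: (t \in _); first by rewrite mulr1.
  by rewrite mulr0.
apply: (@le_trans _ _ (\int[leb]_x \int[lebesgue_measure]_t f (x, t))%E).
  apply: ge0_le_integral => //.
  - apply: measurable_abs_EFin; apply: measurable_funB => //.
    by apply: measurableT_comp => //; exact: measurable_rV_shift.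
  - exact: measurable_fun_fubini_tonelli_F.
  - by move=> x _; rewrite fE (addrC x); exact: increment_le_integral.
rewrite (fubini_tonelli f)//.
have E t : (\int[leb]_x f (x, t) = (\1_(`[0, h]%classic) t)%:E * L1norm (pderiv j phi))%E.
  rewrite -(L1norm_shift (t *: e) mdphi) -ge0_integralZl//=.
  - by apply: eq_integral => x _; rewrite /f/= EFinM muleC addrC.
  - apply: measurable_abs_EFin; apply: measurableT_comp => //.
    exact: measurable_rV_shift.
under eq_integral do rewrite E.
rewrite ge0_integralZr//; last 2 first.
- by apply/measurable_EFinP; exact: measurable_indic.
- exact: L1norm_ge0.
have lebh : lebesgue_measure (`[0, h]%classic : set (measurableTypeR R)) = h%:E.
  by rewrite lebesgue_measure_itv/= lte_fin h0 sube0.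
by rewrite integral_indic// setIT [X in (X * _ <= _)%E]lebh.
Qed.

(** The translation is made one coordinate at a time; the increments along the
    way are translates of those of [L1_translation_basis]. *)
Lemma L1_translation phi v (h : R) : C1 phi -> (forall i, 0 <= v 0 i <= h) ->
  (L1norm (fun x => phi (x + v) - phi x)%R <=
   h%:E * \sum_(j < n) L1norm (pderiv j phi))%E.
Proof.
move=> Cphi vh; have mphi : measurable_fun setT phi.
  by apply: continuous_mx_measurable; have [] := Cphi.
have -> : v = \sum_(j < n) v 0 j *: basis_vec R j by rewrite [LHS]row_sum_delta.
elim: (index_enum _) => [|j s IH].
  rewrite !big_nil mule0 /L1norm integral0_eq// => x _.
  by rewrite addr0 subrr normr0.
rewrite !big_cons; set w := \sum_(_ <- s) _ in IH *; set u := _ *: _.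
have /andP[vj0 vjh] := vh j.
have mshift z : measurable_fun setT (fun x => phi (x + z)).
  by apply: measurableT_comp => //; exact: measurable_rV_shift.
have mshift2 : measurable_fun setT (fun x => phi (x + u + w)).
  rewrite (_ : (fun x => _) = (fun x => phi (x + (u + w)))); first exact: mshift.
  by apply/funext => x; rewrite addrA.
rewrite ge0_muleDr ?L1norm_ge0//; last by apply: sume_ge0 => i _; exact: L1norm_ge0.
have -> : L1norm (fun x => phi (x + (u + w)) - phi x) =
    L1norm (fun x => (phi (x + u + w) - phi (x + u)) + (phi (x + u) - phi x)).
  by congr L1norm; apply/funext => x; rewrite addrA; ring.
apply: (@le_trans _ _ (L1norm (fun x => (phi (x + u + w) - phi (x + u))%R) +
   L1norm (fun x => (phi (x + u) - phi x)%R))%E).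
  rewrite /L1norm -ge0_integralD//; last 2 first.
  - apply: measurable_abs_EFin; apply: measurable_funB => //.
  - by apply: measurable_abs_EFin; apply: measurable_funB.
  apply: ge0_le_integral => //.
  - apply: measurable_abs_EFin; apply: measurable_funD; apply: measurable_funB => //.
  - apply: emeasurable_funD; apply: measurable_abs_EFin; apply: measurable_funB => //.
  - by move=> x _; rewrite -EFinD lee_fin ler_normD.
rewrite addeC; apply: leeD.
  apply: le_trans (L1_translation_basis j Cphi vj0) _.
  by rewrite lee_wpmul2r ?L1norm_ge0 ?lee_fin.
rewrite (L1norm_shift u (phi := fun x => phi (x + w) - phi x))//.
exact: measurable_funB.
Qed.

End translation_estimate.

(** * Mollification *)

Section kernel.
Variables (R : realType) (n : nat) (h : R).
Hypothesis h0 : 0 < h.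
Local Notation leb := (lebesgue_rV R n).

(** A continuous kernel supported in the cube [0, h]^n of the positive orthant,
   where all the coordinates of the translations are nonnegative. *)
Definition kernel : 'rV[R]_n -> R := ball_bump (const_mx (h / 2)) (h / 2) 0.

Lemma kernel_ge0 x : 0 <= kernel x. Proof. exact: ball_bump_ge0. Qed.

Lemma kernel_le1 x : kernel x <= 1. Proof. exact: ball_bump_le1. Qed.

Lemma kernel_continuous : continuous kernel.
Proof. by apply: bump_alg_continuous; exact: bump_alg_ball_bump. Qed.

Lemma kernel_measurable : measurable_fun setT (kernel : _ -> measurableTypeR R).
Proof. by apply: continuous_mx_measurable; exact: kernel_continuous. Qed.

Lemma kernel_support x : kernel x != 0 -> forall i, 0 <= x 0 i <= h.
Proof.
move=> kx i; have [|xb] := pselect (ball (const_mx (h / 2) : 'rV[R]_n) (h / 2) x).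
  by move=> [_ /(_ 0 i)]; rewrite /ball/= mxE ltr_distlC; lra.
by move: kx; rewrite /kernel ball_bump_out ?eqxx// divr_gt0.
Qed.

Lemma kernel_integrable : leb.-integrable setT (EFin \o kernel).
Proof.
have hh : 0 <= h by exact: ltW.
pose Q := rV_box (n := n) (fun=> [set` `[- h, h]]).
have mQ : measurable Q by apply: measurable_rV_box => k.
have Qfin : (leb Q < +oo)%E by rewrite leb_cube// ltry.
have iQ : leb.-integrable Q (EFin \o kernel).
  apply: (@bounded_integrable _ _ _ _ _ mQ _ 1).
  - exact: Qfin.
  - by apply: measurable_funTS; exact: kernel_measurable.
  - by move=> x _; rewrite ger0_norm ?kernel_ge0 ?kernel_le1.
have := (integrable_mkcond (EFin \o kernel) mQ).1 iQ; congr (leb.-integrable setT _).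
apply/funext => x; rewrite /patch; case: ifPn => // xQ /=; apply/esym; congr EFin.
apply/eqP; apply: contraNT xQ => /kernel_support H; apply/mem_set => k /=.
by have := H k; rewrite in_itv/=; lra.
Qed.

Definition kernel_mass : R := \int[leb]_x kernel x.

Lemma kernel_massE : (\int[leb]_x (kernel x)%:E)%E = kernel_mass%:E.
Proof. by rewrite /kernel_mass /Rintegral fineK//; exact: integrable_fin_num kernel_integrable. Qed.

(** All the factors of the bump are bounded below on [h/4, 3h/4]^n. *)
Lemma kernel_mass_gt0 : 0 < kernel_mass.
Proof.
rewrite -lte_fin -kernel_massE.
pose a (_ : 'I_n) := h / 4; pose b (_ : 'I_n) := 3 * h / 4.
have ab k : a k <= b k by move: h0; rewrite /a /b /=; lra.
pose Q := rV_box (fun k => [set` `[a k, b k]]).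
have mQ : measurable Q by apply: measurable_rV_box => k.
pose d := (expR (- (h / 4)^-1) * expR (- (h / 4)^-1)) ^+ n.
have d0 : 0 < d by rewrite exprn_gt0// mulr_gt0// expR_gt0.
apply: (@lt_le_trans _ _ (\int[leb]_(x in Q) d%:E)%E).
  rewrite integral_cst// [X in (_ < _ * X)%E](leb_itv_box ab) -EFinM lte_fin mulr_gt0// prodr_gt0// => k _.
  by move: h0; rewrite /a /b /=; lra.
apply: (@le_trans _ _ (\int[leb]_(x in Q) (kernel x)%:E)%E).
  apply: ge0_le_integral => //.
  - by move=> x _; rewrite lee_fin ltW.
  - by apply/measurable_EFinP; apply: measurable_funTS; exact: kernel_measurable.
  - move=> x Qx; rewrite lee_fin /kernel ball_bumpE /d -[in leLHS](card_ord n) -prodr_const.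
    have flat_ge (t : R) : h / 4 <= t -> expR (- (h / 4)^-1) <= flat 1 (1 * t).
      move=> ht; have t0 : 0 < t by rewrite (lt_le_trans _ ht)// divr_gt0.
      rewrite mul1r flat1E t0 ler_expR lerN2 lef_pV2 ?posrE// divr_gt0//.
    apply: ler_prod => i _; rewrite mulr_ge0 ?expR_ge0//= mxE.
    have := Qx i; rewrite /= in_itv/= /a /b => /andP[x1 x2].
    by apply: ler_pM; rewrite ?expR_ge0// flat_ge//; lra.
apply: ge0_subset_integral => //.
  by apply/measurable_EFinP; exact: kernel_measurable.
by move=> x _; rewrite lee_fin kernel_ge0.
Qed.

End kernel.

Section kernel_estimate.
Variables (R : realType) (n : nat) (h : R).
Hypothesis h0 : 0 < h.
Local Notation leb := (lebesgue_rV R n).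
Local Notation rho := (@kernel R n h).
Implicit Types phi : 'rV[R]_n -> R.

Lemma measurable_rV_add :
  measurable_fun setT (fun xv : 'rV[R]_n * 'rV[R]_n => xv.1 + xv.2).
Proof.
apply: measurable_fun_entryP => i j.
rewrite (_ : (fun _ => _) = (fun xv : 'rV[R]_n * 'rV[R]_n =>
   xv.1 i j + xv.2 i j)); last by apply/funext => xv; rewrite !mxE.
apply: measurable_funD.
  exact: measurableT_comp (measurable_entry i j) measurable_fst.
exact: measurableT_comp (measurable_entry i j) measurable_snd.
Qed.

Lemma measurable_rV_sub :
  measurable_fun setT (fun xv : 'rV[R]_n * 'rV[R]_n => xv.2 - xv.1).
Proof.
apply: measurable_fun_entryP => i j.
rewrite (_ : (fun _ => _) = (fun xv : 'rV[R]_n * 'rV[R]_n =>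
   xv.2 i j - xv.1 i j)); last by apply/funext => xv; rewrite !mxE.
apply: measurable_funB.
  exact: measurableT_comp (measurable_entry i j) measurable_snd.
exact: measurableT_comp (measurable_entry i j) measurable_fst.
Qed.

(** The weighted oscillation of phi near x, which dominates the error of
    mollification. *)
Definition deviation phi (x : 'rV[R]_n) : \bar R :=
  (\int[leb]_v (rho v * `|phi (x + v) - phi x|)%:E)%E.

Let measurable_deviation_kernel phi : measurable_fun setT phi ->
  measurable_fun setT (fun xv : 'rV[R]_n * 'rV[R]_n =>
    (rho xv.2 * `|phi (xv.1 + xv.2) - phi xv.1|)%:E).
Proof.
move=> mphi; apply/measurable_EFinP; apply: measurable_funM.
  by apply: measurableT_comp (measurable_snd); exact: kernel_measurable.
apply: measurableT_comp => //; apply: measurable_funB.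
  exact: measurableT_comp measurable_rV_add.
exact: measurableT_comp measurable_fst.
Qed.

Lemma measurable_deviation phi : measurable_fun setT phi ->
  measurable_fun setT (deviation phi).
Proof.
move=> mphi; apply: (measurable_fun_fubini_tonelli_F (fun xv : 'rV[R]_n * 'rV[R]_n =>
    (rho xv.2 * `|phi (xv.1 + xv.2) - phi xv.1|)%:E)).
  exact: measurable_deviation_kernel.
by move=> xv; rewrite lee_fin mulr_ge0// kernel_ge0.
Qed.

(** Tonelli's theorem: this is the translation estimate averaged over the
    kernel. *)
Lemma integral_deviation phi (B : R) : C1 phi ->
  (\sum_(j < n) L1norm (pderiv j phi) <= B%:E)%E ->
  (\int[leb]_x deviation phi x <= (@kernel_mass R n h * (h * B))%:E)%E.
Proof.
move=> Cphi phiB; have mphi : measurable_fun setT phi.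
  by apply: continuous_mx_measurable; have [] := Cphi.
rewrite /deviation (fubini_tonelli (fun xv : 'rV[R]_n * 'rV[R]_n =>
    (rho xv.2 * `|phi (xv.1 + xv.2) - phi xv.1|)%:E)); last 2 first.
- exact: measurable_deviation_kernel.
- by move=> xv; rewrite lee_fin mulr_ge0// kernel_ge0.
have mdiff v : measurable_fun setT (fun x : 'rV[R]_n => `|phi (x + v) - phi x|%:E).
  apply: measurable_abs_EFin; apply: measurable_funB => //.
  by apply: measurableT_comp => //; exact: measurable_rV_shift.
have B0 : 0 <= B.
  by rewrite -lee_fin (le_trans _ phiB)// sume_ge0// => j _; exact: L1norm_ge0.
apply: (@le_trans _ _ (\int[leb]_v ((rho v)%:E * (h * B)%:E))%E); last first.
  rewrite ge0_integralZr//; last 3 first.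
  - by apply/measurable_EFinP; exact: kernel_measurable.
  - by move=> x _; rewrite lee_fin kernel_ge0.
  - by rewrite lee_fin mulr_ge0// ltW.
  by rewrite kernel_massE// -EFinM.
apply: ge0_le_integral => //.
- by move=> v _; apply: integral_ge0 => x _; rewrite lee_fin mulr_ge0// kernel_ge0.
- apply: (measurable_fun_fubini_tonelli_G (fun xv : 'rV[R]_n * 'rV[R]_n =>
    (rho xv.2 * `|phi (xv.1 + xv.2) - phi xv.1|)%:E)).
    exact: measurable_deviation_kernel.
  by move=> xv; rewrite lee_fin mulr_ge0// kernel_ge0.
- by apply: emeasurable_funM => //; apply/measurable_EFinP; exact: kernel_measurable.
move=> v _ /=; under eq_integral do rewrite EFinM.
rewrite ge0_integralZl//; last by rewrite lee_fin kernel_ge0.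
have [->|rv] := eqVneq (rho v) 0; first by rewrite !mul0e.
rewrite lee_wpmul2l// ?lee_fin ?kernel_ge0// EFinM.
apply: le_trans (L1_translation Cphi (kernel_support h0 rv)) _.
by rewrite lee_wpmul2l// lee_fin ltW.
Qed.

(** The kernel is not normalized: its mass stays as a factor in the
    estimates. *)
Definition mollify phi (x : 'rV[R]_n) : R := \int[leb]_y (rho (y - x) * phi y).

Lemma mollify_deviation phi x : measurable_fun setT phi ->
  leb.-integrable setT (EFin \o phi) ->
  (`|@kernel_mass R n h * phi x - mollify phi x|%:E <= deviation phi x)%E.
Proof.
move=> mphi iphi.
have mk : measurable_fun setT (fun y : 'rV[R]_n => rho (y - x)).
  by apply: (measurableT_comp (@kernel_measurable R n h)); exact: measurable_rV_shift.
have kE : (\int[leb]_y (rho (y - x))%:E = (@kernel_mass R n h)%:E)%E.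
  rewrite -kernel_massE// -(@ge0_integral_shift _ _ (EFin \o rho) (- x))//.
    by apply/measurable_EFinP; exact: kernel_measurable.
  by move=> y; rewrite lee_fin kernel_ge0.
have ik : leb.-integrable setT (EFin \o (fun y : 'rV[R]_n => rho (y - x))).
  apply/integrableP; split; first exact/measurable_EFinP.
  under eq_integral do rewrite /= ger0_norm ?kernel_ge0//.
  by rewrite kE ltry.
have ikc : leb.-integrable setT (EFin \o (fun y : 'rV[R]_n => rho (y - x) * phi x)).
  by have := integrableZr measurableT (phi x) ik.
have ikp : leb.-integrable setT (EFin \o (fun y : 'rV[R]_n => rho (y - x) * phi y)).
  apply: (@bounded_mul_integrable _ _ _ _ _ measurableT phi _ 1) => // y _.
  by rewrite ger0_norm ?kernel_ge0 ?kernel_le1.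
have -> : @kernel_mass R n h * phi x - mollify phi x =
    \int[leb]_y (rho (y - x) * phi x - rho (y - x) * phi y).
  by rewrite RintegralB// RintegralZr// /Rintegral kE.
have mdiff : measurable_fun setT (fun y : 'rV[R]_n => rho (y - x) * phi x - rho (y - x) * phi y).
  by apply: measurable_funB; apply: measurable_funM.
have idiff : leb.-integrable setT
    (EFin \o (fun y : 'rV[R]_n => rho (y - x) * phi x - rho (y - x) * phi y)).
  by have := integrableB measurableT ikc ikp.
rewrite EFin_normr_Rintegral//; apply: le_trans (le_abse_integral _ _ _) _ => //.
  exact/measurable_EFinP.
rewrite /deviation -(@ge0_integral_shift _ _
  (fun y => (`|rho (y - x) * phi x - rho (y - x) * phi y|)%:E) x)//.
  rewrite le_eqVlt; apply/orP; left; apply/eqP; apply: eq_integral => v _.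
  rewrite /= addrK -mulrBr normrM ger0_norm ?kernel_ge0// distrC.
  by rewrite [v + x]addrC.
exact: measurable_abs_EFin.
Qed.

Lemma measurable_mollify phi : measurable_fun setT phi -> measurable_fun setT (mollify phi).
Proof.
move=> mphi.
pose f (xy : 'rV[R]_n * 'rV[R]_n) : \bar R := (rho (xy.2 - xy.1) * phi xy.2)%:E.
have mf : measurable_fun setT f.
  apply/measurable_EFinP; apply: measurable_funM.
    exact: (measurableT_comp (@kernel_measurable R n h) measurable_rV_sub).
  exact: measurableT_comp measurable_snd.
rewrite (_ : mollify phi = fine \o (fun x => fubini_F leb f^\+ x - fubini_F leb f^\- x)%E).
  apply: measurableT_comp => //; apply: emeasurable_funB.
    by apply: measurable_fun_fubini_tonelli_F => //; exact: measurable_funepos.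
  by apply: measurable_fun_fubini_tonelli_F => //; exact: measurable_funeneg.
apply/funext => x; rewrite /mollify /Rintegral /fubini_F /=; congr fine.
rewrite [LHS]integralE; congr (_ - _)%E; apply: eq_integral => y _.
  by rewrite !funeposE.
by rewrite !funenegE.
Qed.

End kernel_estimate.

(** * Completeness of L^1 *)

Section L1_complete.
Context d (T : measurableType d) (R : realType) (mu : {measure set T -> \bar R}).
Variables (D : set T) (mD : measurable D) (f : nat -> T -> R).
Hypothesis intf : forall k, mu.-integrable D (EFin \o f k).
Hypothesis cauchyf : forall e, 0 < e -> exists K, forall k l, (K <= k)%N -> (K <= l)%N ->
  \int[mu]_(x in D) `|f k x - f l x| <= e.

Let mf k : measurable_fun D (f k).
Proof. by apply/measurable_EFinP; exact: measurable_int (intf k). Qed.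

Let intB k l : mu.-integrable D (EFin \o (fun x => f k x - f l x)).
Proof. by have := integrableB mD (intf k) (intf l). Qed.

Let intBE k l : (\int[mu]_(x in D) `|f k x - f l x|%:E =
  (\int[mu]_(x in D) `|f k x - f l x|)%:E)%E.
Proof.
by rewrite /Rintegral fineK//; apply: integrable_fin_num => //; exact: integrable_norm (intB k l).
Qed.

(** Riesz-Fischer: a subsequence with summable increments converges almost
   everywhere, and its limit is the limit in L^1 by Fatou's lemma. *)
Lemma L1_complete : exists u : T -> R, mu.-integrable D (EFin \o u) /\
  \int[mu]_(x in D) `|f k x - u x| @[k --> \oo] --> (0 : R).
Proof.
pose e (j : nat) : R := 1 / (2 ^ (j + 1))%:R.
have e0 j : 0 < e j by rewrite divr_gt0// ltr0n expn_gt0.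
have /choice[N NP] j := cauchyf (e0 j).
pose s j := (\max_(i < j.+1) N i + j)%N.
have sN j : (N j <= s j)%N.
  by apply: leq_trans (leq_addr _ _); exact: (leq_bigmax (ord_max : 'I_j.+1)).
have sS j : (N j <= s j.+1)%N.
  apply: leq_trans (leq_addr _ _).
  exact: (leq_bigmax (widen_ord (leqnSn j.+1) ord_max : 'I_j.+2)).
have sj j : (j <= s j)%N by exact: leq_addl.
pose dd j x : \bar R := `|f (s j.+1) x - f (s j) x|%:E.
have mdd j : measurable_fun D (dd j).
  by apply/measurable_EFinP; apply: measurableT_comp => //; exact: measurable_funB.
pose S x : \bar R := (\sum_(0 <= j <oo) dd j x)%E.
have mS : measurable_fun D S.
  by apply: ge0_emeasurable_sum => // j x _ _; rewrite lee_fin.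
have S0 x : (0 <= S x)%E by apply: nneseries_ge0 => j _ _; rewrite lee_fin.
have intgS : mu.-integrable D S.
  apply/integrableP; split => //.
  under eq_integral do rewrite gee0_abs//.
  rewrite integral_nneseries//; last by move=> j x _; rewrite lee_fin.
  apply: (@le_lt_trans _ _ (\sum_(0 <= j <oo) (e j)%:E)%E).
    apply: lee_nneseries => [j _ _|j _].
      by apply: integral_ge0 => x _; rewrite lee_fin.
    by rewrite /dd intBE lee_fin NP.
  rewrite (cvg_lim _ (@cvg_geometric_eseries_half R 1 0))//.
  by rewrite ltry.
pose A := D `&` [set x | (S x < +oo)%E].
have mA : measurable A by exact: emeasurable_fun_infty_o.
pose h l x : R := if x \in A then f (s l) x else 0.
have cvh x : D x -> cvg (h l x @[l --> \oo]).
  move=> Dx; rewrite /h; case: (boolP (x \in A)) => [/set_mem[_ /= Sx]|_]; last first.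
    exact: is_cvg_cst.
  pose v l := f (s l) x.
  have nv : cvgn [normed series (telescope v)].
    apply: nondecreasing_is_cvgn; first by apply: nondecreasing_series => j _ _; exact: normr_ge0.
    exists (fine (S x)) => _ [l _ <-].
    rewrite -lee_fin fineK ?ge0_fin_numE//.
    apply: le_trans (nneseries_lim_ge l _); last by move=> j _ _; rewrite lee_fin.
    by rewrite /series/= -sumEFin.
  have := normed_cvg nv; rewrite telescopeK => /cvg_ex[a va].
  apply/cvg_ex; exists (a + v 0%N).
  rewrite (_ : (fun l => _) = (fun l => (v l - v 0%N) + v 0%N)); last first.
    by apply/funext => l; rewrite subrK.
  by apply: cvgD va _; exact: cvg_cst.
pose u x := lim (h l x @[l --> \oo]).
have hu x : D x -> h l x @[l --> \oo] --> u x by exact: cvh.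
have mh l : measurable_fun D (h l).
  have -> : h l = f (s l) \_ A by apply/funext => x; rewrite /h /patch.
  apply/(measurable_restrict _ mA mD); exact: (measurable_funS mD (@subIsetl _ D A) (mf (s l))).
have mu_ : measurable_fun D u by exact: measurable_fun_cvg hu.
have hE k l : (\int[mu]_(x in D) `|f k x - h l x|%:E =
    \int[mu]_(x in D) `|f k x - f (s l) x|%:E)%E.
  apply: ae_eq_integral => //.
  - by apply/measurable_EFinP; apply: measurableT_comp => //; exact: measurable_funB.
  - by apply/measurable_EFinP; apply: measurableT_comp => //; exact: measurable_funB.
  - have := integrable_ae mD intgS; apply: filterS => x /[swap] Dx /(_ Dx) Sx.
    rewrite /h mem_set//; split => //=.
    by move: Sx; rewrite fin_numE ltey => /andP[].
have fuE e' : 0 < e' -> exists K, forall k, (K <= k)%N ->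
    (\int[mu]_(x in D) `|f k x - u x|%:E <= e'%:E)%E.
  move=> e'0; have [K KP] := cauchyf e'0; exists K => k Kk.
  have -> : (\int[mu]_(x in D) `|f k x - u x|%:E =
     \int[mu]_(x in D) limn_einf (fun l => `|f k x - h l x|%:E))%E.
    apply: eq_integral => x /set_mem Dx; apply/esym.
    have : `|f k x - h l x|%:E @[l --> \oo] --> (`|f k x - u x|%:E : \bar R).
      apply: cvg_EFin; first exact: nearW.
      by apply: cvg_norm; apply: cvgB; [exact: cvg_cst|exact: hu].
    by move=> /cvg_limn_einf_sup[->].
  apply: le_trans (fatou _ mD _ _) _ => //.
    by move=> l; apply/measurable_EFinP; apply: measurableT_comp => //; exact: measurable_funB.
  rewrite limn_einf_lim; apply: lime_le; first exact: is_cvg_einfs.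
  near=> l; apply: (@le_trans _ _ (\int[mu]_(x in D) `|f k x - h l x|%:E)%E).
    by apply: ereal_inf_lbound; exists l => //=.
  rewrite hE intBE lee_fin KP//.
  by apply: leq_trans (sj l); near: l; exact: nbhs_infty_ge.
have mfu k : measurable_fun D (fun x => f k x - u x) by exact: measurable_funB.
have [K KP] := fuE 1 ltr01.
have intfu : mu.-integrable D (EFin \o (fun x => f K x - u x)).
  apply/integrableP; split; first exact/measurable_EFinP.
  by apply: le_lt_trans (KP K _) _; rewrite ?ltry.
have intu : mu.-integrable D (EFin \o u).
  have := integrableB mD (intf K) intfu; congr (mu.-integrable D _).
  by apply/funext => x /=; rewrite -EFinB; congr EFin; ring.
have intfku k : mu.-integrable D (EFin \o (fun x => f k x - u x)).
  by have := integrableB mD (intf k) intu.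
exists u; split => //; apply/cvgr0Pnorm_le => e' e'0; have [K' K'P] := fuE e' e'0.
near=> k; rewrite ger0_norm; last by apply: Rintegral_ge0.
rewrite -lee_fin /Rintegral fineK; last first.
  by apply: integrable_fin_num => //; exact: integrable_norm (intfku k).
by apply: K'P; near: k; exact: nbhs_infty_ge.
Unshelve. all: by end_near. Qed.

End L1_complete.

(** * The inequality of Poincaré and the theorem of Rellich *)

Section rellich.
Variables (R : realType) (n : nat) (Omega : set 'rV[R]_n).
Hypotheses (oOmega : open Omega) (bOmega : bounded_set Omega).
Local Notation leb := (lebesgue_rV R n).
Implicit Types phi : 'rV[R]_n -> R.

Let mOmega : measurable Omega. Proof. exact: open_mx_measurable. Qed.

Lemma Omega_fin : (leb Omega < +oo)%E. Proof. exact: leb_bounded. Qed.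

Lemma test_function_C1 phi : test_function Omega phi -> C1 phi.
Proof.
move=> tphi; split; first exact: test_function_continuous tphi.
move=> j; split; first exact: test_function_continuous (test_function_pderiv j tphi).
by move=> y; exact: test_function_derivable tphi.
Qed.

Lemma bounded_Omega_integrable (f : 'rV[R]_n -> R) M : measurable_fun Omega f ->
  (forall x, Omega x -> `|f x| <= M) -> leb.-integrable Omega (EFin \o f).
Proof.
by move=> mf fM; apply: (@bounded_integrable _ _ _ _ _ mOmega _ M) => //; exact: Omega_fin.
Qed.

Lemma test_function_restrict phi : test_function Omega phi -> phi \_ Omega = phi.
Proof.
move=> tphi; apply/funext => x; rewrite /patch; case: ifPn => // xO.
by rewrite (test_function0 tphi)// => Ox; move: xO; rewrite mem_set.
Qed.

Lemma test_function_integrable phi : test_function Omega phi ->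
  leb.-integrable setT (EFin \o phi).
Proof.
move=> tphi; have [M phiM] := test_function_bounded tphi.
rewrite -(test_function_restrict tphi) -restrict_EFin.
apply/(integrable_mkcond _ mOmega); apply: (bounded_Omega_integrable (M := M)) => //.
by apply: measurable_funTS; exact: test_function_measurable tphi.
Qed.

(** A translation by more than the diameter moves Omega off itself, so that on
    Omega the function is its own increment. *)
Lemma poincare (j : 'I_n) : exists h : R, forall phi, test_function Omega phi ->
  (L1norm phi <= h%:E * L1norm (pderiv j phi))%E.
Proof.
have [M [_ HM]] := bOmega; pose r := `|M| + 1.
have OM x : Omega x -> `|x 0 j| <= r.
  move=> Ox; apply: le_trans (normr_coord x j) _.
  by apply: HM => //; rewrite ltr_pwDr// ler_norm.
have r0 : 0 < r by rewrite ltr_wpDl.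
exists (r *+ 3) => phi tphi; have Cphi := test_function_C1 tphi.
have h0 : 0 <= r *+ 3 by rewrite mulrn_wge0// ltW.
have mphi := test_function_measurable tphi.
apply: le_trans (L1_translation_basis j Cphi h0); apply: ge0_le_integral => //.
- exact: measurable_abs_EFin.
- apply: measurable_abs_EFin; apply: measurable_funB => //.
  by apply: measurableT_comp => //; exact: measurable_rV_shift.
move=> x _; rewrite lee_fin.
have [Ox|Ox] := pselect (Omega x); last first.
  by rewrite (test_function0 tphi Ox) normr0.
rewrite (test_function0 tphi (x := _ + _)) ?sub0r ?normrN// => /OM.
have -> : (x + r *+ 3 *: basis_vec R j) 0 j = x 0 j + r *+ 3.
  by rewrite !mxE !eqxx [_ * _]mulr1.
move=> xr; have := OM x Ox; move: xr.
by rewrite !ler_norml mulrS mulr2n; lra.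
Qed.

(** The mollification of the functions at scale h has an error of at most h B in
    L^1, uniformly in k. At a fixed scale the mollifications converge pointwise,
    being integrals against translates of the kernel; as they are bounded they
    converge in L^1(Omega). *)
Lemma rellich (phi : nat -> 'rV[R]_n -> R) (B C : R) :
  (forall k, test_function Omega (phi k)) ->
  (forall k, \sum_(j < n) L1norm (pderiv j (phi k)) <= B%:E)%E ->
  (forall k, L1norm (phi k) <= C%:E)%E ->
  (forall (psi : 'rV[R]_n -> R) M, continuous psi -> (forall x, `|psi x| <= M) ->
     cvg (\int[leb]_(x in Omega) (psi x * phi k x) @[k --> \oo])) ->
  forall e, 0 < e -> exists K, forall k l, (K <= k)%N -> (K <= l)%N ->
    \int[leb]_(x in Omega) `|phi k x - phi l x| <= e.
Proof.
move=> tphi phiB phiC cvphi e e0.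
have B0 : 0 <= B.
  by rewrite -lee_fin (le_trans _ (phiB 0%N))// sume_ge0// => j _; exact: L1norm_ge0.
have C0 : 0 <= C by rewrite -lee_fin (le_trans _ (phiC 0%N))// L1norm_ge0.
(* the errors of mollification of phi k and phi l take half of e together *)
pose h := e / (4 * (B + 1)).
have h0 : 0 < h by rewrite divr_gt0// mulr_gt0// ltr_wpDl.
have hB : h * B <= e / 4.
  by rewrite /h mulrAC ler_pdivrMr ?mulr_gt0 ?ltr_wpDl//; nra.
pose i0 := @kernel_mass R n h; have i00 : 0 < i0 by exact: kernel_mass_gt0.
pose K k := mollify h (phi k).
have mphi k : measurable_fun setT (phi k) := test_function_measurable (tphi k).
have mK k : measurable_fun setT (K k) by exact: measurable_mollify.
have KE k x : K k x = \int[leb]_(y in Omega) (kernel h (y - x) * phi k y).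
  rewrite Rintegral_mkcond; apply: eq_Rintegral => y _.
  rewrite /patch; case: ifPn => // yO; rewrite (test_function0 (tphi k)) ?mulr0// => Oy.
  by move: yO; rewrite mem_set.
pose L x := lim (K k x @[k --> \oo]).
have cvK x : K k x @[k --> \oo] --> L x.
  have : cvg (K k x @[k --> \oo]); last by [].
  rewrite (_ : (fun k => _) = (fun k => \int[leb]_(y in Omega) (kernel h (y - x) * phi k y))).
    apply: (cvphi (fun y => kernel h (y - x)) 1).
      move=> y; apply: (@continuous_comp _ _ _ (fun y : 'rV[R]_n => y - x) (kernel h)).
        apply: (@continuousB R _ _ (fun y : 'rV[R]_n => y) (cst x)); last exact: cst_continuous.
        by move=> ?.
      exact: kernel_continuous.
    by move=> y; rewrite ger0_norm ?kernel_ge0 ?kernel_le1.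
  by apply/funext => k; exact: KE.
have KC k x : `|K k x| <= C.
  rewrite -lee_fin (le_trans _ (phiC k))// /K /mollify.
  have mk : measurable_fun setT (fun y : 'rV[R]_n => kernel h (y - x)).
    by apply: (measurableT_comp (@kernel_measurable R n h)); exact: measurable_rV_shift.
  have ik : leb.-integrable setT (EFin \o (fun y : 'rV[R]_n => kernel h (y - x) * phi k y)).
    apply: (@bounded_mul_integrable _ _ _ _ _ measurableT (phi k) _ 1) => //.
      exact: test_function_integrable.
    by move=> y _; rewrite ger0_norm ?kernel_ge0 ?kernel_le1.
  rewrite EFin_normr_Rintegral//; apply: le_trans (le_abse_integral _ _ _) _ => //.
    exact: measurable_int ik.
  apply: ge0_le_integral => //.
  - by apply: measurableT_comp => //; exact: measurable_int ik.
  - exact: measurable_abs_EFin.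
  - move=> y _; rewrite lee_fin normrM ger0_norm ?kernel_ge0//.
    by rewrite ler_piMl ?kernel_le1.
have mL : measurable_fun setT L by apply: (measurable_fun_cvg (h := K)) => // x _.
have LC x : `|L x| <= C.
  by apply: (cvgr_to_le (cvg_norm (cvK x))); apply: nearW => k; exact: KC.
have cvKL : \int[leb]_(x in Omega) `|K k x - L x| @[k --> \oo] --> (0 : R).
  have -> : (0 : R) = \int[leb]_(x in Omega) 0 by rewrite Rintegral_cst// mul0r.
  apply: (@Rintegral_dominated _ _ _ _ _ mOmega (fun k x => `|K k x - L x|) (cst 0) (cst (C + C))).
  - move=> k; apply: measurableT_comp => //; apply: measurable_funTS.
    exact: measurable_funB.
  - exact: measurable_cst.
  - move=> x _; rewrite -[X in _ --> X](normr0 R); apply: cvg_norm.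
    by rewrite -(subrr (L x)); apply: cvgB => //; exact: cvg_cst.
  - by apply: (bounded_Omega_integrable (M := `|C + C|)).
  - move=> k x _; rewrite normr_id (le_trans (ler_normB _ _))// lerD//; exact: KC.
have d0 : 0 < i0 * (e / 4) by rewrite mulr_gt0// divr_gt0.
have /cvgr0Pnorm_le/(_ _ d0)[N _ NP] := cvKL.
exists N => k l Nk Nl.
have intKL k' : leb.-integrable Omega (EFin \o (fun x => `|K k' x - L x|)).
  apply: (bounded_Omega_integrable (M := C + C)).
    by apply: measurableT_comp => //; apply: measurable_funTS; exact: measurable_funB.
  by move=> x _; rewrite normr_id (le_trans (ler_normB _ _))// lerD.
have KLE k' : (N <= k')%N ->
    (\int[leb]_(x in Omega) `|K k' x - L x|%:E <= (i0 * (e / 4))%:E)%E.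
  move=> Nk'; have := NP k' Nk'; rewrite -lee_fin /= => /(le_trans _); apply.
  rewrite ger0_norm; last by apply: Rintegral_ge0.
  rewrite /Rintegral fineK//; apply: integrable_fin_num => //; exact: intKL.
have devE k' : (\int[leb]_(x in Omega) deviation h (phi k') x <= (i0 * (h * B))%:E)%E.
  apply: le_trans (integral_deviation h0 (test_function_C1 (tphi k')) (phiB k')).
  apply: ge0_subset_integral => //; first exact: measurable_deviation.
  move=> x _; apply: integral_ge0 => v _; by rewrite lee_fin mulr_ge0// kernel_ge0.
have dev0 k' x : (0 <= deviation h (phi k') x)%E.
  by apply: integral_ge0 => v _; rewrite lee_fin mulr_ge0// kernel_ge0.
have mdev k' : measurable_fun Omega (deviation h (phi k')).
  by apply: measurable_funTS; exact: measurable_deviation.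
have mKL k' : measurable_fun Omega (fun x => `|K k' x - L x|%:E).
  by have := measurable_int _ (intKL k').
have intkl : leb.-integrable Omega (EFin \o (fun x => `|phi k x - phi l x|)).
  have iO k' : leb.-integrable Omega (EFin \o phi k').
    exact: (integrableS measurableT mOmega (@subsetT _ _) (test_function_integrable (tphi k'))).
  have iB : leb.-integrable Omega (EFin \o (fun x => phi k x - phi l x)).
    by have := integrableB mOmega (iO k) (iO l).
  exact: integrable_norm iB.
have mkl : measurable_fun Omega (fun x => `|phi k x - phi l x|%:E).
  by have := measurable_int _ intkl.
have klE : ((\int[leb]_(x in Omega) `|phi k x - phi l x|)%:E =
    \int[leb]_(x in Omega) `|phi k x - phi l x|%:E)%E.
  by rewrite /Rintegral fineK//; apply: integrable_fin_num => //; exact: intkl.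
rewrite -(ler_pM2l i00) -lee_fin EFinM klE.
rewrite -ge0_integralZl//; last by rewrite lee_fin ltW.
apply: (@le_trans _ _ (\int[leb]_(x in Omega)
   ((deviation h (phi k) x + deviation h (phi l) x) +
    (`|K k x - L x|%:E + `|K l x - L x|%:E)))%E).
  apply: ge0_le_integral => //.
  - by move=> x _; rewrite -EFinM lee_fin mulr_ge0// ltW.
  - exact: emeasurable_funM.
  - by apply: emeasurable_funD; apply: emeasurable_funD.
  move=> x _; have iphi k' := test_function_integrable (tphi k').
  have dk : (`|i0 * phi k x - K k x|%:E <= deviation h (phi k) x)%E.
    exact: mollify_deviation (mphi k) (iphi k).
  have dl : (`|i0 * phi l x - K l x|%:E <= deviation h (phi l) x)%E.
    exact: mollify_deviation (mphi l) (iphi l).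
  apply: le_trans (leeD (leeD dk dl) (lexx _)); rewrite -/i0 -/(K k x) -/(K l x).
  rewrite -EFinM -!EFinD lee_fin -[X in X * _](ger0_norm (ltW i00)) -normrM.
  have -> : i0 * (phi k x - phi l x) = (i0 * phi k x - K k x) - (i0 * phi l x - K l x) +
    ((K k x - L x) - (K l x - L x)) by ring.
  by apply: le_trans (ler_normD _ _) _; apply: lerD; exact: ler_normB.
rewrite ge0_integralD//; last 4 first.
- by move=> x _; exact: adde_ge0.
- exact: emeasurable_funD.
- by move=> x _; rewrite -EFinD lee_fin addr_ge0.
- exact: emeasurable_funD.
rewrite [X in (X + _ <= _)%E](@ge0_integralD _ _ _ leb _ mOmega _ _ (fun x _ => dev0 k x)
  (mdev k) (fun x _ => dev0 l x) (mdev l)).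
rewrite [X in (_ + X <= _)%E](@ge0_integralD _ _ _ leb _ mOmega
  (fun x => `|K k x - L x|%:E) (fun x => `|K l x - L x|%:E))//.
apply: le_trans (leeD (leeD (devE k) (devE l)) (leeD (KLE k Nk) (KLE l Nl))) _.
rewrite -!EFinD lee_fin.
have hB' : i0 * (h * B) <= i0 * (e / 4) by rewrite ler_pM2l.
have -> : i0 * e = i0 * (e / 4) * 4 by field.
by lra.
Qed.

End rellich.

(** * From L^q to L^1 on bounded sets *)

Section Lp_L1.
Variables (R : realType) (n : nat) (Omega : set 'rV[R]_n).
Hypotheses (oOmega : open Omega) (bOmega : bounded_set Omega).
Local Notation leb := (lebesgue_rV R n).
Implicit Types f g : 'rV[R]_n -> R.

Let mOmega : measurable Omega. Proof. exact: open_mx_measurable. Qed.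

Lemma Lnorm1_restrict f :
  Lnorm leb 1%:E (EFin \o (f \_ Omega)) = (\int[leb]_(x in Omega) `|f x|%:E)%E.
Proof.
rewrite Lnorm1 [RHS]integral_mkcond; apply: eq_integral => x _.
by rewrite /= /patch; case: ifPn => //; rewrite normr0.
Qed.

Lemma Lnorm_indic p : 0 < p -> (Lnorm leb p%:E (EFin \o \1_Omega) < +oo)%E.
Proof.
move=> p0; rewrite unlock; apply: poweR_lty.
rewrite (_ : (fun x => _) = EFin \o \1_Omega); last first.
  apply/funext => x; rewrite /= indicE; case: (x \in Omega) => /=.
    by rewrite normr1 powR1.
  by rewrite normr0 powR0// gt_eqF.
by rewrite integral_indic// setIT; exact: Omega_fin.
Qed.

(** On a bounded set the L^q norm controls the L^1 norm, by the Hölder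
    inequality against the indicator function. *)
Lemma L1_le_Lnorm q : 1 <= q -> exists2 C : R, 0 <= C &
  forall f, measurable_fun Omega f ->
    (\int[leb]_(x in Omega) `|f x|%:E <=
     C%:E * Lnorm leb q%:E (EFin \o (f \_ Omega)))%E.
Proof.
rewrite le_eqVlt => /predU1P[<-|q1].
  by exists 1 => // f mf; rewrite mul1e Lnorm1_restrict.
have q0 : 0 < q by rewrite (lt_trans _ q1).
pose p := (1 - q^-1)^-1.
have p0 : 0 < p by rewrite invr_gt0 subr_gt0 invf_lt1.
have pq : q^-1 + p^-1 = 1 by rewrite invrK addrC subrK.
exists (fine (Lnorm leb p%:E (EFin \o \1_Omega))).
  by rewrite fine_ge0// Lnorm_ge0.
move=> f mf; rewrite fineK; last first.
  by rewrite ge0_fin_numE ?Lnorm_ge0//; exact: Lnorm_indic.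
have mfO : measurable_fun setT (f \_ Omega) by apply/(measurable_restrictT f mOmega).
have mI : measurable_fun setT (\1_Omega : 'rV[R]_n -> R) by exact: measurable_indic.
have := hoelder leb mfO mI q0 p0 pq; rewrite muleC; apply: le_trans.
rewrite -Lnorm1_restrict.
rewrite (_ : (f \_ Omega \* \1_Omega)%R = f \_ Omega)//.
apply/funext => x; rewrite /= indicE /patch.
by case: (x \in Omega); rewrite /= ?mulr1// mul0r.
Qed.

Lemma Lp_on_measurable q f : Lp_on Omega q f -> measurable_fun Omega f.
Proof.
by rewrite /Lp_on inE => /andP[/[!inE] mf _]; apply/(measurable_restrictT f mOmega).
Qed.

Lemma Lp_on_integrable q f : 1 <= q -> Lp_on Omega q f ->
  leb.-integrable Omega (EFin \o f).
Proof.
move=> q1 qf; have mf := Lp_on_measurable qf; have [C C0 CP] := L1_le_Lnorm q1.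
apply/integrableP; split; first by apply/measurable_EFinP.
apply: le_lt_trans (CP _ mf) _; apply: lte_mul_pinfty => //.
by move: qf; rewrite /Lp_on inE => /andP[_ /[!inE]].
Qed.

Lemma Lp_on1 f : leb.-integrable Omega (EFin \o f) -> Lp_on Omega 1 f.
Proof.
move=> intf; apply/Lfun1_integrable.
by rewrite -restrict_EFin; apply/(integrable_mkcond _ mOmega).
Qed.

Lemma Rintegral_abs_EFin f : leb.-integrable Omega (EFin \o f) ->
  (\int[leb]_(x in Omega) `|f x|)%:E = (\int[leb]_(x in Omega) `|f x|%:E)%E.
Proof.
move=> intf; rewrite /Rintegral fineK//.
by apply: integrable_fin_num => //; exact: integrable_norm intf.
Qed.

Lemma integrable_sub f g : leb.-integrable Omega (EFin \o f) ->
  leb.-integrable Omega (EFin \o g) ->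
  leb.-integrable Omega (EFin \o (fun x => f x - g x)).
Proof. by move=> intf intg; have := integrableB mOmega intf intg. Qed.

Lemma integrable_add f g : leb.-integrable Omega (EFin \o f) ->
  leb.-integrable Omega (EFin \o g) ->
  leb.-integrable Omega (EFin \o (fun x => f x + g x)).
Proof. by move=> intf intg; have := integrableD mOmega intf intg. Qed.

Lemma Lp_cvg_L1 q (f_ : nat -> 'rV[R]_n -> R) f : 1 <= q ->
  (forall k, leb.-integrable Omega (EFin \o f_ k)) ->
  leb.-integrable Omega (EFin \o f) -> Lp_cvg Omega q f_ f ->
  \int[leb]_(x in Omega) `|f_ k x - f x| @[k --> \oo] --> (0 : R).
Proof.
move=> q1 if_ intf cvf; have [C C0 CP] := L1_le_Lnorm q1.
pose g k := (C%:E * Lnorm leb q%:E (EFin \o ((f_ k \- f)%R \_ Omega)))%E.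
suff H : (fun k => (\int[leb]_(x in Omega) `|f_ k x - f x|)%:E) @ \oo --> 0%E.
  exact: fine_cvg H.
have cvg_g : g @ \oo --> 0%E.
  rewrite -[X in _ --> X](mule0 C%:E); exact: cvgeZl.
apply: squeeze_cvge (cvg_cst 0%E) cvg_g; apply: nearW => k; apply/andP; split.
  by rewrite lee_fin; apply: Rintegral_ge0.
rewrite Rintegral_abs_EFin; last exact: integrable_sub.
by apply: CP; apply/measurable_EFinP; exact: measurable_int (integrable_sub (if_ k) intf).
Qed.

Lemma Lp_cvg1 (f_ : nat -> 'rV[R]_n -> R) f :
  (forall k, leb.-integrable Omega (EFin \o f_ k)) ->
  leb.-integrable Omega (EFin \o f) ->
  \int[leb]_(x in Omega) `|f_ k x - f x| @[k --> \oo] --> (0 : R) ->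
  Lp_cvg Omega 1 f_ f.
Proof.
move=> if_ intf cvf; rewrite /Lp_cvg.
rewrite (_ : (fun k => _) = (fun k => (\int[leb]_(x in Omega) `|f_ k x - f x|)%:E)).
  by apply: cvg_EFin => //; apply: nearW.
apply/funext => k; rewrite Lnorm1_restrict Rintegral_abs_EFin//.
exact: integrable_sub.
Qed.

End Lp_L1.

(** * Weak gradients and energies *)

Section weak_gradients.
Variables (R : realType) (n N : nat) (Omega : set 'rV[R]_n).
Hypotheses (oOmega : open Omega) (bOmega : bounded_set Omega).
Local Notation leb := (lebesgue_rV R n).
Implicit Types (f g : 'rV[R]_n -> R) (u w : 'rV[R]_n -> 'cV[R]_N).

Let mOmega : measurable Omega. Proof. exact: open_mx_measurable. Qed.

Lemma compact_mx_measurable (K : set 'rV[R]_n) : compact K -> measurable K.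
Proof.
move=> cK; rewrite -[K]setCK; apply: measurableC; apply: open_mx_measurable.
by apply: closed_openC; apply: compact_closed => //; exact: norm_hausdorff.
Qed.

(** Omega is a countable union of balls that are contained in compact subsets
    of Omega. *)
Lemma L1loc_measurable f : L1loc Omega f -> measurable_fun Omega f.
Proof.
move=> lf; have [c [r [r0 cover]]] := mx_ball_cover R 1 n.
pose E k := if `[< ball (c k) (r k *+ 2) `<=` Omega >] then ball (c k) (r k) else set0.
have mE k : measurable (E k).
  rewrite /E; case: ifP => // _; apply: open_mx_measurable; exact: ball_open.
have OE : Omega = \bigcup_k E k.
  apply/seteqP; split => [x Ox|x [k _]].
    have [k xk kO] := cover _ oOmega x Ox; exists k => //.
    by rewrite /E asboolT.
  rewrite /E; case: ifP => // /asboolP kO xk; apply: kO.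
  by apply: le_ball xk; rewrite mulr2n lerDl ltW.
rewrite OE; apply/measurable_fun_bigcup => // k; rewrite /E.
case: ifP => [/asboolP kO|_]; last exact: measurable_fun_set0.
pose K := [set x : 'rV[R]_n | forall i, `|c k 0 i - x 0 i| <= r k].
have cK : compact K by exact: closed_box_compact.
have KO : K `<=` Omega.
  move=> x xK; apply: kO; split; first by rewrite mulrn_wgt0.
  move=> i j; rewrite ord1; apply: le_lt_trans (xK j) _.
  by rewrite mulr2n ltrDl.
have mK : measurable K by exact: compact_mx_measurable.
apply: (measurable_funS mK); last first.
  by apply/measurable_EFinP; exact: measurable_int (lf K cK KO).
by move=> x [_ xk] i; exact: ltW (xk 0 i).
Qed.

Lemma integrable_L1loc f : leb.-integrable Omega (EFin \o f) -> L1loc Omega f.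
Proof.
by move=> intf K cK KO; apply: (integrableS mOmega _ KO) intf; exact: compact_mx_measurable.
Qed.

Lemma integrable_mul_test f phi : leb.-integrable Omega (EFin \o f) ->
  test_function Omega phi -> leb.-integrable Omega (EFin \o (fun x => f x * phi x)).
Proof.
move=> intf tphi; have [M phiM] := test_function_bounded tphi.
rewrite (_ : (fun x => _) = (fun x => phi x * f x)); last first.
  by apply/funext => x; rewrite mulrC.
apply: (@bounded_mul_integrable _ _ _ _ _ mOmega f phi M) => //.
by apply: measurable_funTS; exact: test_function_measurable tphi.
Qed.

Lemma weak_pderiv_add j f1 g1 f2 g2 :
  leb.-integrable Omega (EFin \o f1) -> leb.-integrable Omega (EFin \o g1) ->
  leb.-integrable Omega (EFin \o f2) -> leb.-integrable Omega (EFin \o g2) ->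
  weak_pderiv Omega j f1 g1 -> weak_pderiv Omega j f2 g2 ->
  weak_pderiv Omega j (fun x => f1 x + f2 x) (fun x => g1 x + g2 x).
Proof.
move=> if1 ig1 if2 ig2 w1 w2 phi tphi; have tdphi := test_function_pderiv j tphi.
under eq_Rintegral do rewrite mulrDl.
under [in RHS]eq_Rintegral do rewrite mulrDl.
rewrite RintegralD ?RintegralD//; try exact: integrable_mul_test.
by rewrite w1// w2// opprD.
Qed.

Lemma weak_pderiv_unique j f g1 g2 :
  leb.-integrable Omega (EFin \o g1) -> leb.-integrable Omega (EFin \o g2) ->
  weak_pderiv Omega j f g1 -> weak_pderiv Omega j f g2 ->
  \int[leb]_(x in Omega) `|g1 x - g2 x| = 0.
Proof.
move=> ig1 ig2 w1 w2; apply: test_function_L1_unique => // phi tphi.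
by apply: oppr_inj; rewrite -w1// w2.
Qed.

Lemma wgradP u : (exists G, is_weak_grad Omega u G) ->
  is_weak_grad Omega u (wgrad Omega u).
Proof. by move=> /(xgetPex (cst 0)). Qed.

Section summable.
Variable q : R.
Hypothesis q1 : 1 <= q.

Lemma W1_integrable u : W1 Omega q u -> forall i,
  leb.-integrable Omega (EFin \o (fun x => u x i 0)).
Proof. by move=> [uq _ _] i; exact: Lp_on_integrable (uq i). Qed.

Lemma W1_wgrad_integrable u : W1 Omega q u -> forall i j,
  leb.-integrable Omega (EFin \o (fun x => wgrad Omega u x i j)).
Proof. by move=> [_ _ uq] i j; exact: Lp_on_integrable (uq i j). Qed.

Variables u0 u : 'rV[R]_n -> 'cV[R]_N.
Hypotheses (u0_W1 : W1 Omega q u0) (u_W1 : W1_0 Omega q (u \- u0)).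

Let w := u \- u0.
Let w_W1 : W1 Omega q w. Proof. by case: u_W1. Qed.

Let wE x i : w x i 0 = u x i 0 - u0 x i 0.
Proof. by rewrite /w /= !mxE. Qed.

Let uE i : (fun x => u x i 0) = (fun x => w x i 0 + u0 x i 0).
Proof. by apply/funext => x; rewrite wE subrK. Qed.

Lemma translate_integrable i : leb.-integrable Omega (EFin \o (fun x => u x i 0)).
Proof. by rewrite uE; apply: integrable_add => //; exact: W1_integrable. Qed.

Let sum_grad i j : weak_pderiv Omega j (fun x => u x i 0)
  (fun x => wgrad Omega w x i j + wgrad Omega u0 x i j).
Proof.
have [_ exw _] := w_W1; have [_ exu _] := u0_W1.
rewrite uE; apply: weak_pderiv_add; try exact: W1_integrable; try exact: W1_wgrad_integrable.
  exact: (wgradP exw i j).2.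
exact: (wgradP exu i j).2.
Qed.

(** [wgrad] is an arbitrary weak gradient as soon as there is one, such as the
    sum of those of u - u0 and u0. *)
Lemma translate_wgrad : is_weak_grad Omega u (wgrad Omega u).
Proof.
apply: wgradP; exists (fun x => wgrad Omega w x + wgrad Omega u0 x) => i j.
rewrite (_ : (fun x => (wgrad Omega w x + wgrad Omega u0 x) i j) =
    (fun x => wgrad Omega w x i j + wgrad Omega u0 x i j)); last first.
  by apply/funext => x; rewrite mxE.
split; last exact: sum_grad.
by apply: integrable_L1loc; apply: integrable_add => //; exact: W1_wgrad_integrable.
Qed.

(** The test functions approximate u - u0, whose weak gradient agrees almost
    everywhere with the difference of the two weak gradients; hence the bound
    on the derivatives. *)
Lemma W1_0_test_approx e :
  (forall i j, leb.-integrable Omega (EFin \o (fun x => wgrad Omega u x i j))) ->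
  0 < e -> exists phi : 'I_N -> 'rV[R]_n -> R,
  [/\ forall i, test_function Omega (phi i),
      forall i, \int[leb]_(x in Omega) `|phi i x - (u x i 0 - u0 x i 0)| <= e &
      forall i j, \int[leb]_(x in Omega) `|pderiv j (phi i) x| <=
        \int[leb]_(x in Omega) `|wgrad Omega u x i j| +
        \int[leb]_(x in Omega) `|wgrad Omega u0 x i j| + e].
Proof.
move=> iu e0; have [_ [phi_ [tphi cphi cdphi]]] := u_W1.
have itest f : test_function Omega f -> leb.-integrable Omega (EFin \o f).
  by move=> tf; exact: (integrableS measurableT mOmega (@subsetT _ _)
    (test_function_integrable oOmega bOmega tf)).
have near1 : \forall k \near \oo, forall i,
    \int[leb]_(x in Omega) `|phi_ k x i 0 - w x i 0| <= e.
  apply: filter_forall => i.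
  have : \int[leb]_(x in Omega) `|phi_ k x i 0 - w x i 0| @[k --> \oo] --> (0 : R).
    apply: (Lp_cvg_L1 oOmega bOmega q1) (cphi i); first by move=> k; exact: itest.
    exact: W1_integrable.
  move=> /cvgr0Pnorm_le/(_ _ e0); apply: filterS => k.
  by rewrite ger0_norm//; exact: Rintegral_ge0.
have near2 : \forall k \near \oo, forall i, forall j,
    \int[leb]_(x in Omega) `|pderiv j (fun y => phi_ k y i 0) x - wgrad Omega w x i j| <= e.
  apply: filter_forall => i; apply: filter_forall => j.
  have : \int[leb]_(x in Omega)
      `|pderiv j (fun y => phi_ k y i 0) x - wgrad Omega w x i j| @[k --> \oo] --> (0 : R).
    apply: (Lp_cvg_L1 oOmega bOmega q1) (cdphi i j).
      by move=> k; apply: itest; exact: test_function_pderiv.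
    exact: W1_wgrad_integrable.
  move=> /cvgr0Pnorm_le/(_ _ e0); apply: filterS => k.
  by rewrite ger0_norm//; exact: Rintegral_ge0.
have [k [k1 k2]] := filter_ex (filterI near1 near2).
exists (fun i x => phi_ k x i 0); split => // [i|i j].
  by move: (k1 i); under eq_Rintegral do rewrite wE.
set P := fun x => pderiv j (fun y => phi_ k y i 0) x.
have iP : leb.-integrable Omega (EFin \o P).
  by apply: itest; exact: test_function_pderiv.
have iw := W1_wgrad_integrable w_W1 i j.
have iu0 := W1_wgrad_integrable u0_W1 i j.
have iwu0 := integrable_add oOmega iw iu0.
have u0E := weak_pderiv_unique iwu0 (iu i j) (@sum_grad i j) (translate_wgrad i j).2.
have iN f : leb.-integrable Omega (EFin \o f) ->
    leb.-integrable Omega (EFin \o (fun x => `|f x|)).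
  by move=> intf; exact: integrable_norm intf.
have iD := iN _ (integrable_sub oOmega iP iw).
have iE := iN _ (integrable_sub oOmega iwu0 (iu i j)).
have tri (a b c d : R) : `|a| <= (`|a - b| + `|(b + c) - d|) + (`|d| + `|c|).
  rewrite [X in `|X| <= _](_ : _ = ((a - b) + ((b + c) - d)) + (d - c)); last by ring.
  by apply: le_trans (ler_normD _ _) _; apply: lerD; [exact: ler_normD|exact: ler_normB].
apply: (@le_trans _ _ (\int[leb]_(x in Omega)
   ((`|P x - wgrad Omega w x i j| +
     `|(wgrad Omega w x i j + wgrad Omega u0 x i j) - wgrad Omega u x i j|) +
    (`|wgrad Omega u x i j| + `|wgrad Omega u0 x i j|)))).
  apply: le_Rintegral => //; first exact: iN.
    apply: integrable_add => //; first exact: integrable_add.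
    by apply: integrable_add => //; exact: iN.
rewrite RintegralD//; last 2 first.
- exact: integrable_add.
- by apply: integrable_add => //; exact: iN.
rewrite RintegralD// u0E addr0 RintegralD//; try exact: iN.
by rewrite addrC lerD2l; exact: k2.
Qed.

End summable.

Lemma ler_entry_enorm (z : 'M[R]_(N, n)) i j : `|z i j| <= enorm z.
Proof.
rewrite /enorm -sqrtr_sqr ler_wsqrtr// (bigD1 i)//= (bigD1 j)//= -addrA lerDl.
rewrite addr_ge0// ?sumr_ge0// => k _; rewrite ?sumr_ge0// ?sqr_ge0// => l _.
by rewrite sqr_ge0.
Qed.

Section energy.
Variables (F : 'M[R]_(N, n) -> R) (gamma : R).
Hypotheses (F_continuous : continuous F) (gamma_gt0 : 0 < gamma).
Hypothesis F_coercive : forall z, gamma * enorm z <= F z.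

Lemma coercive_ge0 z : 0 <= F z.
Proof. by apply: le_trans (F_coercive z); apply: mulr_ge0; [exact: ltW|exact: sqrtr_ge0]. Qed.

Lemma measurable_energy (G : 'rV[R]_n -> 'M[R]_(N, n)) :
  (forall i j, measurable_fun Omega (fun x => G x i j)) ->
  measurable_fun Omega (F \o G).
Proof.
move=> mG; pose H x := if x \in Omega then G x else 0.
apply: (@eq_measurable_fun _ _ _ _ _ (F \o H)).
  by move=> x xO; rewrite /H /= xO.
apply: measurable_funTS; apply: measurableT_comp.
  exact: continuous_mx_measurable.
apply: measurable_fun_entryP => i j.
rewrite (_ : (fun x => _) = (fun x => G x i j) \_ Omega).
  by apply/(measurable_restrictT (fun x => G x i j) mOmega); exact: mG.
by apply/funext => x; rewrite /H /patch; case: ifP; rewrite ?mxE.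
Qed.

(** Coercivity, with |z i j| <= |z| for the Euclidean norm. *)
Lemma energy_controls_gradient (G : 'rV[R]_n -> 'M[R]_(N, n)) M i j :
  (forall i j, measurable_fun Omega (fun x => G x i j)) ->
  (\int[leb]_(x in Omega) (F (G x))%:E <= M%:E)%E ->
  leb.-integrable Omega (EFin \o (fun x => G x i j)) /\
  \int[leb]_(x in Omega) `|G x i j| <= M / gamma.
Proof.
move=> mG EM; have mFG := measurable_energy mG.
have le : (\int[leb]_(x in Omega) `|G x i j|%:E <= (M / gamma)%:E)%E.
  apply: (@le_trans _ _ (\int[leb]_(x in Omega) (gamma^-1%:E * (F (G x))%:E))%E).
    apply: ge0_le_integral => //.
    - by apply/measurable_EFinP; apply: measurableT_comp => //; exact: mG.
    - by apply: emeasurable_funM => //; apply/measurable_EFinP.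
    move=> x _; rewrite -EFinM lee_fin ler_pdivlMl//.
    apply: le_trans (F_coercive _); rewrite ler_pM2l//; exact: ler_entry_enorm.
  rewrite ge0_integralZl//.
  - by rewrite mulrC EFinM lee_wpmul2l// lee_fin invr_ge0 ltW.
  - by apply/measurable_EFinP.
  - by move=> x _; rewrite lee_fin coercive_ge0.
  - by rewrite lee_fin invr_ge0 ltW.
have intG : leb.-integrable Omega (EFin \o (fun x => G x i j)).
  apply/integrableP; split; first by apply/measurable_EFinP; exact: mG.
  by apply: le_lt_trans le _; rewrite ltry.
by split=> //; rewrite -lee_fin Rintegral_abs_EFin.
Qed.

End energy.
End weak_gradients.

(** * Derivative measures and weak-star convergence *)

Section BV_facts.
Variables (R : realType) (n N : nat) (Omega : set 'rV[R]_n).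
Hypotheses (oOmega : open Omega) (bOmega : bounded_set Omega).
Local Notation leb := (lebesgue_rV R n).
Local Notation finmeas := {finite_measure set 'rV[R]_n -> \bar R}.
Implicit Types (psi : 'rV[R]_n -> R) (u : 'rV[R]_n -> 'cV[R]_N).
Implicit Types (mu : matrix_charge R n N).

Let mOmega : measurable Omega. Proof. exact: open_mx_measurable. Qed.

(** At the points off Omega the extension by zero is continuous because psi is
    small off a compact subset of Omega. *)
Lemma C0_function_extension psi : C0_function Omega psi ->
  continuous (psi \_ Omega) /\ exists M, forall x, `|(psi \_ Omega) x| <= M.
Proof.
move=> [cpsi psi0].
have small (K : set 'rV[R]_n) e : 0 < e -> (forall x, Omega x -> ~ K x -> `|psi x| < e) ->
    forall x, ~ K x -> `|(psi \_ Omega) x| < e.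
  move=> e0 KP x Kx; rewrite /patch; case: ifPn => [/set_mem Ox|_]; first exact: KP.
  by rewrite normr0.
have cext : continuous (psi \_ Omega).
  move=> x; have FF : Filter (nbhs (x : 'rV[R]_n)) by exact: nbhs_filter.
  have [Ox|Ox] := pselect (Omega x).
    have cx : psi y @[y --> x] --> psi x.
      by move: cpsi; rewrite continuous_open_subspace// => cpsi; apply: (cpsi x); rewrite inE.
    have px : (psi \_ Omega) x = psi x by rewrite /patch mem_set.
    rewrite /continuous_at px; apply: cvg_trans cx; apply: (@near_eq_cvg _ _ (nbhs x)).
    have nO : \forall y \near x, Omega y by exact: open_nbhs_nbhs.
    by near do rewrite /patch mem_set//.
  have px : (psi \_ Omega) x = 0 by rewrite /patch memNset.
  rewrite /continuous_at px; apply/cvgr0Pnorm_lt => e e0.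
  have [K [cK KO KP]] := psi0 e e0.
  have oK : open (~` K) by apply: closed_openC; apply: compact_closed => //; exact: norm_hausdorff.
  have xK : (~` K) x by move=> /KO.
  have : \forall y \near x, (~` K) y by exact: open_nbhs_nbhs.
  by apply: filterS => y; exact: small.
split => //; have [K [cK KO KP]] := psi0 1 ltr01.
have [M [_ HM]] : bounded_set ((psi \_ Omega) @` K).
  by apply: compact_bounded; apply: continuous_compact => //; exact: continuous_subspaceT.
exists (`|M| + 1) => x; have [Kx|Kx] := pselect (K x); last first.
  by rewrite ltW// (lt_le_trans (small _ _ ltr01 KP x Kx))// lerDr.
by apply: HM; [rewrite ltr_pwDr// ler_norm|exists x].
Unshelve. all: by end_near. Qed.

Lemma L1_cvg_pairing (f_ : nat -> 'rV[R]_n -> R) (f h : 'rV[R]_n -> R) L :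
  (forall k, leb.-integrable Omega (EFin \o f_ k)) ->
  leb.-integrable Omega (EFin \o f) ->
  \int[leb]_(x in Omega) `|f_ k x - f x| @[k --> \oo] --> (0 : R) ->
  measurable_fun Omega h -> (forall x, Omega x -> `|h x| <= L) ->
  \int[leb]_(x in Omega) (f_ k x * h x) @[k --> \oo] --> \int[leb]_(x in Omega) (f x * h x).
Proof.
move=> if_ intf cvf mh hL.
have imul g : leb.-integrable Omega (EFin \o g) ->
    leb.-integrable Omega (EFin \o (fun x => g x * h x)).
  move=> ig; rewrite (_ : (fun x => _) = (fun x => h x * g x)).
    exact: (@bounded_mul_integrable _ _ _ _ _ mOmega g h L).
  by apply/funext => x; rewrite mulrC.
apply/cvgrPdist_le => e e0.
have L0 : 0 < `|L| + 1 by rewrite ltr_wpDl.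
have /cvgr0Pnorm_le/(_ _ (divr_gt0 e0 L0)) := cvf; apply: filterS => k.
rewrite ger0_norm; last exact: Rintegral_ge0.
rewrite ler_pdivlMr// mulrC => ke; apply: le_trans ke.
have id := integrable_sub oOmega (if_ k) intf.
have ind : leb.-integrable Omega (EFin \o (fun x => `|f_ k x - f x|)).
  exact: integrable_norm id.
rewrite -RintegralB//; try exact: imul.
apply: le_trans (le_normr_Rintegral _ _) _ => //.
  by apply: integrable_sub => //; exact: imul.
rewrite -RintegralZl//; apply: le_Rintegral => //.
- by apply: integrable_norm; apply: integrable_sub => //; exact: imul.
- by have := integrableZl mOmega (`|L| + 1) ind.
move=> x Ox; rewrite -mulrBl normrM mulrC distrC ler_wpM2r//.
by rewrite (le_trans (hL x Ox))// (le_trans (ler_norm _))// lerDl.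
Qed.

Lemma charge_of_difference (m1 m2 : finmeas) : exists nu : {charge set 'rV[R]_n -> \bar R},
  (forall A, measurable A -> nu A = nu (A `&` Omega)) /\
  (forall A, measurable A -> A `<=` Omega -> nu A = m1 A - m2 A)%E.
Proof.
pose c m : {charge set 'rV[R]_n -> \bar R} := crestr0 (charge_of_finite_measure m) mOmega.
pose nu : {charge set 'rV[R]_n -> \bar R} := cadd (c m1) (copp (c m2)).
have nuE A : measurable A -> nu A = (m1 (A `&` Omega) - m2 (A `&` Omega))%E.
  move=> mA; rewrite (_ : nu A = crestr0 m1 mOmega A - crestr0 m2 mOmega A)%E//.
  by rewrite /crestr0 mem_set.
exists nu; split=> A mA.
  by rewrite !nuE//; [rewrite -setIA setIid|exact: measurableI].
by move=> AO; rewrite nuE// setIidl.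
Qed.

Lemma deriv_measureP u : (exists mu, is_deriv_measure Omega u mu) ->
  is_deriv_measure Omega u (deriv_measure Omega u).
Proof. by rewrite /deriv_measure; case: pselect => // h _; case: cid. Qed.

(** [deriv_measure] is a choice among the derivative measures of u, which all
    agree on test functions. *)
Lemma deriv_measure_unique u mu i j psi M : is_deriv_measure Omega u mu ->
  measurable_fun Omega psi -> (forall x, Omega x -> `|psi x| <= M) ->
  charge_integral (deriv_measure Omega u i j) Omega psi =
  charge_integral (mu i j) Omega psi.
Proof.
move=> umu; apply: charge_integral_unique => // phi tphi.
have := deriv_measureP (ex_intro _ _ umu) i j => -[_ /(_ _ tphi)].
by have [_ ->//] := umu i j => /oppr_inj.
Qed.

Lemma weak_grad_deriv_measure u (G : 'rV[R]_n -> 'M[R]_(N, n)) :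
  (forall i j, leb.-integrable Omega (EFin \o (fun x => G x i j))) ->
  is_weak_grad Omega u G ->
  exists2 mu, is_deriv_measure Omega u mu &
    forall i j psi M, measurable_fun Omega psi -> (forall x, Omega x -> `|psi x| <= M) ->
      charge_integral (mu i j) Omega psi = \int[leb]_(x in Omega) (psi x * G x i j).
Proof.
move=> iG uG.
have /choice[mu muP] : forall ij : 'I_N * 'I_n, exists nu : {charge set 'rV[R]_n -> \bar R},
    (forall A, measurable A -> nu A = nu (A `&` Omega)) /\
    (forall psi M, measurable_fun Omega psi -> (forall x, Omega x -> `|psi x| <= M) ->
      charge_integral nu Omega psi = \int[leb]_(x in Omega) (psi x * G x ij.1 ij.2)).
  by move=> [i j]; exact: (density_charge oOmega (iG i j)).
exists (fun i j => mu (i, j)); last by move=> i j; exact: (muP (i, j)).2.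
move=> i j; split; first exact: (muP (i, j)).1.
move=> phi tphi; have [M phiM] := test_function_bounded tphi.
have mphi : measurable_fun Omega phi.
  by apply: measurable_funTS; exact: test_function_measurable tphi.
rewrite ((muP (i, j)).2 phi M mphi (fun x _ => phiM x)) (uG i j).2//.
by congr (- _); apply: eq_Rintegral => x _; rewrite mulrC.
Qed.

(** The minimizer if no competitor has finite energy. *)
Lemma BV_zero : BV Omega (fun=> 0 : 'cV[R]_N).
Proof.
have i0 : leb.-integrable Omega (EFin \o (fun=> 0 : R)) by exact: integrable0.
have e0 (p r : nat) (a : 'I_p) (b : 'I_r) :
    (fun _ : 'rV[R]_n => (0 : 'M[R]_(p, r)) a b) = fun=> 0.
  by apply/funext => x; rewrite mxE.
split=> [i|]; first by apply: Lp_on1 => //; rewrite e0.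
have [|i j|mu ? _] := @weak_grad_deriv_measure (fun=> 0) (fun=> 0); last by exists mu.
  by move=> i j; rewrite e0.
split; first by rewrite e0; exact: integrable_L1loc.
move=> phi tphi; under eq_Rintegral do rewrite mxE mul0r.
under [in RHS]eq_Rintegral do rewrite mxE mul0r.
by rewrite Rintegral_cst// mul0r oppr0.
Qed.

Lemma Rintegral_test (m : finmeas) phi : test_function Omega phi ->
  \int[m]_x phi x = \int[m]_(x in Omega) phi x.
Proof. by move=> tphi; rewrite [RHS]Rintegral_mkcond test_function_restrict. Qed.

(** Integration by parts passes to the limit, which makes the limit measures
    the derivative of the limit function. *)
Lemma BV_weak_star_limit (u_ : nat -> 'rV[R]_n -> 'cV[R]_N) u
    (G : nat -> 'rV[R]_n -> 'M[R]_(N, n)) (m : 'I_N -> 'I_n -> finmeas * finmeas) :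
  (forall k i, leb.-integrable Omega (EFin \o (fun x => u_ k x i 0))) ->
  (forall i, leb.-integrable Omega (EFin \o (fun x => u x i 0))) ->
  (forall i, \int[leb]_(x in Omega) `|u_ k x i 0 - u x i 0| @[k --> \oo] --> (0 : R)) ->
  (forall k i j, leb.-integrable Omega (EFin \o (fun x => G k x i j))) ->
  (forall k, is_weak_grad Omega (u_ k) (G k)) ->
  (forall i j psi M, continuous psi -> (forall x, `|psi x| <= M) ->
    \int[leb]_(x in Omega) (psi x * G k x i j) @[k --> \oo] -->
    \int[(m i j).1]_x psi x - \int[(m i j).2]_x psi x) ->
  BV_weak_star_cvg Omega u_ u.
Proof.
move=> iu_ iu cvu iG uG cvG.
have /choice[nu nuP] : forall ij : 'I_N * 'I_n, exists nu : {charge set 'rV[R]_n -> \bar R},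
    (forall A, measurable A -> nu A = nu (A `&` Omega)) /\
    (forall A, measurable A -> A `<=` Omega ->
       nu A = (m ij.1 ij.2).1 A - (m ij.1 ij.2).2 A)%E.
  by move=> [i j]; exact: charge_of_difference.
have nuE i j psi M : measurable_fun Omega psi -> (forall x, Omega x -> `|psi x| <= M) ->
    charge_integral (nu (i, j)) Omega psi =
    \int[(m i j).1]_(x in Omega) psi x - \int[(m i j).2]_(x in Omega) psi x.
  by move=> mpsi psiM; apply: (charge_integral_diff mOmega mpsi psiM); exact: (nuP (i, j)).2.
have unu : is_deriv_measure Omega u (fun i j => nu (i, j)).
  move=> i j; split; first exact: (nuP (i, j)).1.
  move=> phi tphi; have [M phiM] := test_function_bounded tphi.
  have cphi := test_function_continuous tphi.
  have mphi : measurable_fun Omega phi.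
    by apply: measurable_funTS; exact: test_function_measurable tphi.
  rewrite (nuE i j phi M mphi (fun x _ => phiM x)) -!Rintegral_test//.
  have lim1 := cvG i j phi M cphi phiM.
  have tdphi := test_function_pderiv j tphi.
  have [L dphiL] := test_function_bounded tdphi.
  have lim2 : \int[leb]_(x in Omega) (u_ k x i 0 * pderiv j phi x) @[k --> \oo] -->
      \int[leb]_(x in Omega) (u x i 0 * pderiv j phi x).
    apply: (L1_cvg_pairing (f_ := fun k x => u_ k x i 0) (f := fun x => u x i 0)
      (fun k => iu_ k i) (iu i) (cvu i) _ (fun x _ => dphiL x)).
    by apply: measurable_funTS; exact: test_function_measurable tdphi.
  have lim3 : (- \int[leb]_(x in Omega) (phi x * G k x i j)) @[k --> \oo] -->
      - (\int[(m i j).1]_x phi x - \int[(m i j).2]_x phi x) by exact: cvgN.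
  apply: (cvg_unique _ lim2) => //; apply: cvg_trans lim3.
  apply: near_eq_cvg; apply: nearW => k; rewrite /= (uG k i j).2//.
  by congr (- _); apply: eq_Rintegral => x _; rewrite mulrC.
split.
- move=> k; split; first by move=> i; exact: Lp_on1.
  by have [mu ? _] := weak_grad_deriv_measure (iG k) (uG k); exists mu.
- by split; [move=> i; exact: Lp_on1|exists (fun i j => nu (i, j))].
- by move=> i; exact: Lp_cvg1.
move=> i j psi psi0; have [cpsi [M psiM]] := C0_function_extension psi0.
have psiOM x : Omega x -> `|psi x| <= M.
  by move=> Ox; move: (psiM x); rewrite /patch mem_set.
have mpsi : measurable_fun Omega psi.
  by apply/(measurable_restrictT psi mOmega); exact: continuous_mx_measurable.
rewrite (deriv_measure_unique i j unu mpsi psiOM) (nuE i j psi M)//.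
have extE (p : finmeas) : \int[p]_(x in Omega) psi x = \int[p]_x (psi \_ Omega) x.
  by rewrite Rintegral_mkcond.
rewrite !extE.
apply: cvg_trans (cvG i j _ M cpsi psiM).
apply: near_eq_cvg; apply: nearW => k.
have [mu umu muE] := weak_grad_deriv_measure (iG k) (uG k).
rewrite (deriv_measure_unique i j umu mpsi psiOM) (muE i j psi M)//.
by apply: eq_Rintegral => x xO; rewrite /patch xO.
Qed.

Lemma limn_einf_ge (a : (\bar R)^nat) m : (forall k, m <= a k)%E -> (m <= limn_einf a)%E.
Proof.
move=> ma; rewrite limn_einf_lim; apply: lime_ge; first exact: is_cvg_einfs.
by apply: nearW => k; apply: le_ereal_inf_tmp => _ [l _ <-].
Qed.

Lemma relaxed_functional_ge (F : 'M[R]_(N, n) -> R) q u0 m u :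
  (forall w, W1_0 Omega q (w \- u0)%R ->
     m <= \int[leb]_(x in Omega) (F (wgrad Omega w x))%:E)%E ->
  (m <= relaxed_functional F q u0 Omega u)%E.
Proof.
move=> mE; apply: le_ereal_inf_tmp => _ [u_ [u_W _ ->]].
by apply: limn_einf_ge => k; exact: mE.
Qed.

Lemma relaxed_functional_le (F : 'M[R]_(N, n) -> R) q u0 l u (u_ : nat -> 'rV[R]_n -> 'cV[R]_N) :
  (forall k, W1_0 Omega q (u_ k \- u0)) -> BV_weak_star_cvg Omega u_ u ->
  (fun k => \int[leb]_(x in Omega) (F (wgrad Omega (u_ k) x))%:E)%E @ \oo --> l ->
  (relaxed_functional F q u0 Omega u <= l)%E.
Proof.
move=> u_W cvu cvE; apply: ereal_inf_lbound; exists u_; split => //.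
by rewrite (cvg_limn_einf_sup cvE).
Qed.

End BV_facts.

(** * Compactness *)

Section compactness.
Variables (R : realType) (n N : nat) (Omega : set 'rV[R]_n) (q : R).
Hypotheses (n_gt0 : (0 < n)%N) (oOmega : open Omega) (bOmega : bounded_set Omega).
Hypothesis q1 : 1 <= q.
Local Notation leb := (lebesgue_rV R n).

Let mOmega : measurable Omega. Proof. exact: open_mx_measurable. Qed.

Lemma L1norm_test_function phi : test_function Omega phi ->
  L1norm phi = (\int[leb]_(x in Omega) `|phi x|)%:E.
Proof.
move=> tphi; rewrite Rintegral_abs_EFin//; last first.
  exact: (integrableS measurableT mOmega (@subsetT _ _)
    (test_function_integrable oOmega bOmega tphi)).
rewrite [RHS]integral_mkcond; apply: eq_integral => x _; rewrite /patch.
case: ifPn => // xO; rewrite (test_function0 tphi) ?normr0// => Ox.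
by move: xO; rewrite mem_set.
Qed.

Lemma bounded_subset_compact : exists2 X : set 'rV[R]_n, compact X & Omega `<=` X.
Proof.
have [M [_ HM]] := bOmega; pose r := `|M| + 1.
exists [set x : 'rV[R]_n | forall i, `|(0 : 'rV[R]_n) 0 i - x 0 i| <= r].
  exact: closed_box_compact.
move=> x Ox i; rewrite mxE sub0r normrN; apply: le_trans (normr_coord x i) _.
by apply: HM => //; rewrite ltr_pwDr// ler_norm.
Qed.

Variables (u0 : 'rV[R]_n -> 'cV[R]_N) (u_ : nat -> 'rV[R]_n -> 'cV[R]_N) (B : R).
Hypotheses (u0_W1 : W1 Omega q u0) (u_W1 : forall k, W1_0 Omega q (u_ k \- u0)).
Hypothesis iG : forall k i j,
  leb.-integrable Omega (EFin \o (fun x => wgrad Omega (u_ k) x i j)).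
Hypothesis GB : forall k i j, \int[leb]_(x in Omega) `|wgrad Omega (u_ k) x i j| <= B.

(** Test functions close to u_k - u_0 satisfy the Poincaré inequality, hence
    Rellich's theorem applies to them and the limit is strong in L^1, while the
    gradients only converge as measures. *)
Lemma W1_0_compactness : exists (sigma : nat -> nat) (u : 'rV[R]_n -> 'cV[R]_N),
  (forall k, (k <= sigma k)%N) /\ BV_weak_star_cvg Omega (u_ \o sigma) u.
Proof.
have /choice[phi phiP] k : exists phi : 'I_N -> 'rV[R]_n -> R,
    [/\ forall i, test_function Omega (phi i),
      forall i, \int[leb]_(x in Omega) `|phi i x - (u_ k x i 0 - u0 x i 0)| <= k.+1%:R^-1 &
      forall i j, \int[leb]_(x in Omega) `|pderiv j (phi i) x| <=
        \int[leb]_(x in Omega) `|wgrad Omega (u_ k) x i j| +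
        \int[leb]_(x in Omega) `|wgrad Omega u0 x i j| + k.+1%:R^-1].
  by apply: (W1_0_test_approx oOmega bOmega q1 u0_W1 (u_W1 k) (iG k)); rewrite invr_gt0.
have tphi k i : test_function Omega (phi k i) by case: (phiP k).
pose D i j := B + \int[leb]_(x in Omega) `|wgrad Omega u0 x i j| + 1.
have phiD k i j : (L1norm (pderiv j (phi k i)) <= (D i j)%:E)%E.
  rewrite L1norm_test_function; last exact: test_function_pderiv.
  rewrite lee_fin; have [_ _ /(_ i j)/le_trans->//] := phiP k.
  by rewrite /D !lerD// invf_le1// ler1n.
pose j0 := Ordinal n_gt0; have [h hP] := poincare bOmega j0.
pose C i := `|h| * D i j0.
have phiC k i : (L1norm (phi k i) <= (C i)%:E)%E.
  apply: le_trans (hP _ (tphi k i)) _; rewrite EFinM.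
  apply: (@le_trans _ _ (`|h|%:E * L1norm (pderiv j0 (phi k i)))%E).
    by rewrite lee_wpmul2r ?L1norm_ge0// lee_fin ler_norm.
  by rewrite lee_wpmul2l// lee_fin.
have iphi k i : leb.-integrable Omega (EFin \o phi k i).
  exact: (integrableS measurableT mOmega (@subsetT _ _)
    (test_function_integrable oOmega bOmega (tphi k i))).
pose f (t : 'I_N * option 'I_n) k := if t.2 is Some j
  then fun x => wgrad Omega (u_ k) x t.1 j else phi k t.1.
have [X cX OX] := bounded_subset_compact.
have [sigma [m [sigma_ge cvf]]] : exists (sigma : nat -> nat)
    (m : 'I_N * option 'I_n ->
      {finite_measure set 'rV[R]_n -> \bar R} * {finite_measure set 'rV[R]_n -> \bar R}),
    (forall k, (k <= sigma k)%N) /\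
    forall t (psi : 'rV[R]_n -> R) M, continuous psi -> (forall x, `|psi x| <= M) ->
      \int[leb]_(x in Omega) (psi x * f t (sigma k) x) @[k --> \oo] -->
      \int[(m t).1]_x psi x - \int[(m t).2]_x psi x.
  apply: (L1_weak_compactness mOmega cX (compact_mx_measurable cX) OX
    (C := fun t => if t.2 is Some j then B else C t.1)).
    by move=> [i [j|]] k /=; [exact: iG|exact: iphi].
  move=> [i [j|]] k /=; first exact: GB.
  by rewrite -lee_fin -L1norm_test_function; [exact: phiC|exact: tphi].
have /choice[w wP] i : exists w : 'rV[R]_n -> R, leb.-integrable Omega (EFin \o w) /\
    \int[leb]_(x in Omega) `|phi (sigma k) i x - w x| @[k --> \oo] --> (0 : R).
  apply: (L1_complete mOmega (f := fun k => phi (sigma k) i)) => //.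
  apply: (rellich oOmega bOmega (phi := fun k => phi (sigma k) i)
    (B := \sum_(j < n) D i j) (C := C i)) => // [k|psi M cpsi psiM].
    by rewrite -sumEFin; apply: lee_sum => j _; exact: phiD.
  by apply: (cvgP _ (cvf (i, None) psi M cpsi psiM)).
pose u x : 'cV[R]_N := \col_i (w i x + u0 x i 0).
have iw i : leb.-integrable Omega (EFin \o w i) by have [] := wP i.
have iu0 i := W1_integrable oOmega bOmega q1 u0_W1 i.
have uE i : (fun x => u x i 0) = (fun x => w i x + u0 x i 0).
  by apply/funext => x; rewrite mxE.
have iu i : leb.-integrable Omega (EFin \o (fun x => u x i 0)).
  by rewrite uE; exact: integrable_add.
have iu_ k i : leb.-integrable Omega (EFin \o (fun x => u_ k x i 0)).
  exact: (translate_integrable oOmega bOmega q1 u0_W1 (u_W1 k)).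
have iN (g : 'rV[R]_n -> R) : leb.-integrable Omega (EFin \o g) ->
    leb.-integrable Omega (EFin \o (fun x => `|g x|)).
  by move=> intg; exact: integrable_norm intg.
have inv0 : (fun k => (sigma k).+1%:R^-1) @ \oo --> (0 : R).
  apply: (squeeze_cvgr _ (cvg_cst 0) (@cvg_harmonic R)).
  apply: nearW => k; rewrite /= invr_ge0 ler0n /=.
  by rewrite lef_pV2 ?posrE// ler_nat ltnS.
have cvu i : \int[leb]_(x in Omega) `|u_ (sigma k) x i 0 - u x i 0| @[k --> \oo] --> (0 : R).
  have lim0 : (sigma k).+1%:R^-1 +
      \int[leb]_(x in Omega) `|phi (sigma k) i x - w i x| @[k --> \oo] --> (0 : R).
    by rewrite -[X in _ --> X]addr0; apply: cvgD => //; have [] := wP i.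
  apply: (squeeze_cvgr _ (cvg_cst 0) lim0); apply: nearW => k; apply/andP; split.
    exact: Rintegral_ge0.
  have [_ /(_ i) phik _] := phiP (sigma k).
  apply: le_trans (lerD phik (lexx _)).
  have i1 := iN _ (integrable_sub oOmega (iphi (sigma k) i)
    (integrable_sub oOmega (iu_ (sigma k) i) (iu0 i))).
  have i2 := iN _ (integrable_sub oOmega (iphi (sigma k) i) (iw i)).
  rewrite -RintegralD//; apply: le_Rintegral => //.
  - by apply: iN; exact: integrable_sub.
  - exact: integrable_add.
  move=> x _; rewrite mxE -(normrN (phi _ _ _ - (_ - _))).
  rewrite [X in `|X| <= _](_ : _ = - (phi (sigma k) i x - (u_ (sigma k) x i 0 - u0 x i 0)) +
    (phi (sigma k) i x - w i x)); last by ring.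
  exact: ler_normD.
exists sigma, u; split => //.
apply: (BV_weak_star_limit oOmega (u_ := u_ \o sigma) (u := u)
  (G := fun k => wgrad Omega (u_ (sigma k))) (m := fun i j => m (i, Some j))) => //.
- by move=> k i; exact: iu_.
- by move=> k; exact: (translate_wgrad oOmega bOmega q1 u0_W1 (u_W1 (sigma k))).
- by move=> i j psi M cpsi psiM; exact: (cvf (i, Some j) psi M cpsi psiM).
Qed.

End compactness.

(** * Existence of a minimizer *)

Unset Implicit Arguments.

Theorem lemma4p2 (R : realType) (n N : nat) (n_gt0 : (0 < n)%N)
  (N_gt0 : (0 < N)%N) (Omega : set 'rV[R]_n) (q gamma Gamma : R)
  (u0 : 'rV[R]_n -> 'cV[R]_N) (F : 'M[R]_(N, n) -> R)
  (Omega_open : open Omega) (Omega_bounded : bounded_set Omega)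
  (Omega_lipschitz : lipschitz_boundary Omega)
  (q_ge1 : 1 <= q) (gamma_gt0 : 0 < gamma) (gamma_le_Gamma : gamma <= Gamma)
  (u0_W1q : W1 Omega q u0)
  (F_continuous : continuous F)
  (F_convex : convex_function [set: 'M[R]_(N, n)] F)
  (F_growth : forall z : 'M[R]_(N, n),
     gamma * enorm z <= F z /\ F z <= Gamma * (1 + enorm z `^ q)) :
  exists u : 'rV[R]_n -> 'cV[R]_N, BV Omega u /\
    forall v : 'rV[R]_n -> 'cV[R]_N, BV Omega v ->
      (relaxed_functional F q u0 Omega u <= relaxed_functional F q u0 Omega v)%E.
Proof.
pose E w := (\int[lebesgue_rV R n]_(x in Omega) (F (wgrad Omega w x))%:E)%E.
pose m := ereal_inf [set E w | w in [set w | W1_0 Omega q (w \- u0)]].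
have F_coercive z : gamma * enorm z <= F z by have [] := F_growth z.
have m_le w : W1_0 Omega q (w \- u0) -> (m <= E w)%E.
  by move=> wW; apply: ereal_inf_lbound; exists w.
have relaxed_ge v : (m <= relaxed_functional F q u0 Omega v)%E.
  exact: relaxed_functional_ge.
suff [u [u_BV u_le]] : exists u, BV Omega u /\ (relaxed_functional F q u0 Omega u <= m)%E.
  exists u; split; first exact: u_BV.
  move=> v _; exact: le_trans u_le (relaxed_ge v).
have E_ge0 w : (0 <= E w)%E.
  by apply: integral_ge0 => x _; rewrite lee_fin; exact: (coercive_ge0 gamma_gt0).
have m_ge0 : (0 <= m)%E by apply: le_ereal_inf_tmp => _ [w _ <-].
have [my|m_fin] := eqVneq m +oo%E.
  (* every function minimizes the relaxed functional *)
  by exists (fun=> 0); split; [exact: BV_zero|rewrite my leey].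
have {}m_fin : m \is a fin_num by rewrite ge0_fin_numE// ltey.
(* a minimizing sequence; the constant bound on its energies bounds the gradients *)
have /choice[u_ u_P] k : exists w, W1_0 Omega q (w \- u0) /\ (E w <= m + k.+1%:R^-1%:E)%E.
  have e_gt0 : 0 < k.+1%:R^-1 :> R by rewrite invr_gt0.
  have [_ [w wW <-] wE] := lb_ereal_inf_adherent e_gt0 m_fin.
  by exists w; split => //; exact: ltW.
have E_le k : (E (u_ k) <= (fine m + 1)%:E)%E.
  have [_ /le_trans->//] := u_P k.
  by rewrite EFinD fineK// leeD2l// lee_fin invf_le1// ler1n.
have u_grad k := translate_wgrad Omega_open Omega_bounded q_ge1 u0_W1q (u_P k).1.
have G_bound k i j := energy_controls_gradient Omega_open F_continuous gamma_gt0 F_coercive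
  i j (fun i j => L1loc_measurable Omega_open (u_grad k i j).1) (E_le k).
have [sigma [u [sigma_ge cvu]]] := W1_0_compactness n_gt0 Omega_open Omega_bounded q_ge1
  u0_W1q (fun k => (u_P k).1) (fun k i j => (G_bound k i j).1) (fun k i j => (G_bound k i j).2).
exists u; split; first by case: cvu.
apply: relaxed_functional_le cvu _; first by move=> k; exact: (u_P _).1.
have cvm : (fun k => m + k.+1%:R^-1%:E)%E @ \oo --> m.
  rewrite -[X in _ --> X]adde0; apply: cvgeD => //; first by rewrite fin_num_adde_defr.
    exact: cvg_cst.
  by apply: cvg_EFin; [exact: nearW|exact: cvg_harmonic].
apply: (squeeze_cvge _ (cvg_cst m) cvm); apply: nearW => k; apply/andP; split.
  exact: m_le (u_P _).1.
apply: le_trans (u_P _).2 _.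
by rewrite leeD2l// lee_fin lef_pV2 ?posrE// ler_nat ltnS.
Qed.
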